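(* Let $\Bbbk$ be an arbitrary field and $S=\Bbbk[x_1,\dots,x_n]$. Let $r\le n$ and let $2\le e_1\le e_2\le\cdots\le e_r$ be integers. Suppose $I\subset S$ is a homogeneous ideal containing a regular sequence of monomials $f_1,\dots,f_r$ with $\deg f_i=e_i$ for all $i$. Put $P=(x_1^{e_1},\dots,x_r^{e_r})$. Then there exists a lex-plus-$P$ ideal $L$ such that $L$ has the same Hilbert function as $I$ and $b_{i,j}(L)\ge b_{i,j}(I)$ for all $i,j$.
   Context: $S$ is standard graded ($\deg x_i=1$). The Hilbert function of a graded module $M$ is $d\mapsto\dim_{\Bbbk}M_d$. The graded Betti numbers are $b_{i,j}(M)=\dim_{\Bbbk}\operatorname{Tor}^S_i(\Bbbk,M)_j$. The (graded) lexicographic order: for monomials of the same degree, $x_1^{p_1}\cdots x_n^{p_n}>_{\mathrm{lex}}x_1^{q_1}\cdots x_n^{q_n}$ if there is an $i$ with $p_i>q_i$ and $p_j=q_j$ for all $j<i$. A monomial ideal $\hat L\subset S$ is lex if, whenever $u,v$ are monomials of the same degree with $u<_{\mathrm{lex}}v$ and $u\in \hat L$, then $v\in \hat L$. An ideal $L\supseteq P$ is lex-plus-$P$ if there is a lex ideal $\hat L$ with $L=\hat L+P$. *)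

(* Defs.v *)
From HB Require Import structures.
From mathcomp Require Import all_boot all_order all_algebra.
From mathcomp Require Import boolp classical_sets.
From mathcomp Require Import mpoly.

Set Implicit Arguments.
Unset Strict Implicit.
Unset Printing Implicit Defensive.

Import GRing.Theory.
Local Open Scope classical_set_scope.
Local Open Scope ring_scope.

Section Ideals.
Context {A : comNzRingType}.
Implicit Types I J G : set A.

Definition is_ideal I : Prop :=
  [/\ I 0, forall p q, I p -> I q -> I (p + q) & forall a p, I p -> I (a * p)].

Definition ideal_gen G : set A := smallest is_ideal G.

Definition ideal_sum I J : set A := [set p + q | p in I & q in J].

Definition regular_sequence r (f : 'I_r -> A) : Prop :=
  (forall (i : 'I_r) (g : A),
     ideal_gen (f @` [set j : 'I_r | (j < i)%N]) (f i * g) ->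
     ideal_gen (f @` [set j : 'I_r | (j < i)%N]) g)
  /\ ~ ideal_gen (range f) 1.

End Ideals.

Section Dimension.
Context {k : fieldType} {V : lmodType k}.

(* z induces a k-basis of Z / B, for subspaces B `<=` Z of V. *)
Definition basis_mod (Z B : set V) m (z : 'I_m -> V) : Prop :=
  [/\ forall l, Z (z l),
      forall c : 'I_m -> k, B (\sum_l c l *: z l) -> forall l, c l = 0
    & forall v, Z v -> exists c : 'I_m -> k, B (v - \sum_l c l *: z l)].

(* The dimension of Z / B; the default 0 is only used when Z / B has infinite
   dimension. *)
Definition dim_mod (Z B : set V) : nat :=
  xget 0%N [set m | exists z : 'I_m -> V, basis_mod Z B z].

End Dimension.

Section Polynomials.
Context {k : fieldType} {n : nat}.
Local Notation S := {mpoly k[n]}.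
Implicit Types I L P : set S.

Definition homogeneous_ideal I : Prop :=
  is_ideal I /\ forall p d, I p -> I (pihomog mdeg d p).

Definition hilbert I (d : nat) : nat :=
  dim_mod [set p | I p /\ p \is d.-homog] [set 0].

Definition monomial_ideal I : Prop :=
  exists M : set 'X_{1..n}, I = ideal_gen [set 'X_[m] | m in M].

Definition lex_gt (u v : 'X_{1..n}) : Prop :=
  exists i : 'I_n, (v i < u i)%N /\ forall j : 'I_n, (j < i)%N -> u j = v j.

Definition lex_ideal L : Prop :=
  monomial_ideal L /\
  forall u v : 'X_{1..n},
    mdeg u = mdeg v -> lex_gt v u -> L 'X_[u] -> L 'X_[v].

Definition lex_plus P L : Prop :=
  [/\ is_ideal L, P `<=` L & exists2 L', lex_ideal L' & L = ideal_sum L' P].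

Definition pure_powers r (hr : (r <= n)%N) (e : 'I_r -> nat) : set S :=
  ideal_gen (range (fun i : 'I_r => 'X_(widen_ord hr i) ^+ e i)).

(* p belongs to the degree j component of the twisted module S(-t). *)
Definition twisted_homog (t j : nat) (p : S) : bool :=
  if (t <= j)%N then p \is (j - t).-homog else p == 0.

End Polynomials.

(* A sequence of graded free modules F_i = \bigoplus_(a : gens i) S(- gdeg a),
   with maps F_(i.+1) -> F_i given by matrices over S = k[x_1, .., x_n]. *)
Record free_seq (k : fieldType) (n : nat) := FreeSeq {
  gens : nat -> finType;
  gdeg : forall i, gens i -> nat;
  dmat : forall i, gens i.+1 -> gens i -> {mpoly k[n]} }.

Arguments gdeg {k n} f {i}.
Arguments dmat {k n} f {i}.

Section Tor.
Context {k : fieldType} {n : nat}.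
Local Notation S := {mpoly k[n]}.
Implicit Types (F : free_seq k n) (I : set S).

Definition bdry F i (v : {ffun gens F i.+1 -> S}) : {ffun gens F i -> S} :=
  [ffun b => \sum_a v a * dmat F a b].

(* The S-linear map F_0 -> k = S / (x_1, .., x_n) with a |-> eps a. *)
Definition augmentation F (eps : gens F 0 -> k) (v : {ffun gens F 0 -> S}) : k :=
  \sum_a (v a)@_0%MM * eps a.

(* ... -> F_1 -> F_0 -> k -> 0 is exact, with maps of degree 0. *)
Definition graded_free_resolution F (eps : gens F 0 -> k) : Prop :=
  [/\ forall i (a : gens F i.+1) (b : gens F i),
        twisted_homog (gdeg F b) (gdeg F a) (dmat F a b),
      forall a, eps a != 0 -> gdeg F a = 0%N,
      forall c, exists v, augmentation eps v = c,
      forall v, augmentation eps v = 0 <-> exists w, v = @bdry F 0 w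
    & forall i (v : {ffun gens F i.+1 -> S}),
        bdry v = 0 <-> exists w, v = @bdry F i.+1 w].

(* As F_i is free, F_i \otimes_S I is the submodule of F_i of the vectors
   with all coordinates in I; this is its component of degree j. *)
Definition tensor_homog F I i j : set {ffun gens F i -> S} :=
  [set v | forall a, I (v a) /\ twisted_homog (gdeg F a) j (v a)].

Definition tor_cycles F I i j : set {ffun gens F i -> S} :=
  match i with
  | 0 => tensor_homog I j
  | i'.+1 => [set v | tensor_homog I j v /\ bdry v = 0]
  end.

Definition tor_boundaries F I i j : set {ffun gens F i -> S} :=
  [set bdry w | w in tensor_homog I j].

(* When F is a graded free resolution of k, this is dim_k Tor^S_i(k, I)_j. *)
Definition tor_dim F I i j : nat :=
  dim_mod (@tor_cycles F I i j) (@tor_boundaries F I i j).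

End Tor.

Section Koszul.
Variables (k : fieldType) (n : nat).
Local Notation S := {mpoly k[n]}.

Definition ksign (a : 'I_n) (B : {set 'I_n}) : S :=
  (-1) ^+ #|[set b in B | (b < a)%N]|.

(* The Koszul complex: the generators e_A of F_i are indexed by the i-subsets
   A of the variables, and d e_A = \sum_(a in A) +/- x_a e_(A :\ a). *)
Definition koszul : free_seq k n := {|
  gens i := {A : {set 'I_n} | #|A| == i};
  gdeg i _ := i;
  dmat i A B := \sum_(a | (a \notin val B) && (val A == a |: val B))
                  ksign a (val B) * 'X_a |}.

End Koszul.

(* The graded Betti number b_(i,j)(I), with Tor^S(k, I) computed by the Koszul
   resolution of k; see koszul_resolution below. *)
Definition betti (k : fieldType) (n : nat) (I : set {mpoly k[n]}) (i j : nat) :=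
  tor_dim (koszul k n) I i j.

Section KoszulResolution.
Context {k : fieldType} {n : nat}.
Local Notation S := {mpoly k[n]}.
Implicit Types (V : {set 'I_n} -> S) (A B C : {set 'I_n}).

Let D V B : S := \sum_(a | a \notin B) ksign k a B * 'X_a * V (a |: B).

Lemma ksign_lt (a b : 'I_n) B : (a < b)%N -> a \notin B ->
  ksign k b (a |: B) = - ksign k b B.
Proof.
move=> ab aB; rewrite /ksign.
have -> : [set c in a |: B | (c < b)%N] = (a |: [set c in B | (c < b)%N])%SET.
  by apply/setP=> c; rewrite !inE; case: eqP => //= ->; rewrite ab.
by rewrite cardsU1 inE (negPf aB) /= add1n exprS mulN1r.
Qed.

Lemma ksign_ge (a b : 'I_n) B : (b <= a)%N -> ksign k b (a |: B) = ksign k b B.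
Proof.
move=> ab; rewrite /ksign; congr (_ ^+ _); apply: eq_card => c; rewrite !inE.
by case: eqP => //= ->; rewrite ltnNge ab andbF.
Qed.

Lemma ksign_min (a : 'I_n) B : (forall c : 'I_n, c \in B -> (a <= c)%N) ->
  ksign k a B = 1.
Proof.
move=> h; rewrite /ksign (_ : [set b in B | _] = finset.set0) ?cards0 //.
by apply/setP=> c; rewrite !inE; case cB: (c \in B) => //=; rewrite ltnNge h.
Qed.

Lemma koszul_dd V B : D (D V) B = 0.
Proof.
pose t (a b : 'I_n) : S := ksign k a B * 'X_a *
  (ksign k b (a |: B) * 'X_b * V (b |: (a |: B))).
have tN (a b : 'I_n) : (a < b)%N -> a \notin B -> t b a = - t a b.
  move=> ab aB; rewrite /t (ksign_ge _ (ltnW ab)) (ksign_lt ab aB) finset.setUCA.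
  by rewrite !mulNr mulrN opprK mulrCA.
transitivity (\sum_(a | a \notin B) \sum_(b | (b \notin B) && (b != a)) t a b).
  apply: eq_bigr => a aB; rewrite /D mulr_sumr; apply: eq_bigl => b.
  by rewrite !inE negb_or andbC.
pose P (a b : 'I_n) := (a \notin B) && (b \notin B).
transitivity (\sum_a \sum_(b | P a b && (a < b)%N) t a b
            + \sum_a \sum_(b | P a b && (b < a)%N) t a b).
  rewrite -big_split /= big_mkcond /=; apply: eq_bigr => a _.
  rewrite /P; case aB: (a \in B) => /=; first by rewrite !big_pred0_eq addr0.
  rewrite (bigID (fun b : 'I_n => (a < b)%N)) /=; congr (_ + _);
    apply: eq_bigl => b; rewrite -(inj_eq val_inj) /=;
    case: (b \in B) => //=; by case: ltngtP.
rewrite [X in _ + X](exchange_big_dep predT) //=.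
rewrite -big_split big1 //= => a _; apply/eqP; rewrite addr_eq0 -sumrN.
apply/eqP; apply: eq_big => [b|b /andP[/andP[aB _] ab]].
  by rewrite /P [(b \notin B) && _]andbC.
by rewrite (tN a b) ?opprK.
Qed.

(* p |-> the quotient by x_a of the part of p supported on the monomials
   x_a * m with Q m. *)
Let qpart (a : 'I_n) (Q : pred 'X_{1..n}) (p : S) : S :=
  \sum_(m <- msupp p | (0 < m a)%N && Q (m - U_(a))%MM)
    p@_m *: 'X_[(m - U_(a))%MM].

Lemma qpartE a Q p m : (qpart a Q p)@_m = if Q m then p@_(m + U_(a))%MM else 0.
Proof.
have mK (m' : 'X_{1..n}) : (0 < m' a)%N ->
    ((m' - U_(a))%MM == m) = (m' == (m + U_(a))%MM).
  move=> m'a; apply/eqP/eqP=> [<-|->]; last by rewrite addmK.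
  by rewrite submK // lep1mP -lt0n.
rewrite /qpart raddf_sum /=.
under eq_bigr do rewrite mcoeffZ mcoeffX.
case: (boolP (m + U_(a) \in msupp p)%MM) => [ms|mNs]; last first.
  rewrite (memN_msupp_eq0 mNs) if_same big_seq_cond big1 // => m'.
  case/and3P=> m's m'a _; rewrite mK //; case: eqP => [e|]; last by rewrite mulr0.
  by rewrite -e m's in mNs.
have ma : (0 < (m + U_(a))%MM a)%N by rewrite mnmDE mnm1E eqxx addn1.
case: ifP => Qm; last first.
  rewrite big1 // => m' /andP[m'a]; case: eqP => [->|]; first by rewrite Qm.
  by rewrite mulr0.
rewrite big_mkcond (bigD1_seq _ ms) ?msupp_uniq //= ma addmK Qm eqxx mulr1.
rewrite big1 ?addr0 // => m' m'm; case: ifP => // /andP[m'a _].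
by rewrite mK // (negPf m'm) mulr0.
Qed.

Lemma mcoeff_signXM (a : 'I_n) B p m :
  (ksign k a B * 'X_a * p)@_m
    = if (0 < m a)%N then (-1) ^+ #|[set b in B | (b < a)%N]| * p@_(m - U_(a))%MM
      else 0.
Proof.
rewrite /ksign -mulrA -signr_odd mulr_sign -[in RHS]signr_odd mulr_sign.
have -> : (if odd #|[set b in B | (b < a)%N]| then - ('X_a * p) else 'X_a * p)@_m
  = if odd #|[set b in B | (b < a)%N]| then - ('X_a * p)@_m else ('X_a * p)@_m.
  by case: ifP => // _; rewrite mcoeffN.
have -> : ('X_a * p)@_m = if (0 < m a)%N then p@_(m - U_(a))%MM else 0.
  case: ifP => ma.
    by rewrite mulrC -{1}[m](@submK _ U_(a)%MM) ?mcoeffMX 1?lep1mP -?lt0n // addmC mcoeffMX.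
  apply/memN_msupp_eq0/negP; rewrite mulrC => /msuppM_le.
  case/allpairsP=> -[u v] /= [_]; rewrite msuppX inE => /eqP -> mE.
  by move: ma; rewrite mE mnmDE mnm1E eqxx addn1.
by case: ifP => //; case: ifP => //; rewrite oppr0.
Qed.

(* No index smaller than a occurs in x^m e_A. *)
Let lst (a : 'I_n) (A : {set 'I_n}) (m : 'X_{1..n}) : bool :=
  [forall c : 'I_n, (c < a)%N ==> ((m c == 0%N) && (c \notin A))].

Let H V A : S := \sum_(a in A) qpart a (lst a A) (V (A :\ a)%SET).

Lemma koszul_contract V B :
    (forall C, #|C|.+1 = #|B| -> D V C = 0) ->
    (B = finset.set0 -> (V B)@_0%MM = 0) ->
  D (H V) B = V B.
Proof.
move=> hC h0; apply/mpolyP=> m; rewrite {1}/D raddf_sum /=.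
under eq_bigr do rewrite mcoeff_signXM.
pose occ (c : 'I_n) := (0 < m c)%N || (c \in B).
have [/pred0P occ0|/pred0Pn[a1 a1P]] := boolP (pred0b occ).
  have B0 : B = finset.set0.
    by apply/setP=> c; rewrite inE; have := occ0 c; rewrite /occ /=; case: (c \in B); rewrite ?orbT.
  have m0 c : m c = 0%N.
    by apply/eqP; have := occ0 c; rewrite /occ /=; case: (m c).
  have -> : m = 0%MM by apply/mnmP=> c; rewrite m0 mnm0E.
  by rewrite h0 // big1 // => a _; rewrite mnm0E.
have [a0 a0P a0min] : exists2 a0 : 'I_n, occ a0 & forall c, occ c -> (a0 <= c)%N.
  by case: (arg_minnP (fun c : 'I_n => c : nat) a1P) => a0 ? ?; exists a0.
have Hm (a : 'I_n) : a \notin B -> (0 < m a)%N ->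
   (H V (a |: B))@_(m - U_(a))%MM =
   if a0 \in (a |: B) then (V ((a |: B) :\ a0)%SET)@_(m - U_(a) + U_(a0))%MM else 0.
  move=> aB ma; rewrite /H raddf_sum /=.
  under eq_bigr do rewrite qpartE.
  have lstE c : c \in a |: B -> lst c (a |: B) (m - U_(a))%MM = (c == a0).
    move=> cB; apply/forallP/eqP=> [h|-> d].
      have co : occ c by move: cB; rewrite /occ !inE => /orP[/eqP->|->]; rewrite ?ma ?orbT.
      apply/val_inj/eqP; rewrite eqn_leq [(a0 <= c)%N]a0min // andbT leqNgt.
      apply/negP=> /(implyP (h a0)) /andP[]; rewrite !inE negb_or => m0 /andP[na nB].
      move: a0P; rewrite /occ (negPf nB) orbF lt0n; apply/negP; rewrite negbK.
      by move: m0; rewrite mnmBE mnm1E [a == a0]eq_sym (negPf na) subn0.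
    apply/implyP=> da; have : ~~ occ d by apply: contraL da => /a0min; rewrite -leqNgt.
    rewrite /occ negb_or -eqn0Ngt !inE negb_or => /andP[/eqP md ->].
    rewrite mnmBE md sub0n eqxx /= andbT; apply: contraTneq ma => <-.
    by rewrite md.
  case: ifP => a0B; last first.
    rewrite big1 // => c cB; rewrite lstE //; case: eqP => // ca.
    by rewrite -ca cB in a0B.
  rewrite (bigD1 a0) //= lstE // eqxx big1 ?addr0 // => c /andP[cB ca].
  by rewrite lstE // (negPf ca).
under eq_bigr => a aB.
  rewrite (_ : (if _ then _ else _) = if (0 < m a)%N && (a0 \in a |: B)
     then (-1) ^+ #|[set b in B | (b < a)%N]%SET| * (V ((a |: B) :\ a0)%SET)@_(m - U_(a) + U_(a0))%MM
     else 0); last first.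
    by case: ifP => //= ma; rewrite Hm //; case: ifP => //; rewrite mulr0.
  over.
case: (boolP (a0 \in B)) => a0B; last first.
  have ma0 : (0 < m a0)%N by move: a0P; rewrite /occ (negPf a0B) orbF.
  rewrite (bigD1 a0) //= ma0 !inE eqxx /= big1 ?addr0; last first.
    by move=> a /andP[aB aa]; rewrite !inE eq_sym (negPf aa) (negPf a0B) andbF.
  rewrite setU1K // submK ?lep1mP -?lt0n //.
  rewrite (_ : [set b in B | _]%SET = finset.set0) ?cards0 ?expr0 ?mul1r //.
  apply/setP=> b; rewrite !inE; case bB: (b \in B) => //=.
  by rewrite ltnNge a0min // /occ bB orbT.
have /(congr1 (fun p => p@_(m + U_(a0))%MM)) : D V (B :\ a0)%SET = 0.
  by apply: hC; rewrite (cardsD1 a0 B) a0B.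
rewrite {1}/D raddf_sum mcoeff0 /=.
under eq_bigr do rewrite mcoeff_signXM.
rewrite (bigD1 a0) /=; last by rewrite !inE eqxx.
rewrite mnmDE mnm1E eqxx addn1 /= addmK finset.setD1K //.
rewrite (_ : [set b in (B :\ a0)%SET | (b < a0)%N]%SET = finset.set0); last first.
  apply/setP=> b; rewrite !inE; case bB: (b \in B); rewrite ?andbF //=.
  by rewrite ltnNge a0min ?andbF // /occ bB orbT.
rewrite cards0 expr0 mul1r => /eqP; rewrite addr_eq0 => /eqP ->.
rewrite -sumrN; apply: eq_big => [a|a aB].
  by rewrite !inE; case: eqP => [->|]; rewrite ?a0B //= ?andbT ?andbF.
have aa : a != a0 by apply: contraNneq aB => ->.
rewrite !inE a0B orbT andbT mnmDE mnm1E [a0 == a]eq_sym (negPf aa) addn0.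
case: ifP => ma; last by rewrite oppr0.
have a0a : (a0 < a)%N.
  by rewrite ltn_neqAle eq_sym (inj_eq val_inj) aa a0min // /occ ma.
have -> : ((a |: B) :\ a0 = a |: (B :\ a0))%SET.
  by apply/setP=> c; rewrite !inE; case: (eqVneq c a) => [->|]; rewrite ?aa.
have -> : (m + U_(a0) - U_(a) = m - U_(a) + U_(a0))%MM.
  apply/mnmP=> c; rewrite !(mnmDE, mnmBE, mnm1E).
  by case: (eqVneq a c) => [<-|]; rewrite ?subn0 // eq_sym (negPf aa) !addn0.
have -> : [set b in B | (b < a)%N]%SET = (a0 |: [set b in B :\ a0 | (b < a)%N])%SET.
  by apply/setP=> c; rewrite !inE; case: eqP => [->|] //=; rewrite a0B a0a.
by rewrite cardsU1 !inE eqxx /= add1n exprS mulN1r mulNr.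
Qed.

Let ext i (v : {ffun gens (koszul k n) i -> S}) (A : {set 'I_n}) : S :=
  if insub A is Some a then v a else 0.

Let extE i (v : {ffun gens (koszul k n) i -> S}) a : ext v (val a) = v a.
Proof. by rewrite /ext valK. Qed.

Let ext0 i (v : {ffun gens (koszul k n) i -> S}) A : #|A| != i -> ext v A = 0.
Proof. by move=> h; rewrite /ext insubN. Qed.

Let bdryE i (v : {ffun gens (koszul k n) i.+1 -> S}) (b : gens (koszul k n) i) :
  bdry v b = D (ext v) (val b).
Proof.
rewrite /bdry ffunE /D /=.
under eq_bigr do rewrite mulr_sumr.
rewrite (exchange_big_dep (fun a => a \notin val b)) /=; last by move=> ? ? _ /andP[].
apply: eq_bigr => a ab.
have cab : #|a |: val b| == i.+1 by rewrite cardsU1 ab (eqP (valP b)).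
rewrite (big_pred1 (exist _ (a |: val b)%SET cab)); last first.
  by move=> c; rewrite /= ab /= -(inj_eq val_inj).
by rewrite [RHS]mulrC -extE.
Qed.

Let ext_bdry i (v : {ffun gens (koszul k n) i.+1 -> S}) A : ext (bdry v) A = D (ext v) A.
Proof.
case: (eqVneq #|A| i) => [/eqP cA|cA].
  by rewrite -[A]/(val (exist (fun A : {set 'I_n} => #|A| == i) A cA)) extE bdryE.
rewrite ext0 // /D big1 // => a aA; rewrite ext0 ?mulr0 //.
by rewrite cardsU1 aA eqSS.
Qed.

Lemma koszul_resolution : graded_free_resolution (F := koszul k n) (fun=> 1).
Proof.
have cycle_bdry i (v : {ffun gens (koszul k n) i -> S}) :
    (forall C, #|C|.+1 = i -> D (ext v) C = 0) ->
    (i = 0%N -> forall a, (v a)@_0%MM = 0) ->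
  exists w, v = @bdry _ _ (koszul k n) i w.
  move=> hC h0; exists [ffun b => H (ext v) (val b)].
  apply/ffunP=> b; rewrite bdryE.
  transitivity (D (H (ext v)) (val b)).
    rewrite koszul_contract ?extE // => [C|b0].
      by rewrite (eqP (valP b)); apply: hC.
    by apply: h0; rewrite -(eqP (valP b)) b0 cards0.
  rewrite /D; apply: eq_bigr => a ab; congr (_ * _).
  have cab : #|a |: val b| == i.+1 by rewrite cardsU1 ab (eqP (valP b)).
  by rewrite -[a |: val b]/(val (exist (fun A : {set 'I_n} => #|A| == i.+1) _ cab))
             extE ffunE.
have gen0 (a : gens (koszul k n) 0) : val a = finset.set0.
  by apply/eqP; rewrite -cards_eq0 (valP a).
pose z0 : gens (koszul k n) 0 := exist _ finset.set0 (introT eqP (cards0 'I_n)).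
have gen0E (a : gens (koszul k n) 0) : a = z0 by apply: val_inj; rewrite gen0.
have augE v : augmentation (F := koszul k n) (fun=> 1) v = (v z0)@_0%MM.
  rewrite /augmentation (big_pred1 z0) ?mulr1 // => a.
  by rewrite (gen0E a) /= eqxx.
split=> //.
- move=> i a b; rewrite /twisted_homog /= leqnSn subSnn.
  rewrite rpred_sum // => c _; rewrite /ksign -signr_odd mulr_sign.
  by case: odd; rewrite ?rpredN dhomogX /= mdeg1.
- move=> c; exists [ffun=> c%:MP]; rewrite augE ffunE.
  by rewrite mcoeffC eqxx mulr1.
- move=> v; rewrite augE; split=> [v0|[w ->]].
    by apply: cycle_bdry => // _ a; rewrite (gen0E a).
  rewrite bdryE /D raddf_sum big1 //= => a _.
  by rewrite mcoeff_signXM mnm0E.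
- move=> i v; split=> [v0|[w ->]].
    apply: cycle_bdry => // C [cC]; rewrite -ext_bdry v0 /ext.
    by case: insub => // x; rewrite ffunE.
  apply/ffunP=> b; rewrite bdryE ffunE.
  rewrite -[RHS](koszul_dd (ext w) (val b)) /D.
  by apply: eq_bigr => a _; rewrite ext_bdry.
Qed.

End KoszulResolution.

Section DimensionTheory.
Context {k : fieldType} {V : lmodType k}.
Implicit Types Z B : set V.

Definition subspace B : Prop :=
  B 0 /\ forall (c : k) u v, B u -> B v -> B (c *: u + v).

Let subspace_sum B (I : finType) (c : I -> k) (v : I -> V) :
  subspace B -> (forall i, B (v i)) -> B (\sum_i c i *: v i).
Proof.
by move=> [B0 BD] Bv; elim/big_rec: _ => // i x _ Bx; apply: BD.
Qed.

Lemma independent_le Z B m m' (z : 'I_m -> V) (z' : 'I_m' -> V) :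
    subspace B -> (forall l, Z (z l)) ->
    (forall c : 'I_m -> k, B (\sum_l c l *: z l) -> forall l, c l = 0) ->
    (forall v, Z v -> exists c : 'I_m' -> k, B (v - \sum_l c l *: z' l)) ->
  (m <= m')%N.
Proof.
move=> subB Zz indz spanz'; rewrite leqNgt; apply/negP=> lt_m'm.
have [T BT] := choice (fun l => spanz' _ (Zz l)).
pose M := \matrix_(l < m, j < m') T l j.
have : kermx M != 0.
  by rewrite kermx_eq0 /row_free neq_ltn (leq_ltn_trans (rank_leq_col _) lt_m'm).
case/rowV0Pn=> u /sub_kermxP uM; apply/negP; rewrite negbK; apply/eqP/rowP=> l.
rewrite mxE; apply: (indz (u 0)).
rewrite (_ : \sum_l _ = \sum_l u 0 l *: (z l - \sum_j T l j *: z' j)).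
  exact: subspace_sum.
under [RHS]eq_bigr do rewrite scalerBr; rewrite sumrB.
under [X in _ - X]eq_bigr do rewrite scaler_sumr.
rewrite exchange_big /= [X in _ - X]big1 ?subr0 // => j _.
have /rowP/(_ j) := uM; rewrite !mxE => uMj.
under eq_bigr do rewrite scalerA; rewrite -scaler_suml.
by rewrite (eq_bigr (fun l => u 0 l * M l j)) ?uMj ?scale0r // => i _; rewrite !mxE.
Qed.

Lemma dim_mod_eq Z B m (z : 'I_m -> V) :
  subspace B -> basis_mod Z B z -> dim_mod Z B = m.
Proof.
move=> subB bz; have [z' bz'] : exists z' : 'I_(dim_mod Z B) -> V, basis_mod Z B z'.
  by apply: (@xgetPex _ 0%N [set m | exists z : 'I_m -> V, basis_mod Z B z]);
     exists m, z.
case: bz bz' => [Zz iz sz] [Zz' iz' sz'].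
by apply/eqP; rewrite eqn_leq (independent_le subB Zz' iz' sz) (independent_le subB Zz iz sz').
Qed.

Lemma dim_modP Z B N (y : 'I_N -> V) :
    subspace Z -> subspace B ->
    (forall v, Z v -> exists c : 'I_N -> k, v = \sum_l c l *: y l) ->
  exists z : 'I_(dim_mod Z B) -> V, basis_mod Z B z.
Proof.
move=> subZ subB spany.
apply: (@xgetPex _ 0%N [set m | exists z : 'I_m -> V, basis_mod Z B z]).
pose ind m (z : 'I_m -> V) := (forall l, Z (z l)) /\
  forall c : 'I_m -> k, B (\sum_l c l *: z l) -> forall l, c l = 0.
have ind_le m (z : 'I_m -> V) : ind m z -> (m <= N)%N.
  case=> Zz iz; apply: (@independent_le Z [set 0] m N z y) => //.
  - by split=> // c _ _ -> ->; rewrite scaler0 addr0.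
  - by move=> c /= c0; apply: iz; rewrite c0; case: subB.
  - by move=> v /spany[c ->]; exists c; rewrite /= subrr.
have [m [[z [Zz iz]] mmax]] : exists m, (exists z, ind m z) /\
    forall m', (exists z, ind m' z) -> (m' <= m)%N.
  have ex : exists m, `[< exists z, ind m z >].
    by exists 0%N; apply/asboolP; exists (fun=> 0); split=> [[]|c _ []].
  have ub m : `[< exists z, ind m z >] -> (m <= N)%N by move/asboolP=> [z /ind_le].
  case: (ex_maxnP ex ub) => m /asboolP mz mmax; exists m; split=> // m' m'z.
  by apply: mmax; apply/asboolP.
exists m, z; split=> // v Zv; apply: contrapT => nspan.
pose z' (l : 'I_m.+1) := if unlift ord0 l is Some l' then z l' else v.
suff iz' : ind m.+1 z' by have := mmax _ (ex_intro _ z' iz'); rewrite ltnn.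
split=> [l|c]; first by rewrite /z'; case: unlift.
rewrite big_ord_recl {1}/z' unlift_none.
rewrite (eq_bigr (fun l => c (lift ord0 l) *: z l)); last first.
  by move=> l _; rewrite /z' liftK.
move=> Bc; have c0 : c ord0 = 0.
  apply: contrapT => /eqP c0; apply: nspan.
  exists (fun l => - ((c ord0)^-1 * c (lift ord0 l))).
  have [B0 BD] := subB; have := BD (c ord0)^-1 _ _ Bc B0.
  rewrite addr0 scalerDr scalerA mulVf // scale1r scaler_sumr -sumrN.
  by under eq_bigr do rewrite scalerA; under [in X in _ -> X]eq_bigr do rewrite scaleNr opprK.
move: Bc; rewrite c0 scale0r add0r => /iz ci l.
by case: (unliftP ord0 l) => [l' ->|->].
Qed.

End DimensionTheory.

Section GradedDimensions.
Context {k : fieldType} {n : nat}.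
Local Notation S := {mpoly k[n]}.
Implicit Types (I : set S) (F : free_seq k n).

Let ideal_subspace I : is_ideal I -> forall (c : k) p q, I p -> I q -> I (c *: p + q).
Proof. by case=> _ ID IM c p q Ip Iq; apply: ID => //; rewrite -mul_mpolyC; apply: IM. Qed.

Let twisted_homogP t j (c : k) (p q : S) :
  twisted_homog t j p -> twisted_homog t j q -> twisted_homog t j (c *: p + q).
Proof.
rewrite /twisted_homog; case: ifP => _ hp hq; first by rewrite rpredD ?rpredZ.
by rewrite (eqP hp) (eqP hq) scaler0 addr0.
Qed.

Let tensor_subspace F I i j : is_ideal I -> subspace (@tensor_homog _ _ F I i j).
Proof.
move=> hI; split=> [a|c u v hu hv a] /=; rewrite !ffunE.
  split; first by case: hI.
  by rewrite /twisted_homog; case: ifP; rewrite ?rpred0.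
have [Iu tu] := hu a; have [Iv tv] := hv a.
by split; [apply: ideal_subspace | apply: twisted_homogP].
Qed.

Let bdry_linear F i (c : k) (u v : {ffun gens F i.+1 -> S}) :
  bdry (c *: u + v) = c *: bdry u + bdry v.
Proof.
apply/ffunP=> b; rewrite !ffunE scaler_sumr -big_split; apply: eq_bigr => a _.
by rewrite !ffunE mulrDl scalerAl.
Qed.

Lemma tor_boundaries_subspace F I i j :
  is_ideal I -> subspace (@tor_boundaries _ _ F I i j).
Proof.
move=> /(tensor_subspace F i.+1 j) [T0 TD]; split.
  exists 0 => //; apply/ffunP=> b; rewrite !ffunE big1 // => a _.
  by rewrite ffunE mul0r.
move=> c _ _ [u Tu <-] [v Tv <-]; exists (c *: u + v); first exact: TD.
by rewrite bdry_linear.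
Qed.

Let homog_span d (p : S) : p \is d.-homog ->
  p = \sum_(m : 'X_{1..n < d.+1}) p@_m *: 'X_[m].
Proof.
move=> hp; apply: mpolywE; rewrite msizeE; apply/bigmax_leqP_seq => m mp _.
by rewrite (dhomog_mf hp mp).
Qed.

(* The dimensions defining Betti numbers and Hilbert functions are attained. *)
Lemma tor_dimP F I i j : is_ideal I ->
  exists z : 'I_(tor_dim F I i j) -> {ffun gens F i -> S},
    basis_mod (@tor_cycles _ _ F I i j) (@tor_boundaries _ _ F I i j) z.
Proof.
move=> hI; pose T := (gens F i * 'X_{1..n < j.+1})%type.
pose y (x : T) : {ffun gens F i -> S} := [ffun a => if a == x.1 then 'X_[x.2] else 0].
rewrite /tor_dim; apply: (@dim_modP _ _ _ _ #|{: T}| (fun l => y (enum_val l))).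
- have [T0 TD] := tensor_subspace F i j hI.
  case: i T0 TD {T y} => [|i] T0 TD; first by split.
  split=> [|c u v [Tu bu] [Tv bv]] /=.
    split=> //; apply/ffunP=> b; rewrite !ffunE big1 // => a _.
    by rewrite ffunE mul0r.
  by split; [exact: TD | rewrite bdry_linear bu bv scaler0 addr0].
- exact: tor_boundaries_subspace.
move=> v Zv; have {Zv} Tv : tensor_homog I j v by case: i v Zv {T y} => [|i] v // [].
exists (fun l => (v (enum_val l : T).1)@_(enum_val l : T).2).
rewrite -(big_enum_val (fun x : T => (v x.1)@_x.2 *: y x)) /=.
apply/ffunP=> a; rewrite sum_ffunE.
transitivity (\sum_(x : T) (if x.1 == a then (v x.1)@_x.2 *: 'X_[x.2] else 0)); last first.
  by apply: eq_bigr => x _; rewrite !ffunE eq_sym; case: eqP; rewrite ?scaler0.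
rewrite -(pair_bigA _ (fun b (m : 'X_{1..n < j.+1}) =>
  if b == a then (v b)@_m *: 'X_[m] else 0)) /=.
rewrite (bigD1 a) //= [X in _ + X]big1 ?addr0 => [|b /negPf ba]; last first.
  by rewrite big1 // => m _; rewrite ba.
rewrite eqxx.
have [_] := Tv a; rewrite /twisted_homog; case: leqP => [le_dj hv|_ /eqP ->]; last first.
  by rewrite big1 // => m _; rewrite mcoeff0 scale0r.
apply: mpolywE; rewrite msizeE; apply/bigmax_leqP_seq => m mp _.
by rewrite (dhomog_mf hv mp) ltnS leq_subr.
Qed.

Lemma hilbertP I d : is_ideal I ->
  exists z : 'I_(hilbert I d) -> S,
    basis_mod [set p | I p /\ p \is d.-homog] [set 0] z.
Proof.
move=> hI; pose T := 'X_{1..n < d.+1}.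
rewrite /hilbert; apply: (@dim_modP _ _ _ _ #|{: T}| (fun l => 'X_[(enum_val l : T)])).
- split=> [|c p q [Ip hp] [Iq hq]] /=; first by split; [case: hI | exact: rpred0].
  by split; [apply: ideal_subspace | rewrite rpredD ?rpredZ].
- by split=> // c _ _ -> ->; rewrite scaler0 addr0.
move=> p [_ hp]; exists (fun l => p@_(enum_val l : T)).
rewrite -(big_enum_val (fun m : T => p@_m *: 'X_[m])) /=.
exact: homog_span.
Qed.

End GradedDimensions.

(* Main.v *)
(** Let Z_i(I)_d be the space of i-cycles of the Koszul complex with coefficients
    in I_d. Exactness of the complex gives
      b_(i, i + d + 1)(I) = dim Z_i(I)_(d+1) + dim Z_(i+1)(I)_d
                            - 'C(n, i + 1) * dim I_d,
    so it suffices to find L with the Hilbert function of I and with spaces of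
    cycles at least as large. Passing to an initial ideal does not shrink the
    cycles. The monomials f_i have pairwise disjoint supports, and substituting
    x_a + x_b for x_b and passing to the initial ideal moves the exponents of
    each f_i to one variable; after a permutation of the variables, I is a
    monomial ideal containing P. Modulo P only the monomials in the box given by
    e matter, as in the theorem of Clements and Lindstrom. There one bounds, by
    induction on the number of variables, the dimension K(V, W) of the chains
    with coefficients in a set V of monomials of degree d whose boundary is
    supported in a set W of monomials of degree d + 1: compressing V and W in
    each variable does not decrease K, and compressed sets are compared with lex
    sets through their slices in the last variable. *)

Require Import Defs.
From HB Require Import structures.
From mathcomp Require Import all_boot all_order all_algebra.
From mathcomp Require Import boolp classical_sets functions.
From mathcomp Require Import mpoly perm zify.

Set Implicit Arguments.
Unset Strict Implicit.
Unset Printing Implicit Defensive.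

Import Order.TTheory GRing.Theory.
Local Open Scope classical_set_scope.
Local Open Scope ring_scope.

(** * Dimensions of subspaces *)

(** The field is arbitrary, so no generic coordinates are used: the substitution has coefficient 1,
    and the leading coefficient of the image of a monomial is 1 in every characteristic. In the
    bound on K(V, W) the sets V and W are tied to the lex sets only by their sizes, because slices
    need not come from an ideal; the case i = 1 then contains the theorem of Clements and Lindstrom
    and shows that lex segments of the right sizes form an ideal. Slicing in one variable presents
    chains as a mapping cone, whose dimension has two upper bounds: one is attained when one of two
    sets of the same degree contains the other, the second in the opposite case. Lex sets are
    nested, so for them one of the bounds is always exact. A compressed set need not be lex, but
    with at least three variables a gap above one of its elements must have a larger last exponent,
    which is enough to compare the slices of lowest and highest exponent. Two variables are settled
    by counting shadows. *)

Section FiniteDimension.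
Context {k : fieldType}.

Definition fdim (V : lmodType k) (Z : set V) : nat := dim_mod Z [set 0].

Definition spanned (V : lmodType k) (Z : set V) : Prop :=
  exists N (y : 'I_N -> V), forall v, Z v -> exists c : 'I_N -> k, v = \sum_l c l *: y l.

Definition indep (V : lmodType k) m (z : 'I_m -> V) : Prop :=
  forall c : 'I_m -> k, \sum_l c l *: z l = 0 -> forall l, c l = 0.

Section Linear.
Context {V W : lmodType k} {f : V -> W}.
Hypothesis fL : linear f.

Lemma linear_0 : f 0 = 0.
Proof. by have := fL (-1) 0 0; rewrite scaler0 addr0 scaleN1r addNr. Qed.

Lemma linear_Z c v : f (c *: v) = c *: f v.
Proof. by have := fL c v 0; rewrite addr0 linear_0 addr0. Qed.

Lemma linear_D u v : f (u + v) = f u + f v.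
Proof. by have := fL 1 u v; rewrite !scale1r. Qed.

Lemma linear_sum m (c : 'I_m -> k) (z : 'I_m -> V) :
  f (\sum_l c l *: z l) = \sum_l c l *: f (z l).
Proof.
elim/big_rec2: _ => [|i y1 y2 _ <-]; first exact: linear_0.
exact: fL.
Qed.

End Linear.

Lemma subspace_scale_sum (V : lmodType k) (Z : set V) m (c : 'I_m -> k) (z : 'I_m -> V) :
  subspace Z -> (forall l, Z (z l)) -> Z (\sum_l c l *: z l).
Proof. by move=> [Z0 ZD] Zz; elim/big_rec: _ => // i x _; apply: ZD. Qed.

Lemma subspace0 (V : lmodType k) : subspace [set 0 : V].
Proof. by split=> // c u v -> ->; rewrite scaler0 addr0. Qed.

Lemma subspaceI (V : lmodType k) (Z1 Z2 : set V) :
  subspace Z1 -> subspace Z2 -> subspace (Z1 `&` Z2).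
Proof.
move=> [z1 d1] [z2 d2]; split=> // c u v [u1 u2] [v1 v2].
by split; [apply: d1|apply: d2].
Qed.

Lemma spannedS (V : lmodType k) (Z1 Z2 : set V) :
  Z1 `<=` Z2 -> spanned Z2 -> spanned Z1.
Proof. by move=> s [N [y h]]; exists N, y => v /s /h. Qed.

Variable V : lmodType k.
Implicit Types Z : set V.

Lemma fdim_basis Z : subspace Z -> spanned Z ->
  exists z : 'I_(fdim Z) -> V, basis_mod Z [set 0] z.
Proof. by move=> sZ [N [y h]]; apply: dim_modP (y) _ (subspace0 V) h. Qed.

(** If [Z] has no finite basis, [fdim Z] is the default 0 and the empty family serves. *)
Lemma fdim_indep Z :
  exists z : 'I_(fdim Z) -> V, (forall l, Z (z l)) /\ indep z.
Proof.
rewrite /fdim /dim_mod.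
case: (pselect (exists m (z : 'I_m -> V), basis_mod Z [set 0] z)) => [[m hm]|no].
  have [z [Zz iz _]] := xgetPex 0%N (ex_intro [set m | exists z : 'I_m -> V, basis_mod Z [set 0] z] m hm).
  by exists z.
rewrite xgetPN; last by move=> m hm; apply: no; exists m.
by exists (fun=> 0); split=> [[]|c _ []].
Qed.

Lemma fdim_max Z m (z : 'I_m -> V) : subspace Z -> spanned Z ->
  (forall l, Z (z l)) -> indep z -> (m <= fdim Z)%N.
Proof.
move=> sZ fZ Zz iz; have [z' [Zz' iz' sz']] := fdim_basis sZ fZ.
exact: independent_le (subspace0 V) Zz iz sz'.
Qed.

Lemma fdim_le Z1 Z2 : subspace Z2 -> spanned Z2 -> Z1 `<=` Z2 ->
  (fdim Z1 <= fdim Z2)%N.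
Proof.
move=> s2 f2 s12; have [z [Zz iz]] := fdim_indep Z1.
by apply: (fdim_max s2 f2 _ iz) => l; apply: s12.
Qed.

Lemma fdim0 : fdim [set 0 : V] = 0%N.
Proof.
apply: (@dim_mod_eq _ _ _ _ 0%N (fun=> 0)); first exact: subspace0.
split=> [[]//|c _ []//|v ->].
by exists (fun=> 0); rewrite big_ord0 /= subrr.
Qed.

End FiniteDimension.

Section TwoMaps.
Context {k : fieldType} {V W1 W2 : lmodType k}.
Implicit Types Z : set V.

(** Rank-nullity as an inequality: linear relations among the images under [f] give vectors of [Z]
    killed by [f], and [g] embeds these in [Z2]. With [g] the identity, [Z2] is any space containing
    the kernel of [f] on [Z]. *)
Lemma fdim_add_le (f : V -> W1) (g : V -> W2) Z (Z1 : set W1) (Z2 : set W2) :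
    linear f -> linear g -> subspace Z ->
    subspace Z1 -> spanned Z1 -> subspace Z2 -> spanned Z2 ->
    (forall v, Z v -> Z1 (f v)) ->
    (forall v, Z v -> f v = 0 -> Z2 (g v)) ->
    (forall v, Z v -> f v = 0 -> g v = 0 -> v = 0) ->
  (fdim Z <= fdim Z1 + fdim Z2)%N.
Proof.
move=> fL gL sZ s1 f1 s2 f2 fZ gZ inj.
have [z [Zz iz]] := fdim_indep Z; have [z1 [_ _ span1]] := fdim_basis s1 f1.
have [T fT] := choice (fun l => span1 _ (fZ _ (Zz l))).
pose M := \matrix_(l < fdim Z, j < fdim Z1) T l j.
(* A basis of the relations among the vectors [f (z l)]. *)
pose K := row_base (kermx M).
pose w (i : 'I_(\rank (kermx M))) := \sum_l K i l *: z l.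
have KM i : row i K *m M = 0.
  by rewrite -row_mul; apply/eqP; rewrite (_ : K *m M = 0) ?row0 //;
     apply/sub_kermxP; rewrite eq_row_base.
have Zw i : Z (w i) by apply: subspace_scale_sum.
have fw i : f (w i) = 0.
  rewrite /w linear_sum //.
  under eq_bigr => l _.
    have /eqP := fT l; rewrite subr_eq0 => /eqP ->; rewrite scaler_sumr.
    under eq_bigr do rewrite scalerA.
    over.
  rewrite exchange_big big1 // => j _; rewrite -scaler_suml.
  have /rowP/(_ j) := KM i; rewrite !mxE => e.
  suff -> : \sum_l K i l * T l j = 0 by rewrite scale0r.
  by rewrite -[RHS]e; apply: eq_bigr => l _; rewrite !mxE.
have iw : indep (fun i => g (w i)).
  move=> c c0.
  have u0 : \sum_i c i *: w i = 0.
    apply: inj; first exact: subspace_scale_sum.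
      by rewrite linear_sum // big1 // => i _; rewrite fw scaler0.
    by rewrite linear_sum.
  have cK : (\row_i c i) *m K = 0.
    apply/rowP => l; rewrite !mxE; have := iz (fun l => \sum_i c i * K i l).
    under eq_bigr => j _ do rewrite scaler_suml.
    rewrite exchange_big /=.
    under eq_bigr => i _ do under eq_bigr => j _ do rewrite -scalerA.
    under eq_bigr => i _ do rewrite -scaler_sumr.
    by move=> /(_ u0 l) e; rewrite -[RHS]e; apply: eq_bigr => i _; rewrite !mxE.
  have /eqP : (\row_i c i) = 0.
    by apply/eqP; rewrite -(mulmx_free_eq0 _ (row_base_free (kermx M))) cK.
  by move=> /eqP /rowP h l; have := h l; rewrite !mxE.
have := fdim_max s2 f2 (fun i => gZ _ (Zw i) (fw i)) iw.
rewrite mxrank_ker; have := rank_leq_col M.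
by lia.
Qed.

Lemma fdim_add_ge (f : W1 -> V) (g : W2 -> V) Z (Z1 : set W1) (Z2 : set W2) :
    linear f -> linear g -> subspace Z -> spanned Z ->
    subspace Z1 -> subspace Z2 ->
    (forall w, Z1 w -> Z (f w)) -> (forall w, Z2 w -> Z (g w)) ->
    (forall w1 w2, Z1 w1 -> Z2 w2 -> f w1 + g w2 = 0 -> w1 = 0 /\ w2 = 0) ->
  (fdim Z1 + fdim Z2 <= fdim Z)%N.
Proof.
move=> fL gL sZ fZ s1 s2 fZ1 gZ2 inj.
have [z1 [Zz1 iz1]] := fdim_indep Z1; have [z2 [Zz2 iz2]] := fdim_indep Z2.
pose z (l : 'I_(fdim Z1 + fdim Z2)) :=
  match fintype.split l with inl i => f (z1 i) | inr j => g (z2 j) end.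
apply: (@fdim_max _ _ Z _ z) => // [l|c].
  by rewrite /z; case: (fintype.split l) => i; [apply: fZ1|apply: gZ2].
rewrite big_split_ord /=.
under eq_bigr => i _ do rewrite /z (unsplitK (inl i)).
under [X in _ + X]eq_bigr => i _ do rewrite /z (unsplitK (inr i)).
rewrite -!linear_sum // => /inj [||h1 h2]; try exact: subspace_scale_sum.
by move=> l; case: (split_ordP l) => i ->; [apply: (iz1 _ h1)|apply: (iz2 _ h2)].
Qed.

End TwoMaps.

Lemma fdim_inj_le (k : fieldType) (V W : lmodType k) (f : V -> W) (Z : set V) (Z1 : set W) :
  linear f -> subspace Z -> subspace Z1 -> spanned Z1 ->
  (forall v, Z v -> Z1 (f v)) -> (forall v, Z v -> f v = 0 -> v = 0) ->
  (fdim Z <= fdim Z1)%N.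
Proof.
move=> fL sZ s1 f1 fZ inj.
rewrite -[fdim Z1]addn0 -(@fdim0 k V).
apply: (@fdim_add_le _ _ _ _ f id) => //; first exact: subspace0.
by exists 0%N, (fun=> 0) => v ->; exists (fun=> 0); rewrite big_ord0.
Qed.

Section Peel.
Context {k : fieldType} {V : lmodType k}.
Implicit Types Z : set V.

(** Iterates [fdim_add_le] along the filtration of [Z] by the vanishing of the first q maps; [D q]
    has to contain the image under [f q] of the q-th step only. The induction starts at the last
    step, which is 0. *)
Lemma fdim_peel_le N (W : 'I_N -> lmodType k) (f : forall q, V -> W q)
    (D : forall q, set (W q)) Z :
  (forall q, linear (f q)) -> subspace Z -> spanned Z ->
  (forall q, subspace (D q)) -> (forall q, spanned (D q)) ->
  (forall (q : 'I_N) v, Z v -> (forall j : 'I_N, (j < q)%N -> f j v = 0) -> D q (f q v)) ->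
  (forall v, Z v -> (forall q, f q v = 0) -> v = 0) ->
  (fdim Z <= \sum_q fdim (D q))%N.
Proof.
move=> fL sZ pZ sD pD fZ inj.
pose Y (q : nat) := Z `&` [set v | forall j : 'I_N, (j < q)%N -> f j v = 0].
have sY q : subspace (Y q).
  apply: subspaceI => //; split=> [j _|c u v hu hv j jq]; first exact: linear_0.
  by rewrite fL hu ?hv // scaler0 addr0.
suff h m : (m <= N)%N -> (fdim (Y (N - m)%N) <= \sum_(q < N | (N - m <= q)%N) fdim (D q))%N.
  have := h N (leqnn _); rewrite subnn (eq_bigl xpredT) //.
  move/(leq_trans _); apply; apply: (fdim_le (sY _)).
    by apply: spannedS pZ => v [].
  by move=> v Zv; split.
elim: m => [_|m IH lt_mN].
  rewrite subn0 [X in (_ <= X)%N]big1 => [|q]; last by rewrite leqNgt ltn_ord.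
  rewrite leqn0 -(@fdim0 k V); apply/eqP; congr fdim; apply/seteqP; split=> v.
    by move=> [Zv h]; apply: inj => // q; apply: h.
  by move=> ->; case: (sY N).
have ltq : (N - m.+1 < N)%N by lia.
pose q := Ordinal ltq.
rewrite (bigD1 q) /=; last by [].
apply: (@leq_trans (fdim (D q) + fdim (Y (N - m)%N))%N).
  apply: (@fdim_add_le _ V _ V (f q) id) => //.
  - by apply: spannedS pZ => v [].
  - by move=> v [Zv h]; apply: fZ.
  - move=> v [Zv h] fq0; split=> // j jN; case: (ltngtP j q) => [|/= jq|/val_inj -> //].
      exact: h.
    by lia.
rewrite leq_add2l (leq_trans (IH (ltnW lt_mN))) // eq_leq //.
by apply: eq_bigl => i; rewrite -(inj_eq val_inj) /=; lia.
Qed.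

(** The maps [h q] form a triangular right inverse: [h q] lands in the q-th step of the same
    filtration and splits [f q] there. *)
Lemma fdim_peel_ge N (W : 'I_N -> lmodType k) (f : forall q, V -> W q)
    (h : forall q, W q -> V) (D : forall q, set (W q)) Z :
  (forall q, linear (f q)) -> (forall q, linear (h q)) -> subspace Z -> spanned Z ->
  (forall q, subspace (D q)) ->
  (forall q w, D q w -> Z (h q w)) ->
  (forall q w, D q w -> f q (h q w) = w) ->
  (forall (q : 'I_N) w (j : 'I_N), (j < q)%N -> D q w -> f j (h q w) = 0) ->
  (\sum_q fdim (D q) <= fdim Z)%N.
Proof.
move=> fL hL sZ pZ sD hZ hK hK'.
pose Y (q : nat) := Z `&` [set v | forall j : 'I_N, (j < q)%N -> f j v = 0].
have sY q : subspace (Y q).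
  apply: subspaceI => //; split=> [j _|c u v hu hv j jq]; first exact: linear_0.
  by rewrite fL hu ?hv // scaler0 addr0.
have pY q : spanned (Y q) by apply: spannedS pZ => v [].
suff H m : (m <= N)%N -> (\sum_(q < N | (N - m <= q)%N) fdim (D q) <= fdim (Y (N - m)%N))%N.
  have := H N (leqnn _); rewrite subnn (eq_bigl xpredT) //.
  by move=> /leq_trans; apply; apply: (fdim_le sZ pZ) => v [].
elim: m => [_|m IH lt_mN].
  by rewrite subn0 [X in (X <= _)%N]big1 => [|q] //; rewrite leqNgt ltn_ord.
have ltq : (N - m.+1 < N)%N by lia.
pose q := Ordinal ltq.
rewrite (bigD1 q) /=; last by [].
apply: (@leq_trans (fdim (D q) + fdim (Y (N - m)%N))%N).
  rewrite leq_add2l (leq_trans _ (IH (ltnW lt_mN))) // eq_leq //.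
  by apply: eq_bigl => i; rewrite -(inj_eq val_inj) /=; lia.
apply: (@fdim_add_ge _ V _ V (h q) id) => // [w Dw|w [Zw hw]|w1 w2 D1 [Z2 h2] e].
- by split=> [|j jq]; [apply: hZ|apply: (hK' q)].
- by split=> // j /= jq; apply: hw; lia.
- have /(congr1 (f q)) := e.
  rewrite (linear_D (fL q)) hK // h2 /=; last by lia.
  rewrite addr0 (linear_0 (fL q)) => w10; split=> //.
  by move: e; rewrite w10 (linear_0 (hL q)) add0r.
Qed.

End Peel.

Lemma spanned_ffun (k : fieldType) (X : finType) (V : lmodType k) (P : set V) : spanned P ->
  spanned [set v : {ffun X -> V} | forall a, P (v a)].
Proof.
move=> [N [y hy]].
pose Y (l : X * 'I_N) : {ffun X -> V} := [ffun a => if a == l.1 then y l.2 else 0].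
exists #|{: X * 'I_N}|, (fun l => Y (enum_val l)) => v hv.
have [c hc] := choice (fun a => hy _ (hv a)).
exists (fun l => c (enum_val l).1 (enum_val l).2).
rewrite -(big_enum_val (fun l : X * 'I_N => c l.1 l.2 *: Y l)) /=.
rewrite -(pair_bigA _ (fun q l => c q l *: Y (q, l))) /=.
apply/ffunP => a; rewrite sum_ffunE.
rewrite (bigD1 a) //= [X in _ + X]big1 ?addr0 => [|q qa].
  transitivity (\sum_l c a l *: y l); first exact: hc.
  by rewrite sum_ffunE; apply: eq_bigr => l _; rewrite !ffunE eqxx.
by rewrite sum_ffunE big1 // => l _; rewrite !ffunE eq_sym (negPf qa) scaler0.
Qed.

Section Coordinates.
Context {k : fieldType} {X : eqType}.

Definition supp_in (P : X -> bool) : set (X -> k^o) := [set u | forall x, ~~ P x -> u x = 0].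

Lemma subspace_supp_in P : subspace (supp_in P).
Proof.
split=> // c u v hu hv x Px; change (c *: u x + v x = 0).
by rewrite hu // hv // scaler0 addr0.
Qed.

Definition unit_fun (x : X) : X -> k^o := fun y => (y == x)%:R.

Lemma supp_in_expand (s : seq X) (u : X -> k^o) :
  uniq s -> supp_in (fun x => x \in s) u ->
  u = \sum_(l < size s) u (tnth (in_tuple s) l) *: unit_fun (tnth (in_tuple s) l).
Proof.
move=> us hu; rewrite -(big_tuple _ _ (in_tuple s) xpredT (fun x => u x *: unit_fun x)) /=.
rewrite fct_sumE; apply/funext => x.
rewrite (eq_bigr (fun y => if y == x then u x else 0)); last first.
  move=> y _; rewrite /GRing.scale /= /unit_fun eq_sym; case: eqP => [->|_].
    by rewrite /GRing.scale /= mulr1.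
  by rewrite /GRing.scale /= mulr0.
case: (boolP (x \in s)) => xs.
  by rewrite (bigD1_seq x) //= eqxx big1 ?addr0 // => y /negPf ->.
by rewrite hu // big1 // => y _; rewrite if_same.
Qed.

Lemma fdim_supp_in (s : seq X) : uniq s -> fdim (supp_in (fun x => x \in s)) = size s.
Proof.
move=> us; apply: (@dim_mod_eq _ _ _ _ _ (fun l => unit_fun (tnth (in_tuple s) l))).
  exact: subspace0.
split=> [l x|c|u hu].
- by rewrite /unit_fun; case: eqP => // ->; rewrite mem_tnth.
- move=> /= h l; have := congr1 (fun u => u (tnth (in_tuple s) l)) h.
  rewrite fct_sumE (bigD1 l) //= big1 => [|j jl].
    by rewrite addr0 /GRing.scale /= /GRing.scale /= /unit_fun eqxx mulr1.
  rewrite /GRing.scale /= /GRing.scale /= /unit_fun.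
  rewrite (inj_eq (tuple_uniqP (in_tuple s) us)).
  by rewrite eq_sym (negPf jl) mulr0.
- by exists (fun l => u (tnth (in_tuple s) l)); rewrite /= -supp_in_expand // subrr.
Qed.

Lemma spanned_supp_in (P : X -> bool) (s : seq X) :
  (forall x, P x -> x \in s) -> spanned (supp_in P).
Proof.
move=> Ps; exists (size (undup s)), (fun l => unit_fun (tnth (in_tuple (undup s)) l)) => u hu.
exists (fun l => u (tnth (in_tuple (undup s)) l)); apply: supp_in_expand.
  exact: undup_uniq.
by move=> x xs; apply: hu; apply: contra xs; rewrite mem_undup; apply: Ps.
Qed.

End Coordinates.

(** * Koszul chains *)

Section Monomials.
Context {n : nat}.
Implicit Types (m : 'X_{1..n}) (a b : 'I_n).

Lemma mnmBC m a b : (m - U_(a) - U_(b) = m - U_(b) - U_(a))%MM.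
Proof. by apply/mnmP => c; rewrite !mnmBE !mnm1E; lia. Qed.

Lemma submUK m a : (0 < m a)%N -> (m - U_(a) + U_(a))%MM = m.
Proof. by move=> ma; rewrite submK // lep1mP -lt0n. Qed.

Lemma mdeg_sub m a : (0 < m a)%N -> (mdeg (m - U_(a))%MM).+1 = mdeg m.
Proof. by move=> /submUK h; rewrite -[in RHS]h mdegD mdeg1 addn1. Qed.

Lemma mdeg_gt0 m : (0 < mdeg m)%N -> exists a, (0 < m a)%N.
Proof.
move=> h; apply/existsP; apply: contraLR h => /existsPn m0; rewrite -leqNgt leqn0 mdegE.
by rewrite big1 // => a _; apply/eqP; rewrite -leqn0 leqNgt; apply: m0.
Qed.

Lemma lepm_mulU m a c : (U_(a) *+ c <= m)%MM = (c <= m a)%N.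
Proof.
apply/mnm_lepP/idP => [/(_ a)|h b]; rewrite mulmnE mnm1E; first by rewrite eqxx mul1n.
by have [<-|_] := eqVneq a b; rewrite ?mul1n.
Qed.

End Monomials.

Section Chains.
Context {k : fieldType} {n : nat}.
Implicit Types (s : 'I_n -> {set 'I_n} -> k) (B : {set 'I_n}) (m : 'X_{1..n}).
Implicit Types (V U W : 'X_{1..n} -> bool) (i : nat).

Definition chain : lmodType k := ({set 'I_n} * 'X_{1..n} -> k^o)%type.

(* The value at (B, m) is the coefficient of x^m e_B. *)
Definition bd s (u : chain) : chain := fun x =>
  \sum_(a | (a \notin x.1) && (0 < x.2 a)%N)
     s a x.1 * u (a |: x.1, (x.2 - U_(a))%MM).

Arguments bd : simpl never.

(** The anticommutation makes the square of [bd s] vanish. The signs stay abstract because permuting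
    the variables does not preserve the Koszul signs. *)
Definition sign_system s : Prop :=
  (forall a B, s a B != 0) /\
  (forall a b B, a \notin B -> b \notin B -> a != b ->
     s a B * s b (a |: B) = - (s b B * s a (b |: B))).

Lemma chain_linE (c : k) (u v : chain) x : (c *: u + v) x = c * u x + v x.
Proof. by []. Qed.

Lemma chainDE (u v : chain) x : (u + v) x = u x + v x.
Proof. by []. Qed.

Lemma chain0E x : (0 : chain) x = 0. Proof. by []. Qed.

Lemma chainNE (u : chain) x : (- u) x = - u x. Proof. by []. Qed.

Lemma bd_linear s : linear (bd s).
Proof.
move=> c u v; apply/funext => x; rewrite chain_linE /bd mulr_sumr -big_split /=.
by apply: eq_bigr => a _; rewrite chain_linE mulrDr mulrCA.
Qed.

Lemma bd_bd s u : sign_system s -> bd s (bd s u) = 0.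
Proof.
move=> [s0 sC]; apply/funext => -[B m]; rewrite chain0E /bd /=.
pose t (a b : 'I_n) := s a B * (s b (a |: B) * u (b |: (a |: B), (m - U_(a) - U_(b))%MM)).
pose P (a b : 'I_n) := [&& a \notin B, b \notin B, (0 < m a)%N & (0 < m b)%N].
transitivity (\sum_a \sum_(b | P a b && (a != b)) t a b).
  rewrite big_mkcond /=; apply: eq_bigr => a _; rewrite /P.
  case: ifP => [/andP[aB ma]|h]; last first.
    by rewrite big_pred0 // => b; move: h; case: (a \in B) => //= ->; rewrite !andbF.
  rewrite mulr_sumr; apply: eq_bigl => b.
  rewrite !inE negb_or [b == a]eq_sym aB ma mnmBE mnm1E /=.
  by case: (a == b) => //=; rewrite ?andbF // subn0 andbT.
have tN (a b : 'I_n) : P a b -> a != b -> t a b = - t b a.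
  case/and4P=> aB bB _ _ ab; rewrite /t !mulrA sC // mulNr; congr (- (_ * u _)).
  by rewrite finset.setUCA mnmBC.
transitivity (\sum_a \sum_(b | P a b && (a < b)%N) t a b
            + \sum_a \sum_(b | P a b && (b < a)%N) t a b).
  rewrite -big_split /=; apply: eq_bigr => a _.
  rewrite (bigID (fun b : 'I_n => (a < b)%N)) /=; congr (_ + _);
    apply: eq_bigl => b; rewrite -(inj_eq val_inj) /=; case: (P a b) => //=;
    by case: ltngtP.
rewrite [X in _ + X](exchange_big_dep predT) //=.
rewrite -big_split big1 //= => a _; apply/eqP; rewrite addr_eq0 -sumrN; apply/eqP.
have PC b : P b a = P a b by rewrite /P; lia.
apply: eq_big => [b|b /andP[Pab ab]]; first by rewrite PC.
by rewrite tN // -(inj_eq val_inj) /=; lia.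
Qed.

Definition supp_chain i V : set chain :=
  supp_in (X := ({set 'I_n} * 'X_{1..n})%type) (fun x => (#|x.1| == i) && V x.2).

Lemma bd_supp s u i V : supp_chain i.+1 V u ->
  forall B m, #|B| != i -> bd s u (B, m) = 0.
Proof.
move=> hu B m Bi; rewrite /bd big1 // => a /= /andP[aB _].
by rewrite hu ?mulr0 // cardsU1 aB eqSS (negPf Bi).
Qed.

Lemma bd_ext s (u v : chain) B m :
  (forall a, a \notin B -> (0 < m a)%N -> u (a |: B, (m - U_(a))%MM) = v (a |: B, (m - U_(a))%MM)) ->
  bd s u (B, m) = bd s v (B, m).
Proof. by move=> h; apply: eq_bigr => a /= /andP[aB ma]; rewrite h. Qed.

(* The chains of homological degree i with monomials in V whose boundary
   vanishes at the monomials in U. *)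
Definition K s i V U : set chain :=
  supp_chain i V `&` [set u | forall B m, U m -> bd s u (B, m) = 0].

Lemma subspace_supp_chain i V : subspace (supp_chain i V).
Proof. exact: subspace_supp_in. Qed.

Lemma subspace_K s i V U : subspace (K s i V U).
Proof.
apply: subspaceI; first exact: subspace_supp_chain.
split=> [B m _|c u v hu hv B m Um]; first by rewrite (linear_0 (bd_linear s)).
by rewrite bd_linear chain_linE hu // hv // mulr0 addr0.
Qed.

Definition mons N : seq 'X_{1..n} := [seq bmnm x | x : 'X_{1..n < N}].

Lemma mem_mons N m : (m \in mons N) = (mdeg m < N)%N.
Proof.
apply/fintype.imageP/idP => [[x _ ->]|h]; first exact: bmdeg.
by exists (BMultinom h).
Qed.

Lemma uniq_mons N : uniq (mons N).
Proof. by rewrite map_inj_uniq ?enum_uniq //; exact: val_inj. Qed.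

Definition bounded N V : Prop := forall m, V m -> (mdeg m < N)%N.

(** The cardinality of [V] as soon as [bounded N V] holds; the cut-off makes the count finite. *)
Definition crd N V : nat := count V (mons N).

Lemma boundedS N V W : (forall m, V m -> W m) -> bounded N W -> bounded N V.
Proof. by move=> VW bW m /VW /bW. Qed.

Lemma eq_crd N V W : (forall m, V m = W m) -> crd N V = crd N W.
Proof. by move=> VW; apply: eq_count. Qed.

Lemma crd_le N V W : (forall m, V m -> W m) -> (crd N V <= crd N W)%N.
Proof. by move=> h; apply: sub_count. Qed.

Lemma crd_diff N V W : (forall m, V m -> W m) ->
  (crd N V + crd N (fun m => W m && ~~ V m))%N = crd N W.
Proof.
move=> VW; rewrite /crd -[RHS]size_filter -(count_predC V) !count_filter.
congr (_ + _)%N; apply: eq_count => m /=; last by rewrite andbC.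
by case: (boolP (V m)) => // /VW ->.
Qed.

Lemma crd_eq_sub N V W : bounded N W -> (forall m, V m -> W m) ->
  crd N V = crd N W -> forall m, W m -> V m.
Proof.
move=> bW VW e m Wm; apply: contraT => nV.
have := crd_diff N VW; rewrite e => /eqP; rewrite -[X in _ == X]addn0 eqn_add2l /crd.
rewrite -leqn0 leqNgt -has_count => /hasPn /(_ m).
by rewrite mem_mons bW // => /(_ isT); rewrite Wm nV.
Qed.

Lemma crd_gt0 N V m : bounded N V -> V m -> (0 < crd N V)%N.
Proof. by move=> bV Vm; rewrite -has_count; apply/hasP; exists m; rewrite ?mem_mons ?bV. Qed.

Lemma crd_pred0 N V : (forall m, ~~ V m) -> crd N V = 0%N.
Proof. by move=> h; rewrite /crd (eq_count (a2 := pred0)) ?count_pred0 // => m; apply: negPf. Qed.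

Lemma crd_bounded_le N N' V : (N <= N')%N -> bounded N V -> crd N' V = crd N V.
Proof.
move=> NN bV; rewrite /crd -!size_filter; apply: perm_size.
apply: uniq_perm; rewrite ?filter_uniq ?uniq_mons // => m.
rewrite !mem_filter !mem_mons; case: (boolP (V m)) => //= /bV h.
by rewrite h (leq_trans h).
Qed.

Definition supp_seq N i V : seq ({set 'I_n} * 'X_{1..n}) :=
  [seq (B, m) | B <- enum [set B : {set 'I_n} | #|B| == i]%SET, m <- filter V (mons N)].

Lemma mem_supp_seq N i V x : bounded N V ->
  (x \in supp_seq N i V) = (#|x.1| == i) && V x.2.
Proof.
move=> bV; case: x => B m; apply/allpairsP/andP => /= [[[B' m'] /= []]|[Bi Vm]].
  by rewrite mem_enum inE mem_filter => Bi /andP[Vm _] [-> ->].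
by exists (B, m) => /=; rewrite mem_enum inE mem_filter Bi Vm mem_mons bV.
Qed.

Lemma spanned_supp_chain N i V : bounded N V -> spanned (supp_chain i V).
Proof.
move=> bV; apply: (@spanned_supp_in _ _ _ (supp_seq N i V)) => x.
by rewrite mem_supp_seq.
Qed.

Lemma spanned_K N s i V U : bounded N V -> spanned (K s i V U).
Proof. by move=> bV; apply: spannedS (spanned_supp_chain i bV) => u []. Qed.

Lemma fdim_supp_chain N i V : bounded N V ->
  fdim (supp_chain i V) = ('C(n, i) * crd N V)%N.
Proof.
move=> bV; have -> : supp_chain i V = supp_in (fun x => x \in supp_seq N i V) :> set chain.
  by rewrite /supp_chain; congr supp_in; apply/funext => x; rewrite mem_supp_seq.
rewrite fdim_supp_in; last first.
  apply: allpairs_uniq; rewrite ?enum_uniq ?filter_uniq ?uniq_mons //.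
  by move=> [? ?] [? ?] _ _ [-> ->].
by rewrite size_allpairs -cardE card_draws card_ord size_filter.
Qed.

Lemma fdim_K_le N s i V U : bounded N V -> (fdim (K s i V U) <= 'C(n, i) * crd N V)%N.
Proof.
move=> bV; rewrite -fdim_supp_chain //; apply: fdim_le; last by move=> u [].
  exact: subspace_supp_chain.
exact: spanned_supp_chain bV.
Qed.

(** The boundary of a chain over [V] is supported on products of elements of [V] with a variable;
    when [U] avoids these, the condition is void. *)
Lemma K_full s i V U : (forall m a, V m -> ~~ U (m + U_(a))%MM) ->
  K s i V U = supp_chain i V.
Proof.
move=> h; apply/seteqP; split=> u; first by case.
move=> hu; split=> // B m Um; rewrite /bd big1 // => a /= /andP[aB ma].
rewrite hu ?mulr0 //; apply/negP => /= /andP[_ /(h _ a)].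
by rewrite submUK // Um.
Qed.

Lemma fdim_K_full N s i V U : bounded N V -> (forall m a, V m -> ~~ U (m + U_(a))%MM) ->
  fdim (K s i V U) = ('C(n, i) * crd N V)%N.
Proof. by move=> bV h; rewrite K_full // (fdim_supp_chain i bV). Qed.

Lemma K_0 s V U : K s 0 V U = supp_chain 0 V.
Proof.
apply/seteqP; split=> u; first by case.
move=> hu; split=> // B m Um; rewrite /bd big1 // => a /= /andP[aB ma].
by rewrite hu ?mulr0 // cardsU1 aB.
Qed.

Lemma fdim_K_mono N s i V V' U U' : bounded N V' ->
  (forall m, V m -> V' m) -> (forall m, U' m -> U m) ->
  (fdim (K s i V U) <= fdim (K s i V' U'))%N.
Proof.
move=> bV' VV' UU'; apply: fdim_le; [exact: subspace_K|exact: spanned_K bV'|].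
move=> u [hu bu]; split=> [x|B m /UU']; last exact: bu.
by move=> h; apply: hu; apply: contra h => /andP[-> /VV' ->].
Qed.

Definition rest (P : {set 'I_n} * 'X_{1..n} -> bool) (u : chain) : chain :=
  fun x => if P x then u x else 0.

Lemma rest_linear P : linear (rest P).
Proof.
move=> c u v; apply/funext => x; rewrite chain_linE /rest chain_linE.
by case: ifP => // _; rewrite mulr0 addr0.
Qed.

(** A monomial removed from [V] costs at most one dimension per (i+1)-subset, and one added to [U]
    imposes at most one condition per i-subset. The additive form avoids truncated subtraction. *)
Lemma fdim_K_shrink N s i V V' U U' : bounded N V -> bounded N U' ->
  (forall m, V' m -> V m) -> (forall m, U m -> U' m) ->
  (fdim (K s i.+1 V U) + 'C(n, i.+1) * crd N V' + 'C(n, i) * crd N U <=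
   fdim (K s i.+1 V' U') + 'C(n, i.+1) * crd N V + 'C(n, i) * crd N U')%N.
Proof.
move=> bV bU' V'V UU'.
have bD : bounded N (fun m => V m && ~~ V' m) by apply: boundedS bV => m /andP[].
have bD' : bounded N (fun m => U' m && ~~ U m) by apply: boundedS bU' => m /andP[].
have h1 : (fdim (K s i.+1 V U) <=
    fdim (supp_chain i.+1 (fun m => V m && ~~ V' m)) + fdim (K s i.+1 V' U))%N.
  apply: (fdim_add_le (rest_linear (fun x => ~~ V' x.2)) (g := id)) => //.
  - exact: subspace_K.
  - exact: subspace_supp_chain.
  - exact: spanned_supp_chain bD.
  - exact: subspace_K.
  - by apply: spanned_K (N) _ _ _ _ _; apply: boundedS bV.
  - move=> u [hu _] x; rewrite /rest; case: ifP => // V'x h; apply: hu.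
    by apply: contra h => /andP[-> ->].
  - move=> u [hu bu] r0; split=> // x h.
    have /(congr1 (fun v : chain => v x)) := r0; rewrite /rest chain0E.
    by case: ifP => // V'x _; apply: hu; apply: contra h => /andP[->]; move/negbFE: V'x => ->.
have h2 : (fdim (K s i.+1 V' U) <=
    fdim (supp_chain i (fun m => U' m && ~~ U m)) + fdim (K s i.+1 V' U'))%N.
  apply: (fdim_add_le (f := fun u => rest (fun x => U' x.2 && ~~ U x.2) (bd s u)) (g := id)) => //.
  - by move=> c u v; rewrite bd_linear rest_linear.
  - exact: subspace_K.
  - exact: subspace_supp_chain.
  - exact: spanned_supp_chain bD'.
  - exact: subspace_K.
  - by apply: spanned_K (N) _ _ _ _ _; apply: boundedS bV.
  - move=> u [hu bu] [B m] /= h; rewrite /rest /=; case: ifP => // e.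
    by apply: (bd_supp _ hu); move: h; rewrite e andbT.
  - move=> u [hu bu] r0; split=> // B m U'm.
    case: (boolP (U m)) => [/bu //|nU].
    have /(congr1 (fun v : chain => v (B, m))) := r0.
    by rewrite /rest /= U'm nU chain0E.
rewrite (fdim_supp_chain _ bD) in h1; rewrite (fdim_supp_chain _ bD') in h2.
have := crd_diff N V'V; have := crd_diff N UU'.
by move: h1 h2 => /ssrnat.leP h1 /ssrnat.leP h2 <- <-; rewrite !mulnDr; lia.
Qed.

End Chains.

(** * Separating one variable from the others *)

Section Insertion.
Context {n : nat} (z : 'I_n.+1).
Implicit Types (B : {set 'I_n}) (m : 'X_{1..n}) (j : nat).

Definition lft B : {set 'I_n.+1} := (lift z @: B)%SET.
Definition dlt (A : {set 'I_n.+1}) : {set 'I_n} := [set b | lift z b \in A]%SET.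

Definition ins j m : 'X_{1..n.+1} :=
  [multinom (if unlift z a is Some b then m b else j) | a < n.+1].
Definition delm (m : 'X_{1..n.+1}) : 'X_{1..n} := [multinom m (lift z b) | b < n].

Lemma ins_z j m : ins j m z = j.
Proof. by rewrite mnmE unlift_none. Qed.

Lemma ins_lift j m b : ins j m (lift z b) = m b.
Proof. by rewrite mnmE liftK. Qed.

Lemma insK j m : delm (ins j m) = m.
Proof. by apply/mnmP => b; rewrite mnmE ins_lift. Qed.

Lemma delmK (m : 'X_{1..n.+1}) : ins (m z) (delm m) = m.
Proof.
by apply/mnmP => a; case: (unliftP z a) => [b ->|->]; rewrite ?ins_z // ins_lift mnmE.
Qed.

Lemma insP (m : 'X_{1..n.+1}) : {p | m = ins p.1 p.2}.
Proof. by exists (m z, delm m); rewrite delmK. Qed.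

Lemma ins_inj j j' m m' : ins j m = ins j' m' -> j = j' /\ m = m'.
Proof.
move=> e; split; first by rewrite -(ins_z j m) e ins_z.
by rewrite -(insK j m) e insK.
Qed.

Lemma mem_lft b B : (lift z b \in lft B) = (b \in B).
Proof. by rewrite mem_imset //; apply: lift_inj. Qed.

Lemma z_lft B : (z \in lft B) = false.
Proof. by apply/imsetP => -[b _] /eqP; rewrite (negPf (neq_lift z b)). Qed.

Lemma lft_dlt (A : {set 'I_n.+1}) : z \notin A -> lft (dlt A) = A.
Proof.
move=> zA; apply/setP => a; case: (unliftP z a) => [b ->|->]; first by rewrite mem_lft inE.
by rewrite z_lft (negPf zA).
Qed.

Lemma lft_dltU (A : {set 'I_n.+1}) : z \in A -> (z |: lft (dlt A))%SET = A.
Proof.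
move=> zA; apply/setP => a; rewrite !inE; case: (unliftP z a) => [b ->|->].
  by rewrite mem_lft inE eq_sym (negPf (neq_lift z b)).
by rewrite eqxx zA.
Qed.

Lemma dltK B : dlt (lft B) = B.
Proof. by apply/setP => b; rewrite inE mem_lft. Qed.

Lemma dltUK B : dlt (z |: lft B)%SET = B.
Proof. by apply/setP => b; rewrite !inE mem_lft eq_sym (negPf (neq_lift z b)). Qed.

Lemma card_lft B : #|lft B| = #|B|.
Proof. by rewrite card_imset //; apply: lift_inj. Qed.

Lemma card_lftU B : #|(z |: lft B)%SET| = #|B|.+1.
Proof. by rewrite cardsU1 z_lft card_lft. Qed.

Lemma lft_U1 a B : lft (a |: B)%SET = (lift z a |: lft B)%SET.
Proof. by rewrite /lft imsetU1. Qed.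

Lemma ins_sub j m a : (ins j m - U_(lift z a) = ins j (m - U_(a)))%MM.
Proof.
apply/mnmP => c; rewrite mnmBE mnm1E; case: (unliftP z c) => [b ->|->].
  by rewrite !ins_lift mnmBE mnm1E (inj_eq lift_inj).
by rewrite !ins_z eq_sym (negPf (neq_lift z a)) subn0.
Qed.

Lemma ins_subz j m : (ins j.+1 m - U_(z) = ins j m)%MM.
Proof.
apply/mnmP => c; rewrite mnmBE mnm1E; case: (unliftP z c) => [b ->|->].
  by rewrite !ins_lift (negPf (neq_lift z b)) subn0.
by rewrite !ins_z eqxx subn1.
Qed.

Lemma ins_add j m a : (ins j m + U_(lift z a) = ins j (m + U_(a)))%MM.
Proof.
apply/mnmP => c; rewrite mnmDE mnm1E; case: (unliftP z c) => [b ->|->].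
  by rewrite !ins_lift mnmDE mnm1E (inj_eq lift_inj).
by rewrite !ins_z eq_sym (negPf (neq_lift z a)) addn0.
Qed.

Lemma ins_addz j m : (ins j m + U_(z) = ins j.+1 m)%MM.
Proof.
apply/mnmP => c; rewrite mnmDE mnm1E; case: (unliftP z c) => [b ->|->].
  by rewrite !ins_lift (negPf (neq_lift z b)) addn0.
by rewrite !ins_z eqxx addn1.
Qed.

Lemma mdeg_ins j m : mdeg (ins j m) = (j + mdeg m)%N.
Proof.
rewrite !mdegE (bigD1_ord z) //= ins_z; congr (_ + _)%N.
by apply: eq_bigr => b _; rewrite ins_lift.
Qed.

Lemma sum_lift (V : nmodType) (P : pred 'I_n.+1) (F : 'I_n.+1 -> V) :
  \sum_(a | P a) F a = (if P z then F z else 0) + \sum_(b | P (lift z b)) F (lift z b).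
Proof.
rewrite big_mkcond (bigD1_ord z) //=; congr (_ + _).
by rewrite [RHS]big_mkcond.
Qed.

Definition slice (V : 'X_{1..n.+1} -> bool) j : 'X_{1..n} -> bool := fun m => V (ins j m).

(** In z-degree [j] a generator containing z takes up one degree, so its coefficients have exponent
    j - 1 in z; there are none for j = 0. *)
Definition slice_pred (V : 'X_{1..n.+1} -> bool) j : 'X_{1..n} -> bool :=
  if j is j'.+1 then slice V j' else fun=> false.

End Insertion.

Section Slices.
Context {k : fieldType} {n : nat} (z : 'I_n.+1).
Variable s : 'I_n.+1 -> {set 'I_n.+1} -> k.
Hypothesis sS : sign_system s.
Implicit Types (B : {set 'I_n}) (m : 'X_{1..n}) (j : nat) (u : @chain k n.+1).

Definition res_sign (a : 'I_n) (B : {set 'I_n}) : k := s (lift z a) (lft z B).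

Lemma res_sign_system : sign_system res_sign.
Proof.
case: sS => [s0 sC]; split=> [a B|a b B aB bB ab]; first exact: s0.
by rewrite /res_sign !lft_U1 sC // ?mem_lft // (inj_eq lift_inj).
Qed.

Definition part0 j u : @chain k n := fun x => u (lft z x.1, ins z j x.2).

(** The factor [s z] turns the differential into that of a mapping cone: in z-degree [j] it sends
    the pair (u0, u1) to (d u0 + u1, - d u1). *)
Definition part1 j u : @chain k n := fun x =>
  if j is j'.+1 then s z (lft z x.1) * u ((z |: lft z x.1)%SET, ins z j' x.2) else 0.

Lemma part1_linear j : linear (part1 j).
Proof.
move=> c u v; apply/funext => x; rewrite chain_linE /part1.
case: j => [|j]; first by rewrite mulr0 addr0.
by rewrite chain_linE mulrDr mulrCA.
Qed.

Lemma bd_part0 u B m j :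
  bd s u (lft z B, ins z j m) = bd res_sign (part0 j u) (B, m) + part1 j u (B, m).
Proof.
rewrite /bd /= (sum_lift z) z_lft ins_z /= addrC; congr (_ + _).
  apply: eq_big => [a|a _]; first by rewrite mem_lft ins_lift.
  by rewrite /part0 /= lft_U1 ins_sub.
by rewrite /part1; case: j => [|j] //=; rewrite ins_subz.
Qed.

Lemma bd_part1 u B m j :
  s z (lft z B) * bd s u ((z |: lft z B)%SET, ins z j m) = - bd res_sign (part1 j.+1 u) (B, m).
Proof.
case: sS => [_ sC].
rewrite /bd /= (sum_lift z) setU11 /= add0r mulr_sumr -sumrN.
apply: eq_big => [a|a /andP[]].
  by rewrite !inE mem_lft ins_lift eq_sym (negPf (neq_lift z a)).
rewrite !inE mem_lft => /norP[_ aB] _.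
rewrite mulrA sC ?z_lft ?mem_lft // ?neq_lift // mulNr -mulrA /res_sign.
by rewrite finset.setUCA ins_sub lft_U1.
Qed.

Definition dpair : lmodType k := (@chain k n * @chain k n)%type.

(* The contribution of one degree j in the variable z: the sets A, B are the
   slices of V of degrees j and j - 1, and C, E those of U. *)
Definition dspace (s' : 'I_n -> {set 'I_n} -> k) i (A B C E : 'X_{1..n} -> bool) : set dpair :=
  [set v | [/\ supp_chain i.+1 A v.1, supp_chain i B v.2,
    forall G m, C m -> bd s' v.1 (G, m) + v.2 (G, m) = 0
  & forall G m, E m -> bd s' v.2 (G, m) = 0]].

Lemma subspace_dspace s' i (A B C E : 'X_{1..n} -> bool) : subspace (dspace s' i A B C E).
Proof.
have bl := bd_linear s'.
split=> [|c u v [u1 u2 u3 u4] [v1 v2 v3 v4]].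
  split=> [||G m _|G m _].
  - by case: (subspace_supp_chain (k := k) i.+1 A).
  - by case: (subspace_supp_chain (k := k) i B).
  - by change (bd s' (0 : chain) (G, m) + 0 = 0); rewrite (linear_0 bl) addr0.
  - by change (bd s' (0 : chain) (G, m) = 0); rewrite (linear_0 bl).
split.
- by case: (subspace_supp_chain (k := k) i.+1 A) => _; apply.
- by case: (subspace_supp_chain (k := k) i B) => _; apply.
- move=> G m Cm; change (bd s' (c *: u.1 + v.1) (G, m) + (c *: u.2 + v.2) (G, m) = 0).
  by rewrite bl !chain_linE addrACA -mulrDr u3 // v3 // mulr0 addr0.
- move=> G m Em; change (bd s' (c *: u.2 + v.2) (G, m) = 0).
  by rewrite bl chain_linE u4 // v4 // mulr0 addr0.
Qed.

Lemma pairl_linear : linear (fun v : @chain k n => (v, 0) : dpair).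
Proof.
move=> d u v; change ((d *: u + v, 0) = (d *: u + v, d *: 0 + 0) :> dpair).
by rewrite scaler0 addr0.
Qed.

Lemma pairr_linear : linear (fun v : @chain k n => (0, v) : dpair).
Proof.
move=> d u v; change ((0, d *: u + v) = (d *: 0 + 0, d *: u + v) :> dpair).
by rewrite scaler0 addr0.
Qed.

Lemma spanned_dspace N s' i (A B C E : 'X_{1..n} -> bool) : bounded N A -> bounded N B ->
  spanned (dspace s' i A B C E).
Proof.
move=> bA bB.
have [N1 [y1 h1]] := spanned_supp_chain (k := k) i.+1 bA.
have [N2 [y2 h2]] := spanned_supp_chain (k := k) i bB.
pose y l : dpair := match fintype.split l with
  inl l1 => (y1 l1, 0) | inr l2 => (0, y2 l2) end.
exists (N1 + N2)%N, y => -[v1 v2] [/h1 [c1 /= ->] /h2 [c2 /= ->] _ _].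
pose c l := match fintype.split l with inl l1 => c1 l1 | inr l2 => c2 l2 end.
exists c; rewrite big_split_ord /=.
have eL l : c (lshift N2 l) *: y (lshift N2 l) = c1 l *: (y1 l, 0).
  by rewrite /c /y (unsplitK (inl l)).
have eR l : c (rshift N1 l) *: y (rshift N1 l) = c2 l *: (0, y2 l).
  by rewrite /c /y (unsplitK (inr l)).
rewrite (eq_bigr (fun l => c1 l *: ((y1 l, 0) : dpair)) (fun l _ => eL l)).
rewrite (eq_bigr (fun l => c2 l *: ((0, y2 l) : dpair)) (fun l _ => eR l)).
rewrite -(linear_sum pairl_linear) -(linear_sum pairr_linear).
set x1 := \sum_l _; set x2 := \sum_l _.
by change ((x1, x2) = (x1 + 0, 0 + x2) :> dpair); rewrite addr0 add0r.
Qed.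

Definition parts j u : dpair := (part0 j u, part1 j u).

Lemma parts_linear j : linear (parts j).
Proof. by move=> c u v; rewrite /parts part1_linear. Qed.

(** The differential preserves the degree in z in which e_z counts once, so the conditions separate
    by that degree; since signs do not vanish, the normalisation in [part1] can be undone. *)
Lemma K_parts i V U u :
  K s i.+1 V U u <->
  forall j, dspace res_sign i (slice z V j) (slice_pred z V j)
                   (slice z U j) (slice_pred z U j) (parts j u).
Proof.
case: (sS) => [s0 _]; split=> [[hu bu] j|h].
  split=> [[B m] /= h|[B m] /= h|B m Um|B m].
  - by apply: hu; rewrite /= card_lft.
  - rewrite /part1; case: j h => [//|j] h.
    by rewrite hu ?mulr0 //= card_lftU.
  - by rewrite -bd_part0 bu.
  - case: j => [//|j] Um /=.
    by apply/eqP; rewrite -oppr_eq0 -bd_part1 bu // mulr0.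
split=> [[A M]|A M UM] /=.
  case: (insP z M) => -[j m] /= -> hA; case: (boolP (z \in A)) => zA.
    have [_ h2 _ _] := h j.+1.
    have /eqP : part1 j.+1 u (dlt z A, m) = 0.
      apply: h2; apply: contra hA => /andP[/eqP cA Vm] /=.
      by rewrite -[A](lft_dltU zA) card_lftU -cA eqxx.
    by rewrite /part1 /= lft_dltU // mulf_eq0 (negPf (s0 _ _)) => /eqP.
  have [h1 _ _ _] := h j.
  have : part0 j u (dlt z A, m) = 0.
    apply: h1; apply: contra hA => /andP[/eqP cA Vm] /=.
    by rewrite -[A](lft_dlt zA) card_lft -cA eqxx.
  by rewrite /part0 /= lft_dlt.
case: (insP z M) UM => -[j m] /= -> Um; case: (boolP (z \in A)) => zA.
  have [_ _ _ h4] := h j.+1.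
  have := bd_part1 u (dlt z A) m j; rewrite h4 // oppr0 lft_dltU //.
  by move/eqP; rewrite mulf_eq0 (negPf (s0 _ _)) => /eqP.
have [_ _ h3 _] := h j.
by rewrite -[A](lft_dlt zA) bd_part0 h3.
Qed.

Definition glue j (w : dpair) : @chain k n.+1 := fun x =>
  if z \in x.1 then
    if (x.2 z).+1 == j then (s z (lft z (dlt z x.1)))^-1 * w.2 (dlt z x.1, delm z x.2) else 0
  else if x.2 z == j then w.1 (dlt z x.1, delm z x.2) else 0.

Lemma glue_linear j : linear (glue j).
Proof.
move=> c u v; apply/funext => x; rewrite chain_linE /glue.
case: ifP => _; case: ifP => _; rewrite ?mulr0 ?addr0 //.
by rewrite /= chain_linE mulrDr mulrCA.
Qed.

(** In z-degree 0 there is no room for e_z, so a pair is recovered only if its second component is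
    zero; the left alternative says this, as support in the empty set. *)
Lemma parts_glue j q w : supp_chain 0 (fun=> false) w.2 \/ q != 0%N ->
  parts j (glue q w) = if j == q then w else 0.
Proof.
case: (sS) => [s0 _] hq.
rewrite (surjective_pairing w) /parts (_ : (if _ then _ else _) =
  (if j == q then w.1 else 0, if j == q then w.2 else 0)); last by case: ifP.
congr (_, _); apply/funext => -[B m] /=.
  rewrite /part0 /glue /= z_lft ins_z dltK insK.
  by case: (j == q).
rewrite /part1 /glue /=; case: j => [|j].
  case: eqP => // q0; case: hq => [h|]; last by rewrite -q0.
  by rewrite h // andbF.
rewrite setU11 ins_z dltUK insK; case: ifP => _; last by rewrite mulr0.
by rewrite mulrA divff ?mul1r.
Qed.

(** The sum includes z-degree [N] although exponents of z stay below [N]: exponent N - 1 together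
    with a factor e_z has z-degree [N]. *)
Lemma fdim_K_slices N i V U : bounded N V ->
  fdim (K s i.+1 V U) =
  (\sum_(j < N.+1) fdim (dspace res_sign i (slice z V j) (slice_pred z V j)
                   (slice z U j) (slice_pred z U j)))%N.
Proof.
move=> bV; case: (sS) => [s0 _].
have bsl j : bounded N (slice z V j).
  by move=> m /bV; rewrite mdeg_ins; lia.
have bsp j : bounded N (slice_pred z V j).
  by case: j => [//|j] m /bV; rewrite mdeg_ins; lia.
have sd := fun i (A B C E : 'X_{1..n} -> bool) => @subspace_dspace res_sign i A B C E.
apply/eqP; rewrite eqn_leq; apply/andP; split.
  apply: (@fdim_peel_le k _ N.+1 (fun=> dpair) (fun q => parts q)) => //.
  - by move=> q; apply: parts_linear.
  - exact: subspace_K.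
  - exact: spanned_K bV.
  - by move=> q; apply: spanned_dspace (bsl q) (bsp q).
  - by move=> q u /K_parts h _; apply: h.
  - move=> u [hu _] h0; apply/funext => -[A M]; rewrite chain0E.
    case: (boolP ((#|A| == i.+1) && V M)) => [/andP[_ VM]|h]; last exact: (hu (A, M) h).
    have := bV _ VM; case: (insP z M) VM => -[j m] /= -> Vm; rewrite mdeg_ins => jN.
    case: (boolP (z \in A)) => zA.
      have lt : (j.+1 < N.+1)%N by lia.
      have /(congr1 (fun v : dpair => v.2 (dlt z A, m))) := h0 (Ordinal lt).
      rewrite /= /part1 /= lft_dltU // => /eqP.
      by rewrite mulf_eq0 (negPf (s0 _ _)) => /eqP.
    have lt : (j < N.+1)%N by lia.
    have /(congr1 (fun v : dpair => v.1 (dlt z A, m))) := h0 (Ordinal lt).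
    by rewrite /= /part0 /= lft_dlt.
have pg (q : 'I_N.+1) w j : dspace res_sign i (slice z V q) (slice_pred z V q)
    (slice z U q) (slice_pred z U q) w ->
    parts j (glue q w) = if j == q :> nat then w else 0.
  move=> [_ w2 _ _]; apply: parts_glue; case: (val q) w2 => [|q'] w2; [left|right] => //.
  by move=> x _; apply: w2; rewrite andbF.
apply: (@fdim_peel_ge k _ N.+1 (fun=> dpair) (fun q => parts q) (fun q => glue q)) => //.
- by move=> q; apply: parts_linear.
- by move=> q; apply: glue_linear.
- exact: subspace_K.
- exact: spanned_K bV.
- move=> q w hw; apply/K_parts => j; rewrite pg //; case: eqP => [->|_] //.
  by case: (sd i (slice z V j) (slice_pred z V j) (slice z U j) (slice_pred z U j)).
- by move=> q w hw; rewrite pg // eqxx.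
- by move=> q w j jq hw; rewrite pg // ltn_eqF.
Qed.

End Slices.

Section SliceBounds.
Context {k : fieldType} {n : nat}.
Variable s : 'I_n -> {set 'I_n} -> k.
Hypothesis sS : sign_system s.
Variables (N i : nat) (A B C E : 'X_{1..n} -> bool).
Hypotheses (bA : bounded N A) (bB : bounded N B).

Let D := dspace s i A B C E.
Let sD : subspace D. Proof. exact: subspace_dspace. Qed.
Let pD : spanned D. Proof. exact: spanned_dspace bA bB. Qed.
Let bL := bd_linear s.

(** Project to the second component; on the kernel only the condition at [C] on the first one is
    left. When [C] is the complement of a set X in [T], this bound is attained if [B] lies in X,
    whereas [fdim_dspace_le2] is attained if X lies in [B]. *)
Lemma fdim_dspace_le1 : (fdim D <= fdim (K s i B E) + fdim (K s i.+1 A C))%N.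
Proof.
apply: (fdim_add_le (f := fun v : dpair => v.2) (g := fun v : dpair => v.1)) => //.
- exact: subspace_K.
- exact: spanned_K bB.
- exact: subspace_K.
- exact: spanned_K bA.
- by move=> v [_ v2 _ v4].
- move=> v [v1 _ v3 _] v20; split=> // G m Cm.
  by have := v3 G m Cm; rewrite v20 addr0.
- by move=> [v1 v2] _ /= -> ->.
Qed.

(** As [B] misses [C], the second component does not enter the condition at [C], and the components
    can be chosen independently. *)
Lemma fdim_dspace_ge1 : (forall m, B m -> ~~ C m) ->
  (fdim (K s i B E) + fdim (K s i.+1 A C) <= fdim D)%N.
Proof.
move=> BC.
apply: (fdim_add_ge pairr_linear pairl_linear) => //.
- exact: subspace_K.
- exact: subspace_K.
- move=> w [hw bw]; split=> //= G m Cm.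
  rewrite (linear_0 bL) add0r hw //= negb_and orbC.
  by apply/orP; left; apply: contraL Cm; apply: BC.
- move=> w [hw bw]; split=> //= G m Cm; first by rewrite bw // addr0.
  by rewrite (linear_0 bL).
- move=> w1 w2 _ _ e; have := congr1 fst e; have := congr1 snd e => /=.
  by rewrite addr0 add0r.
Qed.

Variable T : 'X_{1..n} -> bool.
Hypotheses (bT : bounded N T) (BT : forall m, B m -> T m) (CT : forall m, C m -> T m).
Hypothesis ET : forall m a, E m -> (0 < m a)%N -> T (m - U_(a))%MM.

Let restT := rest (k := k) (fun x : {set 'I_n} * 'X_{1..n} => T x.2).

Let bd_restT u G m : E m -> bd s (restT u) (G, m) = bd s u (G, m).
Proof. by move=> Em; apply: bd_ext => a _ ma; rewrite /restT /rest /= ET. Qed.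

Let bTC : bounded N (fun m => T m && ~~ C m).
Proof. by apply: boundedS bT => m /andP[]. Qed.

(** Here d v1 + v2, restricted to [T], replaces v2 as coordinate: it vanishes on [C], and its
    boundary on [E] is that of v2 because the boundary at [E] involves only monomials of [T]. Where
    it is zero, v2 = - d v1 on [T], which confines d v1 to [B] there. *)
Lemma fdim_dspace_le2 :
  (fdim D <= fdim (K s i (fun m => T m && ~~ C m) E) +
             fdim (K s i.+1 A (fun m => T m && ~~ B m)))%N.
Proof.
have fL : linear (fun v : @dpair k n => restT (bd s v.1 + v.2)).
  move=> c u v; change (restT (bd s (c *: u.1 + v.1) + (c *: u.2 + v.2)) =
    c *: restT (bd s u.1 + u.2) + restT (bd s v.1 + v.2)).
  by rewrite bL -(rest_linear _ c); congr restT; rewrite scalerDr addrACA.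
apply: (fdim_add_le (g := fun v : dpair => v.1) fL) => //.
- exact: subspace_K.
- exact: spanned_K bTC.
- exact: subspace_K.
- exact: spanned_K bA.
- move=> v [v1 v2 v3 v4]; split=> [[G m] /=|G m Em].
    rewrite /restT /rest /= chainDE; case: ifP => //= Tm.
    case: (boolP (C m)) => Cm; first by rewrite v3.
    rewrite andbT => Gi; rewrite (bd_supp _ v1 _ Gi) add0r.
    by apply: v2; rewrite negb_and Gi.
  by rewrite bd_restT // (linear_D bL) chainDE v4 // addr0 bd_bd.
- move=> v [v1 v2 v3 v4] v0; split=> // G m /andP[Tm nB].
  have := congr1 (fun u : chain => u (G, m)) v0.
  rewrite /restT /rest /= Tm chainDE chain0E => <-.
  by rewrite v2 ?addr0 //= (negPf nB) andbF.
- move=> [v1 v2] [_ h2 _ _] /= v0 v10; rewrite v10 in v0 *; congr (_, _).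
  apply/funext => -[G m]; rewrite chain0E.
  case: (boolP (T m)) => Tm.
    have := congr1 (fun u : chain => u (G, m)) v0.
    by rewrite /restT /rest /= Tm chainDE (linear_0 bL) add0r.
  apply: h2 => /=; apply/negP => /andP[_ /BT]; exact/negP.
Qed.

(** If the boundary of v1 on [T] is supported in [B], then - d v1 is an admissible second component;
    what can still be added to it lives on the part of [T] outside [C], which is contained in
    [B]. *)
Lemma fdim_dspace_ge2 : (forall m, T m -> ~~ C m -> B m) ->
  (fdim (K s i (fun m => T m && ~~ C m) E) +
     fdim (K s i.+1 A (fun m => T m && ~~ B m)) <= fdim D)%N.
Proof.
move=> TCB.
have gL : linear (fun v : @chain k n => (v, - restT (bd s v)) : dpair).
  move=> c u v; change ((c *: u + v, - restT (bd s (c *: u + v))) =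
    (c *: u + v, c *: (- restT (bd s u)) - restT (bd s v)) :> dpair).
  by rewrite bL /restT (rest_linear _ c) opprD scalerN.
apply: (fdim_add_ge pairr_linear gL) => //.
- exact: subspace_K.
- exact: subspace_K.
- move=> w [hw bw]; split=> //= [[G m] h|G m Cm].
    by apply: hw; apply: contra h => /andP[-> /andP[Tm /TCB ->]].
  by rewrite (linear_0 bL) add0r hw //= Cm !andbF.
- move=> w [hw bw]; split=> //= [[G m] /= h|G m Cm|G m Em].
  + rewrite chainNE /restT /rest /=; case: ifP => Tm; last by rewrite oppr0.
    apply/eqP; rewrite oppr_eq0; apply/eqP; move: h; rewrite negb_and.
    by case/orP => [/(bd_supp _ hw) //|nB]; apply: bw; rewrite Tm nB.
  + by rewrite chainNE /restT /rest /= CT // subrr.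
  + rewrite -scaleN1r (linear_Z bL) /GRing.scale /=.
    by rewrite bd_restT // bd_bd // /GRing.scale /= mulr0.
- move=> w1 w2 _ _ e.
  have w20 : w2 = 0 by have := congr1 fst e; rewrite /= add0r.
  split=> //; have := congr1 snd e; rewrite /= w20 (linear_0 bL).
  by rewrite /restT (linear_0 (rest_linear _)) subr0.
Qed.

End SliceBounds.

(** * Lex sets in a box *)

Section LexSets.
Context {n : nat}.
Implicit Types (e : 'I_n -> nat) (m u v : 'X_{1..n}) (V W L M T : 'X_{1..n} -> bool).

Definition inbox e m : bool := [forall a, (m a < e a)%N].

(* The monomials of degree d - j in the box; for j > d there are none. *)
Definition Tbox e d j m : bool := inbox e m && (mdeg m + j == d)%N.

(** The order compares degrees first; on a homogeneous [T] it is the lexicographic order with the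
    first variable largest. *)
Definition islex T L : Prop :=
  (forall m, L m -> T m) /\ forall u v, L u -> T v -> (u < v)%O -> L v.

Lemma inboxP e m : reflect (forall a, (m a < e a)%N) (inbox e m).
Proof. exact: forallP. Qed.

Lemma bounded_Tbox e d j N : (d < N)%N -> bounded N (Tbox e d j).
Proof. by move=> dN m /andP[_ /eqP]; lia. Qed.

Lemma inbox_sub e m a : inbox e m -> inbox e (m - U_(a))%MM.
Proof. by move/inboxP => h; apply/inboxP => b; rewrite mnmBE; have := h b; lia. Qed.

Lemma Tbox_sub e d j m a : Tbox e d.+1 j m -> (0 < m a)%N -> Tbox e d j (m - U_(a))%MM.
Proof.
move=> /andP[bm dm] ma; rewrite /Tbox inbox_sub //=.
by have := mdeg_sub ma; lia.
Qed.

Lemma Tbox_S e d j m : Tbox e d.+1 j.+1 m = Tbox e d j m.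
Proof. by rewrite /Tbox addnS eqSS. Qed.

Lemma islexT T : islex T T.
Proof. by split. Qed.

Lemma islex0 T : islex T (fun=> false).
Proof. by split. Qed.

Lemma islex_cmp T L M : islex T L -> islex T M ->
  (forall m, L m -> M m) \/ (forall m, M m -> L m).
Proof.
move=> [LT Ll] [MT Ml]; case: (pselect (exists m, L m && ~~ M m)) => [[m /andP[Lm nM]]|no].
  right=> x Mx; case: (ltgtP x m) => [xm|mx|->] //.
    by move: nM; rewrite (Ml x m) // LT.
  by apply: (Ll m) => //; apply: MT.
by left=> m Lm; apply: contraT => nM; case: no; exists m; rewrite Lm.
Qed.

Lemma islex_exists N T c : (c <= crd N T)%N -> bounded N T ->
  exists L, islex T L /\ crd N L = c.
Proof.
move=> hc bT.
have geT : total (fun u v : 'X_{1..n} => (v <= u)%O) by move=> u v; apply: le_total.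
pose s := sort (fun u v => (v <= u)%O) (filter T (mons N)).
have us : uniq s by rewrite sort_uniq filter_uniq ?uniq_mons.
have ms m : (m \in s) = T m.
  rewrite mem_sort mem_filter mem_mons; case: (boolP (T m)) => //= /bT.
  by [].
have ss : sorted (fun u v => (v <= u)%O) s by apply: sort_sorted.
have szs : size s = crd N T by rewrite size_sort size_filter.
exists (fun m => m \in take c s); split; last first.
  have : perm_eq (filter (mem (take c s)) (mons N)) (take c s).
    apply: uniq_perm; rewrite ?filter_uniq ?uniq_mons ?take_uniq // => m.
    rewrite mem_filter mem_mons /= andb_idr // => /mem_take; rewrite ms; exact: bT.
  by move=> /perm_size; rewrite size_filter size_take_min szs => h; apply: (etrans h); lia.
split=> [m /mem_take|u v ut Tv uv]; first by rewrite ms.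
have vs : v \in s by rewrite ms.
have us' := mem_take ut.
rewrite in_take_leq ?szs // ltnNge; apply/negP => cv.
have iu : (index u s < c)%N by rewrite -in_take_leq ?szs.
have : (v <= u)%O.
  rewrite -(nth_index 0%MM vs) -(nth_index 0%MM us').
  have tr : transitive (fun u v : 'X_{1..n} => (v <= u)%O).
    by move=> x y w /= yx wy; apply: le_trans wy yx.
  apply: (sorted_leq_nth tr _ 0%MM ss); rewrite ?inE ?index_mem //.
  by apply: ltnW; apply: leq_trans iu cv.
by rewrite leNgt uv.
Qed.

Definition wsum N (f : 'X_{1..n} -> nat) V : nat := \sum_(m <- mons N | V m) f m.

Lemma wsum_diff N f V W : (forall m, W m -> V m) ->
  wsum N f V = (wsum N f W + wsum N f (fun m => V m && ~~ W m))%N.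
Proof.
move=> WV; rewrite /wsum (bigID W) /=; congr (_ + _)%N.
by apply: eq_bigl => m; case: (boolP (W m)) => [/WV ->|]; rewrite ?andbF.
Qed.

(* Every element of L \ V lies above every element of V \ L. *)
Lemma wsum_islex N f T V L :
  (forall u v, T u -> T v -> (u < v)%O -> (f u < f v)%N) ->
  bounded N T -> (forall m, V m -> T m) -> islex T L -> crd N V = crd N L ->
  (wsum N f V <= wsum N f L)%N /\
  (wsum N f V = wsum N f L -> forall m, V m = L m).
Proof.
move=> fm bT VT [LT Ll] e.
pose I m := V m && L m.
have IV m : I m -> V m by case/andP.
have IL m : I m -> L m by case/andP.
have dV : forall m, (V m && ~~ I m) = V m && ~~ L m by move=> m; rewrite /I; case: (V m).
have dL : forall m, (L m && ~~ I m) = L m && ~~ V m.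
  by move=> m; rewrite /I andbC; case: (L m); rewrite ?andbT ?andbF.
have cd : crd N (fun m => V m && ~~ L m) = crd N (fun m => L m && ~~ V m).
  have := crd_diff N IV; have := crd_diff N IL.
  by rewrite (eq_crd N dV) (eq_crd N dL) e; lia.
rewrite (wsum_diff _ _ IV) (wsum_diff _ _ IL).
have wE X Y : X =1 Y -> wsum N f X = wsum N f Y by move=> XY; apply: eq_bigl.
rewrite (wE _ _ dV) (wE _ _ dL).
have [p0|p0] := posnP (crd N (fun m => V m && ~~ L m)).
  have VL : forall m, V m -> L m.
    move=> m Vm; apply: contraT => nL.
    have := @crd_gt0 _ N (fun m => V m && ~~ L m) m; rewrite p0 ltnn Vm nL => -> //.
    by move=> m' /andP[/VT /bT].
  have LV := crd_eq_sub (boundedS LT bT) VL e.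
  have VE m : V m = L m by apply/idP/idP => [/VL|/LV].
  by split=> // ; rewrite eq_leq //; congr (_ + _)%N; apply: wE => m; rewrite VE.
pose t := \max_(m <- mons N | V m && ~~ L m) f m.
have h1 : (wsum N f (fun m => V m && ~~ L m) <= t * crd N (fun m => V m && ~~ L m))%N.
  rewrite /crd -sum1_count big_distrr /= /wsum.
  rewrite big_seq_cond [X in (_ <= X)%N]big_seq_cond.
  by apply: leq_sum => m /andP[mN h]; rewrite muln1; apply: leq_bigmax_seq.
have h2 : (t.+1 * crd N (fun m => L m && ~~ V m) <= wsum N f (fun m => L m && ~~ V m))%N.
  rewrite /crd -sum1_count big_distrr /= /wsum; apply: leq_sum => y /andP[Ly nV].
  rewrite muln1; have fy x : V x && ~~ L x -> (f x < f y)%N.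
    case/andP=> Vx nL; apply: fm; [exact: VT|exact: LT|].
    case: (ltgtP x y) => // [yx|xy]; last by rewrite -xy Vx in nV.
    by rewrite (Ll y x) ?VT in nL.
  move: p0; rewrite -has_count => /hasP[x0 _ /fy x0y].
  rewrite -(ltn_predK x0y) ltnS; apply/bigmax_leqP_seq => x _ /fy.
  by rewrite -{1}(ltn_predK x0y).
move: h1 h2; rewrite -cd mulSn => h1 h2.
by split; lia.
Qed.

End LexSets.

Section SliceSets.
Context {n : nat} (z : 'I_n.+1).
Implicit Types (V W : 'X_{1..n.+1} -> bool) (e : 'I_n.+1 -> nat).

Lemma bounded_slice N V j : bounded N V -> bounded N (slice z V j).
Proof. by move=> bV m /bV; rewrite mdeg_ins; lia. Qed.

Lemma wsum_slices N f V : bounded N V ->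
  wsum N f V = (\sum_(j < N) wsum N (fun m => f (ins z j m)) (slice z V j))%N.
Proof.
move=> bV; rewrite {1}/wsum -big_filter.
pose s := [seq ins z j m | j <- iota 0 N, m <- filter (slice z V j) (mons N)].
have h : perm_eq (filter V (mons N)) s.
  apply: uniq_perm; first by rewrite filter_uniq ?uniq_mons.
    apply: allpairs_uniq_dep => [|j _|]; rewrite ?iota_uniq ?filter_uniq ?uniq_mons //.
    by move=> [j m] [j' m'] _ _ /= /ins_inj [-> ->].
  move=> M; rewrite mem_filter mem_mons.
  apply/andP/allpairsPdep => /= [[VM _]|[j [m [_]]]].
    case: (insP z M) VM => -[j m] /= -> Vm; exists j, m; split=> //.
      by rewrite mem_iota /=; have := bV _ Vm; rewrite mdeg_ins; lia.
    by rewrite mem_filter mem_mons (bounded_slice bV Vm) /slice Vm.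
  by rewrite mem_filter => /andP[Vm _] ->; split=> //; apply: bV.
rewrite (perm_big _ h) big_allpairs_dep -[X in iota 0 X]subn0 -/(index_iota 0 N) big_mkord.
by apply: eq_bigr => j _; rewrite big_filter.
Qed.

Lemma crd_slices N V : bounded N V ->
  crd N V = (\sum_(j < N) crd N (slice z V j))%N.
Proof.
have cE p (X : 'X_{1..p} -> bool) : crd N X = wsum N (fun=> 1%N) X by rewrite /wsum sum1_count.
by move=> bV; rewrite cE wsum_slices //; apply: eq_bigr => j _; rewrite cE.
Qed.

Definition res_box e : 'I_n -> nat := fun a => e (lift z a).

Lemma inbox_ins e j m : inbox e (ins z j m) = (j < e z)%N && inbox (res_box e) m.
Proof.
apply/inboxP/andP => [h|[jz /inboxP h] a].
  split; first by have := h z; rewrite ins_z.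
  by apply/inboxP => a; have := h (lift z a); rewrite ins_lift.
by case: (unliftP z a) => [b ->|->]; rewrite ?ins_z ?ins_lift //; apply: h.
Qed.

Lemma slice_Tbox e d j0 j m :
  slice z (Tbox e d j0) j m = (j < e z)%N && Tbox (res_box e) d (j0 + j) m.
Proof. by rewrite /slice /Tbox inbox_ins mdeg_ins -andbA; congr [&& _, _ & _]; lia. Qed.

Lemma ltmc_ins j (u v : 'X_{1..n}) : mdeg u = mdeg v ->
  (ins z j u < ins z j v)%O = (u < v)%O.
Proof.
move=> e; have eM : mdeg (ins z j u) = mdeg (ins z j v) by rewrite !mdeg_ins e.
have lt (a b : 'I_n) : (lift z a < lift z b)%N = (a < b)%N.
  by rewrite /= /bump; case: leqP; case: leqP; lia.
apply/(ltmcP eM)/(ltmcP e) => -[i eqi lti].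
  case: (unliftP z i) lti eqi => [b ->|->]; last by rewrite !ins_z ltnn.
  rewrite !ins_lift => ltb eqb; exists b => // a ab.
  by have := eqb (lift z a); rewrite !ins_lift lt; apply.
exists (lift z i); last by rewrite !ins_lift.
move=> a; case: (unliftP z a) => [b ->|->]; last by rewrite !ins_z.
by rewrite lt !ins_lift; apply: eqi.
Qed.

Lemma res_box_mono e : (forall a b : 'I_n.+1, (a <= b)%N -> (e a <= e b)%N) ->
  forall a b : 'I_n, (a <= b)%N -> (res_box e a <= res_box e b)%N.
Proof. by move=> he a b ab; apply: he; rewrite /= leq_bump2. Qed.

End SliceSets.

(** * Compression *)

Definition monotone_box n (e : 'I_n -> nat) : Prop :=
  forall a b : 'I_n, (a <= b)%N -> (e a <= e b)%N.

(** The statement proved by induction on [n]. [V] and [W] are otherwise unrelated, since the slices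
    to which it is applied need not come from an ideal, and the boundary is constrained only inside
    the box. With two sign systems the result also shows that the signs do not matter. *)
Definition lex_extremal (k : fieldType) n : Prop :=
  forall (e : 'I_n -> nat) (s s' : 'I_n -> {set 'I_n} -> k) N d j i
    (V W L M : 'X_{1..n} -> bool),
  monotone_box e -> sign_system s -> sign_system s' -> (d.+1 < N)%N ->
  (forall m, V m -> Tbox e d j m) -> (forall m, W m -> Tbox e d.+1 j m) ->
  islex (Tbox e d j) L -> islex (Tbox e d.+1 j) M ->
  crd N V = crd N L -> crd N W = crd N M ->
  (fdim (K s i V (fun m => Tbox e d.+1 j m && ~~ W m)) <=
   fdim (K s' i L (fun m => Tbox e d.+1 j m && ~~ M m)))%N.

Lemma compl_compl n (T X : 'X_{1..n} -> bool) : (forall m, X m -> T m) ->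
  (fun m => T m && ~~ (T m && ~~ X m)) = X.
Proof.
move=> XT; apply/funext => m; rewrite negb_and negbK.
by case: (boolP (X m)) => [/XT ->|]; rewrite ?orbT // orbF andbN.
Qed.

Section Compression.
Context {k : fieldType} {n : nat}.
Hypothesis Rn : lex_extremal k n.

(** The lex sets [B'] and [X'] live in the same degree, hence are nested. Whichever contains the
    other selects the bound on [dspace] that is exact for the lex sets, and its two terms are
    compared by the induction hypothesis. *)
Lemma fdim_dspace_lex_le (e : 'I_n -> nat) (s : 'I_n -> {set 'I_n} -> k) N d j i
    (A B X Y A' B' X' Y' : 'X_{1..n} -> bool) :
  monotone_box e -> sign_system s -> (d.+2 < N)%N ->
  let T0 := Tbox e d j in let T1 := Tbox e d.+1 j in let T2 := Tbox e d.+2 j in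
  (forall m, A m -> T0 m) -> (forall m, B m -> T1 m) ->
  (forall m, X m -> T1 m) -> (forall m, Y m -> T2 m) ->
  islex T0 A' -> islex T1 B' -> islex T1 X' -> islex T2 Y' ->
  crd N A = crd N A' -> crd N B = crd N B' -> crd N X = crd N X' -> crd N Y = crd N Y' ->
  (fdim (dspace s i A B (fun m => T1 m && ~~ X m) (fun m => T2 m && ~~ Y m)) <=
   fdim (dspace s i A' B' (fun m => T1 m && ~~ X' m) (fun m => T2 m && ~~ Y' m)))%N.
Proof.
move=> em sS dN T0 T1 T2 AT BT XT YT lA lB lX lY cA cB cX cY.
have dN' : (d.+1 < N)%N by apply: ltnW.
have b0 : bounded N T0 by apply: bounded_Tbox; lia.
have b1 : bounded N T1 by apply: bounded_Tbox; lia.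
have bA : bounded N A by apply: boundedS b0.
have bB : bounded N B by apply: boundedS b1.
have bA' : bounded N A' by apply: boundedS lA.1 b0.
have bB' : bounded N B' by apply: boundedS lB.1 b1.
have T21 m a : T2 m && ~~ Y m -> (0 < m a)%N -> T1 (m - U_(a))%MM.
  by move=> /andP[h _]; apply: Tbox_sub.
have T21' m a : T2 m && ~~ Y' m -> (0 < m a)%N -> T1 (m - U_(a))%MM.
  by move=> /andP[h _]; apply: Tbox_sub.
case: (islex_cmp lB lX) => [BX|XB].
  apply: leq_trans (fdim_dspace_le1 s i _ _ bA bB) _.
  apply: (leq_trans _ (fdim_dspace_ge1 s i _ bA' bB' _)); last first.
    by move=> m /BX ->; rewrite andbF.
  by apply: leq_add; apply: (@Rn _ _ _ N _ _ _ _ _ _ _ em).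
apply: leq_trans (fdim_dspace_le2 sS i _ bA b1 BT T21) _.
have CT m : T1 m && ~~ X' m -> T1 m by case/andP.
apply: (leq_trans _ (fdim_dspace_ge2 sS i bA' bB' CT T21' _)); last first.
  by move=> m Tm; rewrite Tm /= negbK; apply: XB.
rewrite !compl_compl //; last exact: lX.1.
by apply: leq_add; apply: (@Rn _ _ _ N _ _ _ _ _ _ _ em).
Qed.

Variables (e : 'I_n.+1 -> nat) (s : 'I_n.+1 -> {set 'I_n.+1} -> k).
Hypotheses (em : monotone_box e) (sS : sign_system s).
Implicit Types (V W : 'X_{1..n.+1} -> bool).

Definition lex_sliced (z : 'I_n.+1) d j0 V : Prop :=
  forall j, (j < e z)%N -> islex (Tbox (res_box z e) d (j0 + j)) (slice z V j).

Lemma slice_sub z d j0 j V : (forall m, V m -> Tbox e d j0 m) ->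
  forall m, slice z V j m -> (j < e z)%N && Tbox (res_box z e) d (j0 + j) m.
Proof. by move=> VT m /VT; rewrite -(slice_Tbox z e d j0 j m). Qed.

Lemma slice_compl z d j0 j W m :
  slice z (fun m => Tbox e d j0 m && ~~ W m) j m =
  Tbox (res_box z e) d (j0 + j) m &&
    ~~ (if (j < e z)%N then slice z W j m else Tbox (res_box z e) d (j0 + j) m).
Proof.
rewrite {1}/slice -[Tbox e d j0 _]/(slice z (Tbox e d j0) j m) slice_Tbox.
by case: ifP => //= _; rewrite andbN.
Qed.

Lemma fdim_K_sliced_le z N d j0 i V W V' W' : (d.+2 < N)%N ->
  (forall m, V m -> Tbox e d j0 m) -> (forall m, W m -> Tbox e d.+1 j0 m) ->
  (forall m, V' m -> Tbox e d j0 m) -> (forall m, W' m -> Tbox e d.+1 j0 m) ->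
  lex_sliced z d j0 V' -> lex_sliced z d.+1 j0 W' ->
  (forall j, crd N (slice z V j) = crd N (slice z V' j)) ->
  (forall j, crd N (slice z W j) = crd N (slice z W' j)) ->
  (fdim (K s i.+1 V (fun m => Tbox e d.+1 j0 m && ~~ W m)) <=
   fdim (K s i.+1 V' (fun m => Tbox e d.+1 j0 m && ~~ W' m)))%N.
Proof.
move=> dN VT WT V'T W'T lV lW cV cW.
have bT : bounded N (Tbox e d j0) by apply: bounded_Tbox; lia.
rewrite !(fdim_K_slices z sS _ _ (N := N)); try by apply: boundedS bT.
apply: leq_sum => -[j /= _] _.
(* Beyond the box in z there is no condition on the boundary; [X] is then the whole box in the other
   variables, a lex set with empty complement. [Y] does the same in z-degree 0. *)
pose X W j m := if (j < e z)%N then slice z W j m else Tbox (res_box z e) d.+1 (j0 + j) m.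
pose Y W j m := if j is j'.+1 then X W j' m else Tbox (res_box z e) d.+2 j0 m.
have CE U : slice z (fun m => Tbox e d.+1 j0 m && ~~ U m) j =
    (fun m => Tbox (res_box z e) d.+1 (j0 + j) m && ~~ X U j m).
  by apply/funext => m; rewrite slice_compl.
have EE U : slice_pred z (fun m => Tbox e d.+1 j0 m && ~~ U m) j =
    (fun m => Tbox (res_box z e) d.+2 (j0 + j) m && ~~ Y U j m).
  case: (j) => [|j'] /=; apply/funext => m; first by rewrite addn0 andbN.
  by rewrite slice_compl addnS Tbox_S.
rewrite !CE !EE.
have XT (U : 'X_{1..n.+1} -> bool) : (forall m, U m -> Tbox e d.+1 j0 m) -> forall j' m, X U j' m ->
    Tbox (res_box z e) d.+1 (j0 + j') m.
  by move=> UT j' m; rewrite /X; case: ifP => // _ /(slice_sub UT) /andP[].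
have lX U : lex_sliced z d.+1 j0 U -> forall j', islex (Tbox (res_box z e) d.+1 (j0 + j')) (X U j').
  by move=> lU j'; rewrite /X; case: ltnP => h; [apply: lU|apply: islexT].
have empty (U : 'X_{1..n.+1} -> bool) d' : (forall m, U m -> Tbox e d' j0 m) -> forall j', (e z <= j')%N ->
    slice z U j' = (fun=> false).
  move=> UT j' h; apply/funext => m; apply/negP => /(slice_sub UT) /andP[].
  by rewrite ltnNge h.
apply: (fdim_dspace_lex_le (N := N)) => //.
- exact: res_box_mono.
- exact: res_sign_system.
- by move=> m /(slice_sub VT) /andP[].
- by case: (j) => [//|j'] m /(slice_sub VT) /andP[]; rewrite addnS Tbox_S.
- exact: XT.
- by case: (j) => [|j'] m /=; [rewrite addn0|move/(XT _ WT); rewrite addnS Tbox_S].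
- case: (ltnP j (e z)) => h; first exact: lV.
  by rewrite (empty V' d); [exact: islex0|exact: V'T|].
- case: (j) => [|j'] /=; first exact: islex0.
  have -> : Tbox (res_box z e) d.+1 (j0 + j'.+1) = Tbox (res_box z e) d (j0 + j').
    by apply/funext => m; rewrite addnS Tbox_S.
  case: (ltnP j' (e z)) => h; first exact: lV.
  by rewrite (empty V' d); [exact: islex0|exact: V'T|].
- exact: lX.
- case: (j) => [|j'] /=; first by rewrite addn0; apply: islexT.
  have -> : Tbox (res_box z e) d.+2 (j0 + j'.+1) = Tbox (res_box z e) d.+1 (j0 + j').
    by apply/funext => m; rewrite addnS Tbox_S.
  exact: lX.
- by case: (j) => [|j'] /=; rewrite ?cV.
- by rewrite /X; case: (j < e z)%N; first exact: cW.
- by rewrite /Y /X; case: (j) => [|j'] //; case: (j' < e z)%N; first exact: cW.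
Qed.

Lemma exists_lex_sliced z N d j0 V : (d < N)%N -> (forall m, V m -> Tbox e d j0 m) ->
  exists V', [/\ forall m, V' m -> Tbox e d j0 m, lex_sliced z d j0 V'
    & forall j, crd N (slice z V j) = crd N (slice z V' j)].
Proof.
move=> dN VT.
have ex j : exists L, islex (Tbox (res_box z e) d (j0 + j)) L /\ crd N L = crd N (slice z V j).
  apply: islex_exists; last exact: bounded_Tbox.
  by apply: crd_le => m /(slice_sub VT) /andP[].
have [L hL] := choice ex.
exists (fun M : 'X_{1..n.+1} => (M z < e z)%N && L (M z) (delm z M)).
have sE j m : slice z (fun M : 'X_{1..n.+1} => (M z < e z)%N && L (M z) (delm z M)) j m = (j < e z)%N && L j m.
  by rewrite /slice ins_z insK.
split=> [M|j jz|j].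
- case: (insP z M) => -[j m] /= ->; rewrite ins_z insK => /andP[jz /(hL j).1.1 h].
  by rewrite -[Tbox _ _ _ _]/(slice z (Tbox e d j0) j m) slice_Tbox jz.
- have -> : slice z (fun M : 'X_{1..n.+1} => (M z < e z)%N && L (M z) (delm z M)) j = L j.
    by apply/funext => m; rewrite sE jz.
  exact: (hL j).1.
- case: (ltnP j (e z)) => h.
    by rewrite -(hL j).2; apply: eq_crd => m; rewrite sE h.
  rewrite !crd_pred0 // => m; first by rewrite sE ltnNge h.
  by apply/negP => /(slice_sub VT); rewrite ltnNge h.
Qed.

(** Its sum over a set is the potential that bounds repeated compression. *)
Definition rank N (m : 'X_{1..n.+1}) : nat := count (fun v => (v < m)%O) (mons N).

Lemma rank_lt N (u v : 'X_{1..n.+1}) : (mdeg u < N)%N -> (u < v)%O -> (rank N u < rank N v)%N.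
Proof.
move=> uN uv; rewrite /rank.
have sub (m : 'X_{1..n.+1}) : (m < u)%O -> (m < v)%O by move=> /lt_trans; apply.
have := crd_diff N (V := fun w => (w < u)%O) (W := fun w => (w < v)%O) sub.
rewrite /crd => <-; rewrite -[X in (X < _)%N]addn0 ltn_add2l -has_count.
by apply/hasP; exists u; rewrite ?mem_mons //= uv ltxx.
Qed.

(** In each slice the lex set is the unique one of its size with the largest sum of ranks, so
    compression raises the potential unless it changes nothing. *)
Lemma wsum_sliced z N d j0 V V' : (d < N)%N ->
  (forall m, V m -> Tbox e d j0 m) -> (forall m, V' m -> Tbox e d j0 m) ->
  lex_sliced z d j0 V' -> (forall j, crd N (slice z V j) = crd N (slice z V' j)) ->
  (wsum N (rank N) V <= wsum N (rank N) V')%N /\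
  (wsum N (rank N) V = wsum N (rank N) V' -> forall m, V m = V' m).
Proof.
move=> dN VT V'T lV cV.
have bT : bounded N (Tbox e d j0) by apply: bounded_Tbox.
have bV := boundedS VT bT; have bV' := boundedS V'T bT.
rewrite !(wsum_slices z) //.
have h j : (j < e z)%N ->
    (wsum N (fun m => rank N (ins z j m)) (slice z V j) <=
      wsum N (fun m => rank N (ins z j m)) (slice z V' j))%N /\
    (wsum N (fun m => rank N (ins z j m)) (slice z V j) =
     wsum N (fun m => rank N (ins z j m)) (slice z V' j) ->
     forall m, slice z V j m = slice z V' j m).
  move=> jz.
  apply: (@wsum_islex _ N (fun m => rank N (ins z j m)) (Tbox (res_box z e) d (j0 + j))).
  - move=> u v /andP[bu /eqP du] /andP[_ /eqP dv] uv.
    case: (boolP (mdeg (ins z j u) < N)%N) => [lt|]; last by rewrite mdeg_ins; lia.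
    by apply: rank_lt => //; rewrite ltmc_ins //; lia.
  - exact: bounded_Tbox.
  - by move=> m /(slice_sub VT) /andP[].
  - exact: lV.
  - exact: cV.
have empty (U : 'X_{1..n.+1} -> bool) : (forall m, U m -> Tbox e d j0 m) ->
    forall j m, (e z <= j)%N -> slice z U j m = false.
  by move=> UT j m hj; apply/negP => /(slice_sub UT); rewrite ltnNge hj.
have hle (j : 'I_N) : (wsum N (fun m => rank N (ins z j m)) (slice z V j) <=
    wsum N (fun m => rank N (ins z j m)) (slice z V' j) ?= iff
    (wsum N (fun m => rank N (ins z j m)) (slice z V j) ==
    wsum N (fun m => rank N (ins z j m)) (slice z V' j)))%N.
  split=> //; case: (ltnP j (e z)) => hj; first by case: (h j hj).
  by rewrite /wsum !big_pred0 // => m; apply: empty.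
have := leqif_sum (fun (j : 'I_N) (_ : true) => hle j).
move=> [le eqi]; split=> // /eqP; rewrite eqi => /forallP heq M.
case: (insP z M) => -[j m] /= ->.
case: (ltnP j N) => jN; last first.
  have out U : bounded N U -> U (ins z j m) = false.
    by move=> bU; apply/negP => /bU; rewrite mdeg_ins; lia.
  by rewrite !out.
case: (ltnP j (e z)) => jz.
  by case: (h j jz) => _ /(_ (eqP (heq (Ordinal jN)))) /(_ m).
by have := empty _ VT j m jz; have := empty _ V'T j m jz; rewrite /slice => -> ->.
Qed.

(** Compressing in one variable can spoil the compression in another. Among all pairs of the same
    sizes with no smaller [fdim], one of maximal total rank is fixed by every compression; the full
    boxes bound that rank. *)
Lemma exists_compressed N d j0 V W : (d.+2 < N)%N ->
  (forall m, V m -> Tbox e d j0 m) -> (forall m, W m -> Tbox e d.+1 j0 m) ->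
  exists V' W', [/\ forall m, V' m -> Tbox e d j0 m, forall m, W' m -> Tbox e d.+1 j0 m,
      crd N V = crd N V' /\ crd N W = crd N W',
      forall i, (fdim (K s i.+1 V (fun m => Tbox e d.+1 j0 m && ~~ W m)) <=
        fdim (K s i.+1 V' (fun m => Tbox e d.+1 j0 m && ~~ W' m)))%N
    & forall z, lex_sliced z d j0 V' /\ lex_sliced z d.+1 j0 W'].
Proof.
move=> dN VT WT.
pose mu V' W' := (wsum N (rank N) V' + wsum N (rank N) W')%N.
pose good V' W' := [/\ forall m, V' m -> Tbox e d j0 m, forall m, W' m -> Tbox e d.+1 j0 m,
      crd N V = crd N V' /\ crd N W = crd N W'
    & forall i, (fdim (K s i.+1 V (fun m => Tbox e d.+1 j0 m && ~~ W m)) <=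
        fdim (K s i.+1 V' (fun m => Tbox e d.+1 j0 m && ~~ W' m)))%N].
pose P q := `[< exists V' W', good V' W' /\ mu V' W' = q >].
have exP : exists q, P q by exists (mu V W); apply/asboolP; exists V, W.
have ubP q : P q -> (q <= mu (Tbox e d j0) (Tbox e d.+1 j0))%N.
  move=> /asboolP [V' [W' [[V'T W'T _ _] <-]]].
  apply: leq_add; first by rewrite (wsum_diff _ _ V'T) leq_addr.
  by rewrite (wsum_diff _ _ W'T) leq_addr.
case: (ex_maxnP exP ubP) => q /asboolP [V' [W' [[V'T W'T [cV cW] le] muq]]] qmax.
exists V', W'; split=> // z.
have [V2 [V2T lV2 cV2]] := @exists_lex_sliced z N d j0 V' ltac:(lia) V'T.
have [W2 [W2T lW2 cW2]] := @exists_lex_sliced z N d.+1 j0 W' ltac:(lia) W'T.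
have [sV eV] := @wsum_sliced z N d j0 V' V2 ltac:(lia) V'T V2T lV2 cV2.
have [sW eW] := @wsum_sliced z N d.+1 j0 W' W2 ltac:(lia) W'T W2T lW2 cW2.
have bT : bounded N (Tbox e d j0) by apply: bounded_Tbox; lia.
have bT1 : bounded N (Tbox e d.+1 j0) by apply: bounded_Tbox; lia.
have : (mu V2 W2 <= q)%N.
  apply: qmax; apply/asboolP; exists V2, W2; split=> //; split=> //.
    split; [rewrite cV|rewrite cW].
      by rewrite (crd_slices z (boundedS V'T bT)) (crd_slices z (boundedS V2T bT)); apply: eq_bigr.
    by rewrite (crd_slices z (boundedS W'T bT1)) (crd_slices z (boundedS W2T bT1)); apply: eq_bigr.
  by move=> i; apply: leq_trans (le i) _; apply: (@fdim_K_sliced_le z N).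
rewrite -muq /mu => h.
have -> : V' = V2 by apply/funext => m; apply: eV; lia.
by have -> : W' = W2 by apply/funext => m; apply: eW; lia.
Qed.

End Compression.

(** * Compressed sets in at least three variables *)

Section CompressedSets.
Context {n : nat}.
Hypothesis n_gt0 : (0 < n)%N.
Variable e : 'I_n.+2 -> nat.
Hypothesis em : monotone_box e.
Implicit Types (u v w : 'X_{1..n.+2}) (V L : 'X_{1..n.+2} -> bool).

Let last : 'I_n.+2 := ord_max.
Let one : 'I_n.+2 := lift ord0 ord0.
Let last0 : last != ord0. Proof. by []. Qed.
Let last1 : last != one.
Proof. by rewrite -(inj_eq val_inj) /= /bump /=; move: n_gt0; case: n. Qed.

Definition compressed d j0 V : Prop := forall z, lex_sliced e z d j0 V.

(** Monomials with the same exponent of z lie in the same slice, and inserting that exponent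
    preserves the order. *)
Lemma mem_of_common_exponent d j0 V u v z : lex_sliced e z d j0 V ->
  Tbox e d j0 v -> V v -> Tbox e d j0 u -> (v <= u)%O -> v z = u z -> V u.
Proof.
move=> lV Tv Vv Tu; rewrite le_eqVlt => /orP[/eqP <- //|vu] vz.
case: (insP z v) (insP z u) vz Tv Vv Tu vu => -[j v'] /= -> [[j' u'] /= ->].
rewrite !ins_z => <- Tv Vv Tu vu.
have := slice_Tbox z e d j0 j v'; rewrite /slice Tv => /esym /andP[jz Tv'].
have := slice_Tbox z e d j0 j u'; rewrite /slice Tu => /esym /andP[_ Tu'].
apply: ((lV j jz).2 v' u') => //.
rewrite -(ltmc_ins z j) //.
by move: Tv' Tu' => /andP[_ /eqP h1] /andP[_ /eqP h2]; lia.
Qed.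

Lemma exponents_le_mdeg v : (v ord0 + v one + v last <= mdeg v)%N.
Proof.
rewrite mdegE (bigD1 ord0) //= (bigD1 one) //= (bigD1 last) /=; last by rewrite ?last0 last1.
by rewrite !addnA leq_addr.
Qed.

Lemma exponents2_le_mdeg v : (v ord0 + v last <= mdeg v)%N.
Proof. by have := exponents_le_mdeg v; lia. Qed.

Lemma ltmc_first v u (i : 'I_n.+2) : mdeg v = mdeg u -> (forall j : 'I_n.+2, (j < i)%N -> v j = u j) ->
  (v i < u i)%N -> (v < u)%O.
Proof. by move=> dvu h lt; apply/(ltmcP dvu); exists i. Qed.

(** Moving one unit from a middle variable to the last one lowers a monomial; the hypothesis says
    that the middle variables hold at least [t] units. *)
Lemma push_last t u : (t + u ord0 + u last <= mdeg u)%N ->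
  exists w, [/\ w ord0 = u ord0, w last = (u last + t)%N, mdeg w = mdeg u,
    forall c, c != last -> (w c <= u c)%N & (w <= u)%O].
Proof.
elim: t u => [|t IH] u ht; first by exists u; split; rewrite ?addn0.
have [c /andP[c0 cl] uc] : exists2 c, (c != ord0) && (c != last) & (0 < u c)%N.
  apply: contrapT => no; move: ht; rewrite mdegE (bigD1 ord0) //= (bigD1 last) //=.
  rewrite big1 => [|c /andP[c0 cl]]; first by lia.
  by apply/eqP; rewrite -leqn0 leqNgt; apply/negP => h; apply: no; exists c; rewrite ?c0.
pose u' := (u - U_(c) + U_(last))%MM.
have du' : mdeg u' = mdeg u.
  by rewrite mdegD -[in RHS](submUK uc) mdegD !mdeg1.
have u'E a : u' a = (u a - (c == a) + (last == a))%N by rewrite mnmDE mnmBE !mnm1E.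
have u'0 : u' ord0 = u ord0 by rewrite u'E (negPf c0) (negPf last0) subn0 addn0.
have u'l : u' last = (u last).+1 by rewrite u'E (negPf cl) eqxx subn0 addn1.
have [|w [w0 wl dw wc wu]] := IH u'; first by rewrite u'0 u'l du'; lia.
exists w; split; rewrite ?w0 ?wl ?dw ?u'l ?addnS //.
- by move=> a al; apply: leq_trans (wc a al) _; rewrite u'E [last == a]eq_sym (negPf al); lia.
- apply: le_trans wu _; apply: ltW; apply: (@ltmc_first _ _ c) => // [j jc|].
    rewrite u'E -!(inj_eq val_inj) /= (gtn_eqF jc) (@gtn_eqF j n.+1) ?subn0 ?addn0 //.
    exact: leq_trans jc (leq_ord c).
  by rewrite u'E eqxx [last == c]eq_sym (negPf cl); lia.
Qed.

(* A monomial of V smaller than a monomial u outside V is joined to u by an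
   increasing path in which consecutive monomials share an exponent, unless
   the last exponent increases. *)
Lemma compressed_last d j0 V u v : (forall m, V m -> Tbox e d j0 m) -> compressed d j0 V ->
  V v -> Tbox e d j0 u -> ~~ V u -> (v < u)%O -> (v last < u last)%N.
Proof.
move=> VT cV Vv Tu nVu vu; rewrite ltnNge; apply/negP => lvu.
move/negP: nVu; apply.
have Tv := VT _ Vv.
have share z w w' : V w -> Tbox e d j0 w' -> (w <= w')%O -> w z = w' z -> V w'.
  by move=> Vw; apply: (mem_of_common_exponent (cV z)); first exact: VT.
have duv : mdeg v = mdeg u by move: Tv Tu => /andP[_ /eqP ?] /andP[_ /eqP ?]; lia.
have bv : forall a, (v a < e a)%N by move: Tv => /andP[/inboxP].
have bu : forall a, (u a < e a)%N by move: Tu => /andP[/inboxP].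
have [i0 eqi lti] : exists2 i : 'I_n.+2, (forall j : 'I_n.+2, (j < i)%N -> v j = u j) & (v i < u i)%N.
  exact/(ltmcP duv).
have [i00|i0n] := eqVneq i0 ord0; last first.
  apply: (share ord0 v) => //; first exact: ltW.
  by apply: eqi; rewrite lt0n; apply: contraNneq i0n => h; apply/eqP/val_inj.
rewrite {i0}i00 in eqi lti.
(* The path is v <= w' <= w <= u: v and w' share the first exponent, w' and w the last, w and u the
   first. The common last exponent [l] is that of v, cut down to what fits beside the first exponent
   of u. *)
pose l := minn (v last) (mdeg u - u ord0).
have := exponents_le_mdeg v; have := exponents2_le_mdeg u => h2 h3.
have [|w [w0 wl dw wc wu]] := @push_last (l - u last) u; first by rewrite /l; lia.
have {}wl : w last = l by rewrite wl /l; lia.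
have Tw : Tbox e d j0 w.
  move: Tu => /andP[_ du]; rewrite /Tbox dw du andbT; apply/inboxP => a.
  have [->|al] := eqVneq a last; last by apply: leq_ltn_trans (wc a al) (bu a).
  by rewrite wl; apply: leq_ltn_trans (geq_minl _ _) (bv _).
apply: (share ord0 w) => //.
pose t := (v last - l)%N.
pose w' : 'X_{1..n.+2} :=
  [multinom (if c == one then v c + t else if c == last then v c - t else v c)%N | c < n.+2].
have w'0 : w' ord0 = v ord0 by rewrite mnmE.
have w'1 : w' one = (v one + t)%N by rewrite mnmE eqxx.
have w'l : w' last = l by rewrite mnmE (negPf last1) eqxx /t /l; lia.
have dw' : mdeg w' = mdeg v.
  have : (w' + U_(last) *+ t = v + U_(one) *+ t)%MM.
    apply/mnmP => c; rewrite !mnmDE !mulmnE !mnm1E mnmE.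
    have [->|c1] := eqVneq c one; first by rewrite ?eqxx ?(negPf last1) /= mul1n; lia.
    have [->|cl] := eqVneq c last; first by rewrite /= mul1n mul0n /t; lia.
    by [].
  by move/(congr1 mdeg); rewrite !mdegD !mdegMn !mdeg1; lia.
(* If t > 0, then [l] is the degree of u outside the first variable, whence v one + t <= u ord0 < e
   ord0 <= e one: monotonicity of the box lets the surplus fit into the second variable. *)
have e01 : (e ord0 <= e one)%N by apply: em.
have Tw' : Tbox e d j0 w'.
  move: Tv => /andP[_ dv]; rewrite /Tbox dw' dv andbT; apply/inboxP => a.
  have [->|a1] := eqVneq a one; last first.
    rewrite mnmE (negPf a1); case: ifP => _; last exact: bv.
    by apply: leq_ltn_trans (leq_subr _ _) (bv _).
  by rewrite w'1 /t /l; have := bv one; have := bu ord0; lia.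
have vw' : (v <= w')%O.
  have [t0|t0] := posnP t.
    rewrite le_eqVlt; apply/orP; left; apply/eqP/mnmP => c; rewrite mnmE t0.
    by case: ifP => _; rewrite ?addn0 //; case: ifP => _; rewrite ?subn0.
  apply: ltW; apply: (@ltmc_first _ _ one) => // [j j1|]; last by rewrite w'1; lia.
  rewrite mnmE -!(inj_eq val_inj) /=; move: j1; rewrite /= /bump /=.
  by case: (val j).
have Vw' : V w' by apply: (share ord0 v).
apply: (share last w') => //; last by rewrite w'l wl.
by apply: ltW; apply: (@ltmc_first _ _ ord0); rewrite ?dw ?dw' ?w0 ?w'0.
Qed.

Section Comparison.
Variables (N d j0 : nat) (V L : 'X_{1..n.+2} -> bool).
Hypotheses (dN : (d < N)%N) (VT : forall m, V m -> Tbox e d j0 m).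
Hypotheses (cV : compressed d j0 V) (lL : islex (Tbox e d j0) L).
Hypothesis cVL : crd N V = crd N L.

Let bT : bounded N (Tbox e d j0). Proof. exact: bounded_Tbox. Qed.

Let pair_last u v : L u -> ~~ V u -> V v -> ~~ L v -> (v last < u last)%N.
Proof.
move=> Lu nV Vv nL; apply: (compressed_last VT cV Vv (lL.1 _ Lu) nV).
case: (ltgtP v u) => // [uv|vu]; last by rewrite vu Lu in nL.
by rewrite (lL.2 u v) ?VT in nL.
Qed.

(** For u in [L] outside [V], equal sizes provide v in [V] outside [L]. Then v < u since [L] is lex,
    and [compressed_last] makes the last exponent of u positive. *)
Lemma islex_slice0_sub m : slice last L 0 m -> slice last V 0 m.
Proof.
rewrite /slice => Lm; apply: contraT => nV.
have [VL|/existsNP[v /existsNP[Vv /negP nL]]] := pselect (forall v, V v -> L v).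
  by rewrite (crd_eq_sub (boundedS lL.1 bT) VL cVL Lm) in nV.
by have := pair_last Lm nV Vv nL; rewrite ins_z.
Qed.

(** By the same pairing, an element of [V] outside [L] has a smaller last exponent than some u in
    the box, hence not the maximal one. *)
Lemma slice_top_sub m : slice last V (e last).-1 m -> slice last L (e last).-1 m.
Proof.
rewrite /slice => Vm; apply: contraT => nL.
have [LV|/existsNP[u /existsNP[Lu /negP nV]]] := pselect (forall u, L u -> V u).
  by rewrite (crd_eq_sub (boundedS VT bT) LV (esym cVL) Vm) in nL.
have := pair_last Lu nV Vm nL; rewrite ins_z.
by have /andP[/inboxP/(_ last) + _] := lL.1 _ Lu; lia.
Qed.

End Comparison.

End CompressedSets.

(** * The inductive step *)

Lemma lemc_lastU n (a : 'I_n.+1) : (U_(ord_max) <= U_(a) :> 'X_{1..n.+1})%O%MM.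
Proof.
have [->|am] := eqVneq a ord_max; first exact: lexx.
apply: ltW; apply/ltmcP; first by rewrite !mdeg1.
have la : (a < n)%N by have := leq_ord a; rewrite leq_eqVlt => /orP[/eqP h|//]; case/negP: am; apply/eqP/val_inj.
exists a => [j ja|]; rewrite !mnm1E -!(inj_eq val_inj) /= ?eqxx.
  by rewrite (gtn_eqF ja) (gtn_eqF (ltn_trans ja la)).
by rewrite (gtn_eqF la).
Qed.

Section SliceEstimates.
Context {k : fieldType} {n : nat}.
Variables (e : 'I_n.+1 -> nat) (s : 'I_n.+1 -> {set 'I_n.+1} -> k).
Hypothesis sS : sign_system s.
Variables (N d j0 i : nat) (V W : 'X_{1..n.+1} -> bool) (z : 'I_n.+1).
Hypotheses (dN : (d.+2 < N)%N) (VT : forall m, V m -> Tbox e d j0 m)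
  (WT : forall m, W m -> Tbox e d.+1 j0 m).

Let e' := res_box z e.
Let s' := res_sign z s.
Let sS' : sign_system s'. Proof. exact: res_sign_system. Qed.
Let t := e z.
Let bT : bounded N (Tbox e d j0). Proof. by apply: bounded_Tbox; lia. Qed.
Let bV : bounded N V. Proof. exact: boundedS VT bT. Qed.
Let bsV j : bounded N (slice z V j). Proof. exact: bounded_slice. Qed.
Let bpV j : bounded N (slice_pred z V j). Proof. by case: j => //= j; apply: bounded_slice. Qed.

(* In the three cases j = 0, 0 < j < t and j = t, this is the value of the
   j-th summand of fdim_K_slices for lex sets, and an upper bound in general. *)
Definition slice_bound j : nat :=
  ((if j == 0%N then fdim (K s' i.+1 (slice z V 0) (fun m => Tbox e' d.+1 j0 m && ~~ slice z W 0 m)) else 0)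
  + (if (0 < j)%N then 'C(n, i.+1) * crd N (slice z V j) + 'C(n, i) * crd N (slice z W j) else 0)
  + (if j == t then fdim (K s' i (slice z V t.-1)
       (fun m => Tbox e' d.+1 (j0 + t.-1) m && ~~ slice z W t.-1 m)) else 0))%N.

Let D j := dspace s' i (slice z V j) (slice_pred z V j)
  (slice z (fun m => Tbox e d.+1 j0 m && ~~ W m) j)
  (slice_pred z (fun m => Tbox e d.+1 j0 m && ~~ W m) j).

Let slice_empty (U : 'X_{1..n.+1} -> bool) d' j : (forall m, U m -> Tbox e d' j0 m) -> (t <= j)%N ->
  slice z U j = (fun=> false).
Proof.
move=> UT h; apply/funext => m; apply/negP => /(slice_sub UT) /andP[].
by rewrite ltnNge h.
Qed.

Let K_empty i' (U : 'X_{1..n} -> bool) : fdim (K s' i' (fun=> false) U) = 0%N.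
Proof.
apply/eqP; rewrite -leqn0; apply: leq_trans (fdim_K_le _ _ _ (N := N) _) _ => //.
by rewrite crd_pred0 // muln0.
Qed.

Let complt j : (j < t)%N -> slice z (fun m => Tbox e d.+1 j0 m && ~~ W m) j =
  (fun m => Tbox e' d.+1 (j0 + j) m && ~~ slice z W j m).
Proof. by move=> jt; apply/funext => m; rewrite slice_compl jt. Qed.

Let complE j : (t <= j)%N -> slice z (fun m => Tbox e d.+1 j0 m && ~~ W m) j = (fun=> false).
Proof. by apply: (@slice_empty _ d.+1) => m /andP[]. Qed.

Let bT1 j : bounded N (Tbox e' d.+1 j). Proof. by apply: bounded_Tbox; lia. Qed.

Let mid_sub j m a : slice_pred z (fun m => Tbox e d.+1 j0 m && ~~ W m) j m ->
  (0 < m a)%N -> Tbox e' d.+1 (j0 + j) (m - U_(a))%MM.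
Proof.
case: j => [//|j] /=; have h : forall m, Tbox e d.+1 j0 m && ~~ W m -> Tbox e d.+1 j0 m.
  by move=> ? /andP[].
by move=> /(slice_sub h) /andP[_ Tm] /(Tbox_sub Tm); rewrite addnS Tbox_S.
Qed.

Let predT j m : slice_pred z V j m -> Tbox e' d.+1 (j0 + j) m.
Proof. by case: j => [//|j] /= /(slice_sub VT) /andP[_]; rewrite addnS Tbox_S. Qed.

Let complT j m : slice z (fun m => Tbox e d.+1 j0 m && ~~ W m) j m ->
  Tbox e' d.+1 (j0 + j) m.
Proof.
have h : forall m, Tbox e d.+1 j0 m && ~~ W m -> Tbox e d.+1 j0 m by move=> ? /andP[].
by move=> /(slice_sub h) /andP[].
Qed.

Let midE j : (j < t)%N ->
  (fun m => Tbox e' d.+1 (j0 + j) m && ~~ slice z (fun m => Tbox e d.+1 j0 m && ~~ W m) j m) =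
  slice z W j.
Proof. by move=> jt; rewrite complt // compl_compl // => m /(slice_sub WT) /andP[]. Qed.

Let bW : bounded N W.
Proof. by apply: boundedS WT _; apply: bounded_Tbox; lia. Qed.

Hypothesis t_gt0 : (0 < t)%N.

Let predE (U : 'X_{1..n.+1} -> bool) : slice_pred z U t = slice z U t.-1.
Proof. by rewrite -{1}(prednK t_gt0). Qed.

(** For j = 0 there is no part with e_z, and for j = t only that part is left. In between, the
    second bound on [dspace] is combined with the trivial bound by all chains. *)
Lemma fdim_slice_le j : (fdim (D j) <= slice_bound j)%N.
Proof.
rewrite /slice_bound; have [j0E|jp] := posnP j.
  rewrite j0E (ltn_eqF t_gt0) /= !addn0 /D.
  apply: leq_trans (fdim_dspace_le1 s' i _ _ (@bsV _) (@bpV _)) _.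
  by rewrite /= K_empty add0n complt // addn0.
case: (ltngtP j t) => [jt|tj|jE] /=.
- rewrite addn0 add0n /D.
  apply: leq_trans (fdim_dspace_le2 sS' i _ (@bsV _) (@bT1 (j0 + j)%N) (@predT j) (@mid_sub j)) _.
  rewrite (midE jt) [X in (X <= _)%N]addnC.
  apply: leq_add; apply: fdim_K_le; first exact: (@bsV j).
  exact: bounded_slice.
- rewrite /D (slice_empty VT (ltnW tj)).
  apply: leq_trans (fdim_dspace_le1 s' i _ _ (N := N) _ _) _ => //.
  have -> : slice_pred z V j = (fun=> false) by case: (j) tj => //= j' tj; rewrite (slice_empty VT).
  by rewrite !K_empty.
- rewrite jE /D; apply: leq_trans (fdim_dspace_le1 s' i _ _ (@bsV _) (@bpV _)) _.
  rewrite (slice_empty VT (leqnn t)) K_empty addn0.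
  by apply: leq_trans (leq_addl _ _); rewrite !predE complt // prednK.
Qed.

Hypothesis mid : forall j m, slice z W j.+1 m -> slice z V j m.
Hypotheses (lV : islex (Tbox e d j0) V) (lW : islex (Tbox e d.+1 j0) W).

Hypothesis z_last : z = ord_max.

Let lex_exchange (U : 'X_{1..n.+1} -> bool) d' j m a : (forall m, U m -> Tbox e d' j0 m) ->
  islex (Tbox e d' j0) U -> slice z U j.+1 m -> Tbox e' d' (j0 + j) (m + U_(a))%MM ->
  (j < t)%N -> slice z U j (m + U_(a))%MM.
Proof.
move=> UT lU Um Tm jt.
have TE : Tbox e d' j0 (ins z j (m + U_(a))).
  by rewrite -[Tbox _ _ _ _]/(slice z (Tbox e d' j0) j _) slice_Tbox jt.
have : (ins z j.+1 m <= ins z j (m + U_(a)))%O.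
  by rewrite -ins_addz -ins_add lemc_add2r z_last lemc_lastU.
rewrite le_eqVlt => /orP[/eqP h|h]; first by rewrite /slice -h.
exact: lU.2 Um TE h.
Qed.

(** As z is the last variable, replacing a factor x_z by x_a moves a monomial up. So the box shadow
    of the slice of degree j + 1 of a lex set lies in its slice of degree j, the boundary conditions
    are void and the trivial bounds are attained; [mid] makes the second bound on [dspace] exact. *)
Lemma fdim_slice_ge j : (slice_bound j <= fdim (D j))%N.
Proof.
rewrite /slice_bound; have [j0E|jp] := posnP j.
  rewrite j0E (ltn_eqF t_gt0) /= !addn0 /D.
  apply: (leq_trans _ (fdim_dspace_ge1 s' i _ (@bsV _) (@bpV _) _)) => //.
  by rewrite complt // addn0 leq_addl.
case: (ltngtP j t) => [jt|tj|jE] /=.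
- rewrite addn0 add0n /D.
  apply: (leq_trans _ (fdim_dspace_ge2 sS' i (@bsV _) (@bpV _) (@complT j) (@mid_sub j) _)); last first.
    move=> m Tm nC; have : slice z W j m by rewrite -(midE jt) Tm.
    by case: (j) jp => //= j' _; apply: mid.
  rewrite (midE jt) [X in (_ <= X)%N]addnC eq_leq //; congr (_ + _)%N.
    rewrite (fdim_K_full (N := N)) //.
    case: (j) jp jt => //= j' _ jt m a Vm.
    apply/negP => /andP[Tm]; apply/negP; rewrite negbK.
    apply: (lex_exchange VT) => //; last exact: ltnW.
    by move: Tm; rewrite addnS Tbox_S.
  rewrite (fdim_K_full (N := N)) //; first exact: bounded_slice.
  case: (j) jp jt => //= j' _ jt m a Wm; rewrite (complt (ltnW jt)).
  apply/negP => /andP[Tm]; apply/negP; rewrite negbK.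
  by apply: (lex_exchange WT) => //; apply: ltnW.
- by rewrite (slice_empty VT (ltnW tj)) (slice_empty WT (ltnW tj)) crd_pred0 // !muln0.
- rewrite jE (slice_empty VT (leqnn t)) (slice_empty WT (leqnn t)) crd_pred0 // !muln0 !add0n /D.
  apply: (leq_trans _ (fdim_dspace_ge1 s' i _ (@bsV _) (@bpV _) _)); last by rewrite complE.
  rewrite (slice_empty VT (leqnn t)) K_empty addn0.
  by rewrite !predE complt // prednK.
Qed.

End SliceEstimates.

Lemma islex_sliced n (e : 'I_n.+1 -> nat) (z : 'I_n.+1) d j0 (L : 'X_{1..n.+1} -> bool) :
  islex (Tbox e d j0) L -> lex_sliced e z d j0 L.
Proof.
move=> [LT Ll] j jz; split=> [m /(slice_sub LT) /andP[] //|u v Lu Tv uv].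
apply: (Ll _ (ins z j v) Lu).
  by rewrite -[Tbox _ _ _ _]/(slice z (Tbox e d j0) j v) slice_Tbox jz.
rewrite ltmc_ins //; move: (slice_sub LT Lu) Tv => /andP[_ /andP[_ /eqP h1]] /andP[_ /eqP h2].
by lia.
Qed.

Section Step.
Context {k : fieldType} {n : nat}.
Hypothesis n_gt0 : (0 < n)%N.
Hypothesis Rn : lex_extremal k n.+1.

Lemma crd_sum_tail N p (z : 'I_p.+1) (V : 'X_{1..p.+1} -> bool) : bounded N V ->
  (crd N (slice z V 0) + \sum_(j < N.+1) (if (0 < j)%N then crd N (slice z V j) else 0) = crd N V)%N.
Proof.
move=> bV; rewrite big_ord_recl /= add0n (crd_slices z bV).
case: N bV => [|N] bV.
  by rewrite !big_ord0 addn0 crd_pred0 // => m; apply/negP => /bV.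
rewrite [RHS]big_ord_recl; congr (_ + _)%N.
rewrite big_ord_recr /= [X in (_ + X)%N]crd_pred0 ?addn0 // => m.
by apply/negP => /bV; rewrite mdeg_ins /bump /=; lia.
Qed.

(** Intermediate slices enter through their sizes only, so the total depends on the bottom slice,
    the top slice and the sizes of [V] and [W]. There is no top term when [e z] exceeds [N]. *)
Lemma sum_slice_bound (e : 'I_n.+2 -> nat) (s : 'I_n.+2 -> {set 'I_n.+2} -> k) N d j0 i
    (V W : 'X_{1..n.+2} -> bool) (z : 'I_n.+2) : bounded N V -> bounded N W ->
  (\sum_(j < N.+1) slice_bound e s N d j0 i V W z j =
    fdim (K (res_sign z s) i.+1 (slice z V 0)
      (fun m => Tbox (res_box z e) d.+1 j0 m && ~~ slice z W 0 m))
    + ('C(n.+1, i.+1) * (crd N V - crd N (slice z V 0)) + 'C(n.+1, i) * (crd N W - crd N (slice z W 0)))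
    + (if (e z <= N)%N then fdim (K (res_sign z s) i (slice z V (e z).-1)
       (fun m => Tbox (res_box z e) d.+1 (j0 + (e z).-1) m && ~~ slice z W (e z).-1 m)) else 0))%N.
Proof.
move=> bV bW; rewrite /slice_bound !big_split /=; congr (_ + _ + _)%N.
- by rewrite big_ord_recl /= big1 ?addn0.
- rewrite -(crd_sum_tail z bV) -(crd_sum_tail z bW) !addKn !big_distrr -big_split /=.
  by apply: eq_bigr => j _; case: ifP; rewrite ?muln0.
- rewrite -big_mkcond /=; case: leqP => h; last first.
    by rewrite big_pred0 // => j; apply/negbTE; rewrite neq_ltn (leq_ltn_trans _ h) // -ltnS.
  by rewrite (big_pred1 (Ordinal (h : (e z < N.+1)%N))).
Qed.

(** Either [M] contains the box shadow of [L], and the lex side attains the trivial bound, or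
    dividing elements of [M] by the last variable lands in [L], and the slice bounds are exact for
    the lex sets. Then only bottom and top slices are left to compare. *)
Lemma lex_extremal_step : lex_extremal k n.+2.
Proof.
move=> e s s' N0 d j0 i V0 W0 L M em sS sS' dN0 V0T W0T lL lM cV0 cW0.
(* The slice lemmas need a cut-off above d + 2, one more than is given; enlarging it changes no
   cardinality. *)
pose N := (N0 + d.+3)%N.
have bcrd (U : 'X_{1..n.+2} -> bool) : bounded N0 U -> crd N U = crd N0 U.
  by apply: crd_bounded_le; rewrite /N leq_addr.
have b00 : bounded N0 (Tbox e d j0) by apply: bounded_Tbox; lia.
have b01 : bounded N0 (Tbox e d.+1 j0) by apply: bounded_Tbox; lia.
rewrite -(bcrd V0) -?(bcrd L) in cV0; try by [apply: boundedS b00|apply: boundedS lL.1 b00].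
rewrite -(bcrd W0) -?(bcrd M) in cW0; try by [apply: boundedS b01|apply: boundedS lM.1 b01].
have dN : (d.+2 < N)%N by rewrite /N; lia.
have b0 : bounded N (Tbox e d j0) by apply: bounded_Tbox; lia.
have b1 : bounded N (Tbox e d.+1 j0) by apply: bounded_Tbox; lia.
have bL := boundedS lL.1 b0; have bM := boundedS lM.1 b1.
case: i => [|i].
  rewrite !K_0 (fdim_supp_chain 0 (boundedS V0T b0)) (fdim_supp_chain 0 bL).
  by rewrite cV0.
have [V [W [VT WT [cV cW] le cz]]] := exists_compressed Rn em sS dN V0T W0T.
apply: leq_trans (le i) _; rewrite {le}.
have {cV0} cV : crd N V = crd N L by rewrite -cV.
have {cW0} cW : crd N W = crd N M by rewrite -cW.
have cV' : compressed e d j0 V by move=> z; case: (cz z).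
have cW' : compressed e d.+1 j0 W by move=> z; case: (cz z).
have bV := boundedS VT b0; have bW := boundedS WT b1.
have [full|] := pselect (forall m a, L m -> Tbox e d.+1 j0 (m + U_(a))%MM -> M (m + U_(a))%MM).
  rewrite (@fdim_K_full k n.+2 N s' i.+1 L) // -?cV; first exact: fdim_K_le.
  by move=> m a Lm; apply/negP => /andP[/(full _ _ Lm) ->].
move=> /existsNP[x /existsNP[a /not_implyP[Lx /not_implyP[Txa /negP nMxa]]]].
pose z : 'I_n.+2 := ord_max.
have tp : (0 < e z)%N.
  by have /andP[/inboxP/(_ z) h _] := lL.1 _ Lx; apply: leq_ltn_trans h.
(* Every element of [M] exceeds x x_a, which is in the box but not in [M]. As x_z is the smallest
   variable, the quotient of such an element by x_z cannot be smaller than [x], so it is in [L]. *)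
have mid j m : slice z M j.+1 m -> slice z L j m.
  rewrite /slice => Mm; have Tm := lM.1 _ Mm.
  have lt : ((x + U_(a))%MM < ins z j.+1 m)%O.
    case: (ltgtP (x + U_(a))%MM (ins z j.+1 m)) => // [h|h]; last by rewrite h Mm in nMxa.
    by rewrite (lM.2 _ _ Mm Txa h) in nMxa.
  have Tm' : Tbox e d j0 (ins z j m).
    by rewrite -ins_subz; apply: Tbox_sub => //; rewrite ins_z.
  case: (ltgtP (ins z j m) x) => [h|h|-> //]; last exact: lL.2 Lx Tm' h.
  have := lt; rewrite -ins_addz ltNge; case/negP; apply: ltW.
  by apply: ltmc_le_add => //; apply: lemc_lastU.
rewrite (fdim_K_slices z sS i _ bV) (fdim_K_slices z sS' i _ bL).
apply: (@leq_trans (\sum_(j < N.+1) slice_bound e s N d j0 i V W z j)%N).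
  by apply: leq_sum => j _; apply: fdim_slice_le.
apply: (@leq_trans (\sum_(j < N.+1) slice_bound e s' N d j0 i L M z j)%N); last first.
  by apply: leq_sum => j _; apply: fdim_slice_ge => //; [exact: lL.1|exact: lM.1].
rewrite !sum_slice_bound // -cV -cW.
have c0 : forall m, slice z L 0 m -> slice z V 0 m :=
  @islex_slice0_sub _ n_gt0 e em N d j0 V L ltac:(lia) VT cV' lL cV.
have c0' : forall m, slice z M 0 m -> slice z W 0 m :=
  @islex_slice0_sub _ n_gt0 e em N d.+1 j0 W M ltac:(lia) WT cW' lM cW.
have ct : forall m, slice z V (e z).-1 m -> slice z L (e z).-1 m :=
  @slice_top_sub _ n_gt0 e em N d j0 V L ltac:(lia) VT cV' lL cV.
have ct' : forall m, slice z W (e z).-1 m -> slice z M (e z).-1 m :=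
  @slice_top_sub _ n_gt0 e em N d.+1 j0 W M ltac:(lia) WT cW' lM cW.
have lL0 := islex_sliced lL tp; have lM0 := islex_sliced lM tp.
rewrite addn0 in lL0 lM0.
have tt : ((e z).-1 < e z)%N by rewrite prednK.
have lLt := islex_sliced lL tt; have lMt := islex_sliced lM tt.
pose e' := res_box z e; pose T := Tbox e' d.+1 j0.
have bs (U : 'X_{1..n.+2} -> bool) j : bounded N U -> bounded N (slice z U j).
  exact: bounded_slice.
have bT : bounded N T by apply: bounded_Tbox; lia.
have WT0 m : slice z W 0 m -> T m by move=> /(slice_sub WT) /andP[_]; rewrite addn0.
have em' : monotone_box e' := res_box_mono z em.
(* The induction hypothesis for identical sets, used only to exchange the signs. *)
have r0 : (fdim (K (res_sign z s) i.+1 (slice z L 0) (fun m => T m && ~~ slice z M 0 m)) <=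
    fdim (K (res_sign z s') i.+1 (slice z L 0) (fun m => T m && ~~ slice z M 0 m)))%N.
  apply: (@Rn _ _ _ N d j0 _ _ _ _ _ em') => //; try exact: res_sign_system; try lia.
    exact: lL0.1.
  exact: lM0.1.
have bTM : bounded N (fun m => T m && ~~ slice z M 0 m) by apply: boundedS bT => m /andP[].
have TWM m : T m && ~~ slice z W 0 m -> T m && ~~ slice z M 0 m.
  by move=> /andP[-> nW]; apply: contra nW; apply: c0'.
(* Passing to the smaller bottom slices of [L] and [M] loses at most binomial multiples of the
   differences in size; the middle terms regain this because the total sizes agree. *)
have sh := fdim_K_shrink (res_sign z s) i (bs _ 0%N bV) bTM c0 TWM.
have tle : ((if (e z <= N)%N then fdim (K (res_sign z s) i (slice z V (e z).-1)
      (fun m => Tbox (res_box z e) d.+1 (j0 + (e z).-1) m && ~~ slice z W (e z).-1 m)) else 0) <=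
    (if (e z <= N)%N then fdim (K (res_sign z s') i (slice z L (e z).-1)
      (fun m => Tbox (res_box z e) d.+1 (j0 + (e z).-1) m && ~~ slice z M (e z).-1 m)) else 0))%N.
  case: ifP => // _.
  apply: (@leq_trans (fdim (K (res_sign z s) i (slice z L (e z).-1)
      (fun m => Tbox (res_box z e) d.+1 (j0 + (e z).-1) m && ~~ slice z M (e z).-1 m)))).
    apply: (fdim_K_mono _ _ (bs _ _ bL) ct) => m /andP[-> nM].
    by apply: contra nM; apply: ct'.
  apply: (@Rn _ _ _ N d (j0 + (e z).-1)%N _ _ _ _ _ em') => //; try exact: res_sign_system; try lia.
    exact: lLt.1.
  exact: lMt.1.
have TW := crd_diff N WT0; have TM := crd_diff N lM0.1.
have slice_le (U : 'X_{1..n.+2} -> bool) : bounded N U -> (crd N (slice z U 0) <= crd N U)%N.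
  by move=> bU; rewrite -(crd_sum_tail z bU) leq_addr.
have Vs := slice_le _ bV; have W0' := slice_le _ bW.
have L0 := slice_le _ bL; have M0 := slice_le _ bM.
rewrite -cV in L0; rewrite -cW in M0.
have bD : ('C(n.+1, i) * crd N (fun m => T m && ~~ slice z W 0 m) + 'C(n.+1, i) * crd N (slice z W 0) =
    'C(n.+1, i) * crd N (fun m => T m && ~~ slice z M 0 m) + 'C(n.+1, i) * crd N (slice z M 0))%N.
  by rewrite -!mulnDr addnC TW addnC -TM addnC.
have mulB p x1 y : (y <= x1)%N -> (p * (x1 - y) + p * y = p * x1)%N.
  by move=> xy; rewrite -mulnDr subnK.
have h1 := mulB 'C(n.+1, i.+1) _ _ Vs; have h2 := mulB 'C(n.+1, i) _ _ W0'.
have h3 := mulB 'C(n.+1, i.+1) _ _ L0; have h4 := mulB 'C(n.+1, i) _ _ M0.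
by move: sh r0 tle bD h1 h2 h3 h4; rewrite -/e' -/T; lia.
Qed.

End Step.

(** * At most two variables *)

Section SmallDegrees.
Context {k : fieldType} {n : nat}.
Variable s : 'I_n -> {set 'I_n} -> k.
Hypothesis sS : sign_system s.
Implicit Types (V U W : 'X_{1..n} -> bool) (m : 'X_{1..n}).

Definition shadow V m : bool := [exists a : 'I_n, (0 < m a)%N && V (m - U_(a))%MM].

Lemma shadowP V m : reflect (exists2 a, (0 < m a)%N & V (m - U_(a))%MM) (shadow V m).
Proof. by apply: (iffP existsP) => [[a /andP[? ?]]|[a ? ?]]; exists a => //; apply/andP. Qed.

Lemma mem_shadow V m a : V m -> shadow V (m + U_(a))%MM.
Proof.
by move=> Vm; apply/shadowP; exists a; rewrite ?addmK // mnmDE mnm1E eqxx addn1.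
Qed.

Let bL := bd_linear s.

(** For i = 1 only the monomials of [U] in the shadow of [V] impose conditions, at most one each. *)
Lemma fdim_K1_ge N V U : bounded N V -> bounded N U ->
  (n * crd N V <= crd N (fun m => U m && shadow V m) + fdim (K s 1 V U))%N.
Proof.
move=> bV bU; pose Q m := U m && shadow V m.
have bQ : bounded N Q by apply: boundedS bU => m /andP[].
have e1 : (n * crd N V)%N = fdim (supp_chain (k := k) 1 V).
  by rewrite (fdim_supp_chain 1 bV) bin1.
have e0 : crd N Q = fdim (supp_chain (k := k) 0 Q).
  by rewrite (fdim_supp_chain 0 bQ) bin0 mul1n.
rewrite e0 e1.
apply: (fdim_add_le (f := fun u => rest (fun x => Q x.2) (bd s u)) (g := id)) => //.
- by move=> c u v; rewrite bL rest_linear.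
- exact: subspace_supp_chain.
- exact: subspace_supp_chain.
- exact: spanned_supp_chain bQ.
- exact: subspace_K.
- exact: spanned_K bV.
- move=> u hu [B m] /= h; rewrite /rest /=; case: ifP => // Qm.
  by apply: (bd_supp s hu); rewrite Qm andbT in h.
- move=> u hu r0; split=> // B m Um.
  case: (boolP (Q m)) => Qm.
    by have := congr1 (fun v : chain => v (B, m)) r0; rewrite /rest /= Qm.
  rewrite /bd big1 // => a /= /andP[_ ma]; rewrite hu ?mulr0 //=.
  rewrite negb_and; apply/orP; right; apply: contra Qm => Vm.
  by rewrite /Q Um; apply/shadowP; exists a.
Qed.

(** These conditions are independent: [pk] chooses for each monomial of the shadow one variable with
    quotient in [V], which yields chains with any prescribed boundary on these monomials. With
    [fdim_K1_ge] the dimension is known exactly. *)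
Lemma fdim_K1_le N V U : bounded N V -> bounded N U ->
  (crd N (fun m => U m && shadow V m) + fdim (K s 1 V U) <= n * crd N V)%N.
Proof.
move=> bV bU; pose Q m := U m && shadow V m.
have bQ : bounded N Q by apply: boundedS bU => m /andP[].
have e1 : (n * crd N V)%N = fdim (supp_chain (k := k) 1 V).
  by rewrite (fdim_supp_chain 1 bV) bin1.
have e0 : crd N Q = fdim (supp_chain (k := k) 0 Q).
  by rewrite (fdim_supp_chain 0 bQ) bin0 mul1n.
rewrite e0 e1.
pose pk m : option 'I_n := [pick a | (0 < m a)%N && V (m - U_(a))%MM].
pose g (w : @chain k n) : @chain k n := fun x =>
  \sum_(a | (x.1 == [set a]%SET) && (Q (x.2 + U_(a))%MM && (pk (x.2 + U_(a))%MM == Some a)))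
     (s a finset.set0)^-1 * w (finset.set0, (x.2 + U_(a))%MM).
have gL : linear g.
  move=> c u v; apply/funext => x; rewrite chain_linE /g mulr_sumr -big_split /=.
  by apply: eq_bigr => a _; rewrite chain_linE mulrDr mulrCA.
have bg w m : Q m -> bd s (g w) (finset.set0, m) = w (finset.set0, m).
  move=> Qm; rewrite /bd /=.
  have [a pa] : exists a, pk m = Some a.
    rewrite /pk; case: pickP => [a _|no]; first by exists a.
    by move: Qm => /andP[_ /shadowP[a ma Va]]; have := no a; rewrite ma Va.
  have /andP[ma Va] : (0 < m a)%N && V (m - U_(a))%MM.
    by move: pa; rewrite /pk; case: pickP => // b hb [<-].
  have gE b : (0 < m b)%N -> g w ((b |: finset.set0)%SET, (m - U_(b))%MM) =
      if b == a then (s a finset.set0)^-1 * w (finset.set0, m) else 0.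
    move=> mb; rewrite finset.setU0 /g /=.
    rewrite (eq_bigl (fun c => (c == b) && (b == a))) => [|c]; last first.
      rewrite (inj_eq set1_inj) [b == c]eq_sym; case: (eqVneq c b) => [->|//] /=.
      rewrite submUK // Qm pa /=.
      by apply/eqP/eqP => [[]|->].
    have [ba|_] := eqVneq b a; last by rewrite big_pred0 // => c; rewrite andbF.
    subst b.
    by rewrite (big_pred1 a) => [|c]; rewrite ?andbT // submUK.
  rewrite (bigD1 a) /=; last by rewrite inE ma.
  rewrite gE // eqxx mulrA divff ?mul1r; last by case: sS.
  by rewrite big1 ?addr0 // => b /andP[/andP[_ mb] ba]; rewrite gE // (negPf ba) mulr0.
rewrite addnC.
apply: (@fdim_add_ge _ _ _ _ id g) => //.
- exact: subspace_supp_chain.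
- exact: spanned_supp_chain bV.
- exact: subspace_K.
- exact: subspace_supp_chain.
- by move=> w [].
- move=> w hw [B m] /= h; rewrite /g big1 // => a /= /andP[/eqP Ba /andP[_ /eqP pa]].
  case/negP: h; rewrite Ba cards1 eqxx /=.
  by move: pa; rewrite /pk; case: pickP => // b /andP[_ Vb] [eb]; rewrite eb addmK in Vb.
- move=> u w [hu bu] hw e.
  suff w0 : w = 0 by split=> //; move: e; rewrite w0 (linear_0 gL) addr0.
  apply/funext => -[B m]; rewrite chain0E.
  case: (boolP (Q m)) => Qm; last by apply: hw; rewrite /= (negPf Qm) andbF.
  have [B0|Bn] := eqVneq B finset.set0; last by apply: hw; rewrite /= cards_eq0 (negPf Bn).
  rewrite B0 -bg //; have := congr1 (fun v => bd s v (finset.set0, m)) e.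
  rewrite (linear_D bL) (linear_0 bL) chainDE chain0E bu ?add0r //.
  by case/andP: Qm.
Qed.

(** The boundary coefficient at the complement of [a] receives a single term, so every condition
    kills one coefficient. *)
Lemma K_top V U : K s n V U = supp_chain n (fun m => V m && [forall a, ~~ U (m + U_(a))%MM]).
Proof.
apply/seteqP; split=> u; last first.
  move=> hu; split=> [[B m] /= h|B m Um].
    by apply: hu; apply: contra h => /= /andP[-> /andP[-> _]].
  rewrite /bd big1 // => a /= /andP[_ ma]; rewrite hu ?mulr0 //=.
  apply/negP => /andP[_ /andP[_ /forallP/(_ a)]].
  by rewrite submUK // Um.
move=> [hu bu] [A m] /= h.
case: (boolP ((#|A| == n) && V m)) => [/andP[cA Vm]|]; last exact: (hu (A, m)).
move: h; rewrite cA Vm /= negb_forall => /existsP[a]; rewrite negbK => Ua.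
have AT : A = [set: 'I_n]%SET.
  by apply/eqP; rewrite eqEcard finset.subsetT cardsT card_ord (eqP cA) leqnn.
have := bu [set~ a]%SET _ Ua; rewrite /bd (big_pred1 a) => [|b] /=.
  rewrite addmK finset.setUCr AT => /eqP; rewrite mulf_eq0; case: sS => s0 _.
  by rewrite (negPf (s0 _ _)) => /eqP.
rewrite !inE negbK mnmDE mnm1E; case: (eqVneq b a) => [->|//] /=.
by rewrite addn1.
Qed.

End SmallDegrees.

Section TwoVariables.
Variables (D a b : nat).
Hypothesis ab : (a <= b)%N.
Implicit Types (V L : nat -> bool) (p : nat).

(** The exponent p stands for x^p y^(D - p). [T0] and [T1] are the boxes bounded by [a] in x and [b]
    in y, in degrees D and D + 1, and [sh] is the shadow in the box. *)
Let T0 p := [&& (p < a)%N, (p <= D)%N & (D < b + p)%N].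
Let T1 p := [&& (p < a)%N, (p <= D.+1)%N & (D.+1 < b + p)%N].
Let sh V p := T1 p && (V p || (0 < p)%N && V p.-1).
Let cnt V := count V (iota 0 D.+2).

Let cnt_add V g : ~~ V g -> (g < D.+2)%N -> cnt (fun p => V p || (p == g)) = (cnt V).+1.
Proof.
move=> Vg gD; transitivity (count (predU V (pred1 g)) (iota 0 D.+2)); first by [].
have := count_predUI V (pred1 g) (iota 0 D.+2).
rewrite [count (predI _ _) _](_ : _ = 0%N) ?addn0; last first.
  apply/eqP; rewrite -leqn0 leqNgt -has_count; apply/hasPn => p _ /=.
  by apply/negP => /andP[Vp /eqP pg]; rewrite -pg Vp in Vg.
by move=> ->; rewrite [count (pred1 g) _](count_uniq_mem _ (iota_uniq _ _)) mem_iota gD addn1.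
Qed.

Let cnt_sub V L : (forall p, (p < D.+2)%N -> V p -> L p) -> (cnt V <= cnt L)%N.
Proof.
move=> VL; rewrite /cnt -!size_filter; apply: uniq_leq_size; first by rewrite filter_uniq ?iota_uniq.
by move=> p; rewrite !mem_filter mem_iota => /andP[Vp /andP[_ h]]; rewrite VL // mem_iota.
Qed.

Lemma two_var_shadow_lex L : (forall p, L p -> T0 p) ->
  (forall p q, L p -> T0 q -> (p < q)%N -> L q) ->
  forall p q, sh L p -> T1 q -> (p < q)%N -> sh L q.
Proof.
move=> LT Ll p q /andP[Tp h] Tq pq; rewrite /sh Tq /=.
case/orP: h => [Lp|/andP[p0 Lp]].
  have [qD|qD] := leqP q D.
    by rewrite (Ll p) //; move: Tq; rewrite /T0 /T1; lia.
  have -> : q = D.+1 by move: Tq; rewrite /T1; lia.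
  apply/orP; right; have [pD|pD] := eqVneq p D; first by rewrite /= -pD.
  apply: (Ll p) => //; move: (LT _ Lp) Tp Tq pD; rewrite /T0 /T1; lia.
apply/orP; right; apply/andP; split; first by lia.
by apply: (Ll _ _ Lp); move: Tq; rewrite /T0 /T1; lia.
Qed.

(** If a <= D + 1, the shadow of a lex set has no new exponent p, while that of any set but the full
    box has at least as many exponents as the set. If a > D + 1, the box does not bind: a lex set
    gains at most one exponent and every nonempty set gains one. *)
Lemma two_var_shadow V L : (forall p, V p -> T0 p) -> (forall p, L p -> T0 p) ->
  (forall p q, L p -> T0 q -> (p < q)%N -> L q) -> cnt V = cnt L ->
  (cnt (sh L) <= cnt (sh V))%N.
Proof.
move=> VT LT Ll e; have [aD|Da] := leqP a D.+1.
  have shL p : sh L p -> L p.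
    move=> /andP[Tp /orP[//|/andP[p0 Lp]]]; apply: (Ll p.-1) => //; last by lia.
    by move: Tp; rewrite /T1 /T0; lia.
  have [[p0 /andP[Vp0 nT]]|no] := pselect (exists p, V p && ~~ T1 p); last first.
    apply: (@leq_trans (cnt L)); first by apply: cnt_sub => p _; apply: shL.
    rewrite -e; apply: cnt_sub => p _ Vp; rewrite /sh Vp andbT.
    by apply: contraT => nT; case: no; exists p; rewrite Vp.
  have p0E : D.+1 = (b + p0)%N by move: (VT _ Vp0) nT; rewrite /T0 /T1; lia.
  have [[q /andP[Tq nVq]]|TV] := pselect (exists q, T0 q && ~~ V q); last first.
    apply: cnt_sub => p _ /andP[Tp h]; rewrite /sh Tp /=.
    have LV r : L r -> V r.
      by move=> /LT Tr; apply: contraT => nV; case: TV; exists r; rewrite Tr.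
    by case/orP: h => [/LV -> //|/andP[-> /LV ->]]; rewrite orbT.
  have pq : (p0 < q)%N.
    have : p0 != q by apply: contraNneq nVq => <-.
    by move: Tq; rewrite /T0; lia.
  (* The only exponent that multiplication by y pushes out of the box is p0, the least in [T0]. It
     is compensated by the first gap g above it, reached from g - 1 through multiplication by x. *)
  have [g /andP[pg nVg] gmin] :=
    ex_minnP (ex_intro (fun q => (p0 < q)%N && ~~ V q) q (introT andP (conj pq nVq))).
  have gq : (g <= q)%N by apply: gmin; rewrite pq.
  have Vg1 : V g.-1.
    apply: contraT => nV1; have := gmin g.-1; rewrite nV1 andbT => h.
    have [p1|p1] := eqVneq p0 g.-1; first by rewrite -p1 Vp0 in nV1.
    by have := h ltac:(lia); lia.
  apply: (@leq_trans (cnt L)); first by apply: cnt_sub => p _; apply: shL.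
  rewrite -e.
  have -> : cnt V = cnt (fun p => (V p && (p != p0)) || (p == g)).
    rewrite (cnt_add (V := fun p => V p && (p != p0))) ?(negPf nVg) //; last by move: Tq; rewrite /T0; lia.
    rewrite -(cnt_add (V := fun p => V p && (p != p0)) (g := p0)) ?eqxx ?andbF //; last by lia.
    by apply: eq_count => p /=; have [->|] := eqVneq p p0; rewrite ?Vp0 ?orbT ?andbT ?orbF.
  apply: cnt_sub => p _ /orP[/andP[Vp pp0]|/eqP ->].
    rewrite /sh Vp andbT; move: (VT _ Vp) pp0; rewrite /T0 /T1; lia.
  rewrite /sh Vg1 andbT; apply/andP; split; last by lia.
  by move: Tq; rewrite /T0 /T1; lia.
have [c0|] := posnP (cnt V).
  have L0 p : (p < D.+2)%N -> L p = false.
    move=> pD; apply/negP => Lp; have : has L (iota 0 D.+2) by apply/hasP; exists p; rewrite ?mem_iota.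
    by rewrite has_count -/(cnt L) -e c0.
  by apply: cnt_sub => p pD /andP[_]; rewrite !L0 ?andbF //; lia.
rewrite -has_count => /hasP[p1 _ Vp1].
have [g Vg gmax] := ex_maxnP (ex_intro V p1 Vp1) (fun p (Vp : V p) => (andP (andP (VT p Vp)).2).1 : (p <= D)%N).
have gD : (g <= D)%N by have /and3P[] := VT _ Vg.
apply: (@leq_trans (cnt V).+1).
  rewrite e -(@cnt_add L D.+1) ?ltnSn //; last by apply/negP => /LT; rewrite /T0; lia.
  apply: cnt_sub => p pD /andP[Tp /orP[->//|/andP[p0 Lp]]].
  have [->|pD'] := eqVneq p D.+1; first by rewrite orbT.
  by rewrite (Ll p.-1) //; move: Tp pD' (LT _ Lp); rewrite /T0 /T1; lia.
rewrite -(@cnt_add V g.+1) //; last by apply/negP => /gmax; rewrite ltnn.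
apply: cnt_sub => p pD /orP[Vp|/eqP ->].
  by rewrite /sh Vp andbT; move: (VT _ Vp); rewrite /T0 /T1; lia.
by rewrite /sh /= Vg orbT andbT; move: Da gD; rewrite /T1; lia.
Qed.

End TwoVariables.

Section TwoVariableMonomials.
Implicit Types (V L : 'X_{1..2} -> bool) (m : 'X_{1..2}).

Let x : 'I_2 := ord0.
Let y : 'I_2 := ord_max.

Let ord2 (a : 'I_2) : a = x \/ a = y.
Proof. by case: a => -[|[|//]] h; [left|right]; apply: val_inj. Qed.

Definition mono2 D p : 'X_{1..2} := [multinom (if a == ord0 then p else D - p)%N | a < 2].

Let mono2x D p : mono2 D p x = p. Proof. by rewrite mnmE. Qed.
Let mono2y D p : mono2 D p y = (D - p)%N. Proof. by rewrite mnmE. Qed.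

Let mdeg2 m : mdeg m = (m x + m y)%N.
Proof.
by rewrite mdegE big_ord_recl big_ord1; congr (_ + m _)%N; apply: val_inj.
Qed.

Lemma mono2E D m : mdeg m = D -> m = mono2 D (m x).
Proof.
by rewrite mdeg2 => dm; apply/mnmP => a; case: (ord2 a) => ->; rewrite ?mono2x ?mono2y; lia.
Qed.

Lemma mdeg_mono2 D p : (p <= D)%N -> mdeg (mono2 D p) = D.
Proof. by rewrite mdeg2 mono2x mono2y; lia. Qed.

Lemma ltmc_mono2 D p q : (p <= D)%N -> (q <= D)%N -> (mono2 D p < mono2 D q)%O = (p < q)%N.
Proof.
move=> pD qD; have e : mdeg (mono2 D p) = mdeg (mono2 D q) by rewrite !mdeg_mono2.
apply/(ltmcP e)/idP => [[a h lt]|lt]; last by exists x => //; rewrite !mono2x.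
case: (ord2 a) h lt => -> h; first by rewrite !mono2x.
by have := h x isT; rewrite !mono2x !mono2y => ->; rewrite ltnn.
Qed.

Lemma crd_mono2 N D V : (forall m, V m -> mdeg m = D) -> (D < N)%N ->
  crd N V = count (fun p => V (mono2 D p)) (iota 0 D.+1).
Proof.
move=> VD DN; rewrite /crd -!size_filter -(size_map (mono2 D)); apply: perm_size.
apply: uniq_perm.
- by rewrite filter_uniq ?uniq_mons.
- rewrite map_inj_uniq ?filter_uniq ?iota_uniq // => p q h.
  by rewrite -(mono2x D p) h mono2x.
move=> m; rewrite mem_filter mem_mons; apply/andP/mapP => [[Vm _]|[p]].
  have dm := VD _ Vm; exists (m x); last exact: mono2E.
  by rewrite mem_filter -mono2E // Vm mem_iota /=; move: dm; rewrite mdeg2; lia.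
by rewrite mem_filter => /andP[Vp _] ->; rewrite (VD _ Vp).
Qed.

Variables (e : 'I_2 -> nat) (d j N : nat).
Hypotheses (em : monotone_box e) (dN : (d.+1 < N)%N).

Definition box_shadow V m : bool := Tbox e d.+1 j m && shadow V m.

Lemma bounded_box_shadow V : bounded N (box_shadow V).
Proof. by apply: boundedS (@bounded_Tbox _ e _ j _ dN) => m /andP[]. Qed.

Section Degree.
Variable D : nat.
Hypothesis Dj : (D + j = d)%N.

Let T0 p := [&& (p < e x)%N, (p <= D)%N & (D < e y + p)%N].
Let T1 p := [&& (p < e x)%N, (p <= D.+1)%N & (D.+1 < e y + p)%N].

Let Tbox_mono2 d' D' p : (D' + j = d')%N -> (p <= D')%N ->
  Tbox e d' j (mono2 D' p) = [&& (p < e x)%N, (p <= D')%N & (D' < e y + p)%N].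
Proof.
move=> Dj' pD; rewrite /Tbox mdeg_mono2 // Dj' eqxx andbT pD /=.
apply/inboxP/andP => [h|[h1 h2] a].
  by have := h x; have := h y; rewrite mono2x mono2y; lia.
by case: (ord2 a) => ->; rewrite ?mono2x ?mono2y; lia.
Qed.

Let sub_x p : (0 < p <= D.+1)%N -> (mono2 D.+1 p - U_(x))%MM = mono2 D p.-1.
Proof.
move=> h; apply/mnmP => a; rewrite mnmBE mnm1E.
by case: (ord2 a) => ->; rewrite ?mono2x ?mono2y /=; lia.
Qed.

Let sub_y p : (p <= D)%N -> (mono2 D.+1 p - U_(y))%MM = mono2 D p.
Proof.
move=> h; apply/mnmP => a; rewrite mnmBE mnm1E.
by case: (ord2 a) => ->; rewrite ?mono2x ?mono2y /=; lia.
Qed.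

Let nat_of V p := (p <= D)%N && V (mono2 D p).

Let box_shadow_mono2 V p : (forall m, V m -> Tbox e d j m) -> (p <= D.+1)%N ->
  box_shadow V (mono2 D.+1 p) =
  T1 p && (nat_of V p || (0 < p)%N && nat_of V p.-1).
Proof.
move=> VT pD.
have -> : (0 < p)%N && nat_of V p.-1 = (0 < p)%N && V (mono2 D p.-1).
  by case: (p) pD => //= p' pD; rewrite /nat_of (_ : (p' <= D)%N) //; lia.
rewrite /box_shadow (@Tbox_mono2 d.+1) //; last by lia.
congr (_ && _); apply/shadowP/orP => [[a]|].
  case: (ord2 a) => ->; rewrite ?mono2x ?mono2y => ma.
    by rewrite sub_x ?ma //= => ->; right.
  have pD' : (p <= D)%N by lia.
  by rewrite sub_y // /nat_of pD' => ->; left.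
case=> /andP[h Vp]; first by exists y; rewrite ?mono2y ?sub_y //; lia.
by exists x; rewrite ?mono2x ?sub_x //; rewrite h.
Qed.

Let nat_ofT V : (forall m, V m -> Tbox e d j m) -> forall p, nat_of V p -> T0 p.
Proof. by move=> VT p /andP[pD /VT]; rewrite (Tbox_mono2 Dj pD). Qed.

Let TD d' D' m : (D' + j = d')%N -> Tbox e d' j m -> mdeg m = D'.
Proof. by move=> Dj' /andP[_ /eqP]; lia. Qed.

Let cnt_nat_of V : (forall m, V m -> Tbox e d j m) ->
  count (nat_of V) (iota 0 D.+2) = crd N V.
Proof.
move=> VT; rewrite (@crd_mono2 _ D) => [|m /VT|]; [|exact: TD|lia].
have h : count (nat_of V) (iota D.+1 1) = 0%N by rewrite /= /nat_of ltnn.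
rewrite -[D.+2]addn1 iotaD count_cat add0n h addn0.
apply: eq_in_count => p; rewrite mem_iota /nat_of => /andP[_]; rewrite add0n ltnS => ->.
by [].
Qed.

Let cnt_shadow V : (forall m, V m -> Tbox e d j m) ->
  count (fun p => T1 p && (nat_of V p || (0 < p)%N && nat_of V p.-1)) (iota 0 D.+2) =
  crd N (box_shadow V).
Proof.
move=> VT; rewrite (@crd_mono2 _ D.+1) => [|m /andP[+ _]|]; [|apply: TD; lia|lia].
apply: eq_in_count => p; rewrite mem_iota => /andP[_ pD].
by rewrite box_shadow_mono2.
Qed.

Let exy : (e x <= e y)%N. Proof. exact: em. Qed.

Let islex_nat L : islex (Tbox e d j) L ->
  forall p q, nat_of L p -> T0 q -> (p < q)%N -> nat_of L q.
Proof.
move=> [_ Ll] p q /andP[pD Lp] Tq pq; have qD : (q <= D)%N by case/and3P: Tq.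
rewrite /nat_of qD; apply: Ll Lp _ _; last by rewrite ltmc_mono2.
by rewrite (Tbox_mono2 Dj qD).
Qed.

Lemma crd_box_shadow2_deg V L : (forall m, V m -> Tbox e d j m) -> islex (Tbox e d j) L ->
  crd N V = crd N L -> (crd N (box_shadow L) <= crd N (box_shadow V))%N.
Proof.
move=> VT lL c; have LT := lL.1.
rewrite -!cnt_shadow //; apply: (two_var_shadow exy).
- exact: nat_ofT.
- exact: nat_ofT.
- exact: islex_nat.
- by rewrite !cnt_nat_of.
Qed.

Lemma islex_box_shadow2_deg L : islex (Tbox e d j) L -> islex (Tbox e d.+1 j) (box_shadow L).
Proof.
move=> lL; have LT := lL.1; split=> [m /andP[] //|u v Lu Tv uv].
have Dj' : (D.+1 + j = d.+1)%N by lia.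
have du : mdeg u = D.+1 by apply: (TD Dj'); case/andP: Lu.
have dv : mdeg v = D.+1 by apply: (TD Dj').
have pE m : mdeg m = D.+1 -> (m x <= D.+1)%N by rewrite mdeg2; lia.
move: Lu Tv uv; rewrite (mono2E du) (mono2E dv) ltmc_mono2 ?pE //.
rewrite !(box_shadow_mono2 LT) ?pE // (@Tbox_mono2 d.+1) ?pE // => Lu Tv uv.
have {}Tv : T1 (v x) by rewrite /T1 pE.
exact: (two_var_shadow_lex exy (nat_ofT LT) (islex_nat lL) Lu Tv uv).
Qed.

End Degree.

Let empty V : (d < j)%N -> (forall m, V m -> Tbox e d j m) -> forall m, V m = false.
Proof. by move=> dj VT m; apply/negP => /VT /andP[_ /eqP]; lia. Qed.

Lemma crd_box_shadow2 V L : (forall m, V m -> Tbox e d j m) -> islex (Tbox e d j) L ->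
  crd N V = crd N L -> (crd N (box_shadow L) <= crd N (box_shadow V))%N.
Proof.
move=> VT lL c; have [jd|dj] := leqP j d.
  by apply: (@crd_box_shadow2_deg (d - j)) => //; rewrite subnK.
rewrite [X in (X <= _)%N]crd_pred0 // => m; apply/negP => /andP[_ /shadowP[a _]].
by rewrite (empty dj lL.1).
Qed.

Lemma islex_box_shadow2 L : islex (Tbox e d j) L -> islex (Tbox e d.+1 j) (box_shadow L).
Proof.
move=> lL; have [jd|dj] := leqP j d.
  by apply: (@islex_box_shadow2_deg (d - j)) => //; rewrite subnK.
split=> [m /andP[] //|u v /andP[_ /shadowP[a _]]].
by rewrite (empty dj lL.1).
Qed.

End TwoVariableMonomials.

(** For i = 1 the dimension is 2|V| minus the number of box shadow monomials outside [W]; lex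
    shadows are smallest and nested with [M]. For i = 2 it counts the elements of [V] whose box
    shadow lies in [W]. *)
Lemma lex_extremal2 (k : fieldType) : lex_extremal k 2.
Proof.
move=> e s s' N d j i V W L M em sS sS' dN VT WT lL lM cV cW.
have b0 : bounded N (Tbox e d j) by apply: bounded_Tbox; lia.
have b1 : bounded N (Tbox e d.+1 j) by apply: bounded_Tbox.
have bV := boundedS VT b0; have bL := boundedS lL.1 b0.
have bW := boundedS WT b1; have bM := boundedS lM.1 b1.
case: i => [|[|[|i]]]; last 1 first.
- by apply: leq_trans (fdim_K_le _ _ _ bV) _; rewrite bin_small.
- by rewrite !K_0 (fdim_supp_chain 0 bV) (fdim_supp_chain 0 bL) cV.
- pose U X m := Tbox e d.+1 j m && ~~ X m.
  have bU X : bounded N (U X) by apply: boundedS b1 => m /andP[].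
  have h1 := fdim_K1_le sS bV (bU W); have h2 := @fdim_K1_ge k 2 s' N L _ bL (bU M).
  rewrite -cV in h2.
  suff : (crd N (fun m => U M m && shadow L m) <= crd N (fun m => U W m && shadow V m))%N.
    by rewrite -/(U W) -/(U M); lia.
  have E X Y m : (U X m && shadow Y m) = (box_shadow e d j Y m && ~~ X m).
    by rewrite /U /box_shadow andbAC.
  rewrite (eq_crd N (E M L)) (eq_crd N (E W V)).
  have hs := crd_box_shadow2 em dN VT lL cV.
  have ls := islex_box_shadow2 em dN lL.
  have bs X := @bounded_box_shadow e d j N dN X.
  have hV : (crd N (box_shadow e d j V) <=
      crd N (fun m => box_shadow e d j V m && ~~ W m) + crd N W)%N.
    have h := @crd_diff _ N (fun m => box_shadow e d j V m && W m) (box_shadow e d j V).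
    rewrite -h => [|m /andP[] //]; rewrite addnC leq_add //.
      by apply: crd_le => m /andP[-> /=].
    by apply: crd_le => m /andP[].
  case: (islex_cmp ls lM) => h.
    by rewrite crd_pred0 // => m; apply/negP => /andP[/h ->].
  by have := crd_diff N h; move: hV; rewrite -cW; lia.
- rewrite !K_top //.
  pose G (X Y : 'X_{1..2} -> bool) m :=
    X m && [forall a, ~~ (Tbox e d.+1 j (m + U_(a))%MM && ~~ Y (m + U_(a))%MM)].
  have bG X Y : bounded N X -> bounded N (G X Y) by move=> bX; apply: boundedS bX => m /andP[].
  rewrite (fdim_supp_chain 2 (bG V W bV)) (fdim_supp_chain 2 (bG L M bL)) leq_mul2l /=.
  have GT m : G V W m -> Tbox e d j m by move=> /andP[/VT].
  have [X [lX cX]] : exists X, islex (Tbox e d j) X /\ crd N X = crd N (G V W).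
    by apply: islex_exists b0; apply: crd_le.
  have XL m : X m -> L m.
    case: (islex_cmp lX lL) => [h /h //|h].
    apply: (crd_eq_sub (boundedS lX.1 b0) h).
    apply/eqP; rewrite eqn_leq crd_le //= cX -cV; apply: crd_le => m' /andP[] //.
  rewrite -cX; apply: crd_le => m Xm; rewrite /G XL //=; apply/forallP => a.
  apply/negP => /andP[Ta]; apply/negP; rewrite negbK.
  have ls := islex_box_shadow2 em dN lX.
  have hs := crd_box_shadow2 em dN GT lX (esym cX).
  have GW : (crd N (box_shadow e d j (G V W)) <= crd N W)%N.
    apply: crd_le => u /andP[Tu /shadowP[b ub /andP[_ /forallP/(_ b)]]].
    by rewrite submUK // Tu /= negbK.
  have Sm : box_shadow e d j X (m + U_(a))%MM by rewrite /box_shadow Ta mem_shadow.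
  case: (islex_cmp ls lM) => h; first exact: h.
  apply: (crd_eq_sub (@bounded_box_shadow e d j N dN X) h) Sm.
  by apply/eqP; rewrite eqn_leq crd_le //= -cW (leq_trans hs GW).
Qed.

(** Each degree has at most one monomial, so the sets coincide; a boundary coefficient has at most
    one term, whose vanishing does not depend on the signs. *)
Lemma lex_extremal_small (k : fieldType) n : (n <= 1)%N -> lex_extremal k n.
Proof.
move=> n1 e s s' N d j i V W L M em sS sS' dN VT WT lL lM cV cW.
have ordE (a b : 'I_n) : a = b by apply: val_inj => /=; have := ltn_ord a; have := ltn_ord b; lia.
have TE d' (m m' : 'X_{1..n}) : Tbox e d' j m -> Tbox e d' j m' -> m = m'.
  move=> /andP[_ /eqP h] /andP[_ /eqP h']; apply/mnmP => a.
  have mE (u : 'X_{1..n}) : mdeg u = u a.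
    by rewrite mdegE (bigD1 a) //= big1 ?addn0 // => b; rewrite (ordE b a) eqxx.
  by rewrite -!mE; lia.
have XE d' (X Y : 'X_{1..n} -> bool) : (d' < N)%N -> (forall m, X m -> Tbox e d' j m) ->
    (forall m, Y m -> Tbox e d' j m) -> crd N X = crd N Y -> forall m, X m -> Y m.
  move=> d'N XT YT c m Xm.
  have : (0 < crd N X)%N by apply: (crd_gt0 _ Xm); apply: boundedS XT (@bounded_Tbox _ e _ j _ d'N).
  rewrite c -has_count => /hasP[m' _ Ym'].
  by rewrite (TE d' m m') //; [apply: XT|apply: YT].
have VL : V = L.
  by apply/funext => m; apply/idP/idP; [apply: (XE d)|apply: (XE d)] => //; try lia; exact: lL.1.
have WM : W = M.
  by apply/funext => m; apply/idP/idP; [apply: (XE d.+1)|apply: (XE d.+1)] => //; exact: lM.1.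
rewrite VL WM; apply: fdim_le.
- exact: subspace_K.
- apply: (spanned_K (N := N)); apply: boundedS lL.1 _; apply: bounded_Tbox; lia.
move=> u [hu bu]; split=> // B m Um; have := bu B m Um; rewrite /bd /=.
have [/existsP[a /andP[aB ma]]|no] := boolP [exists a : 'I_n, (a \notin B) && (0 < m a)%N]; last first.
  by move=> _; rewrite big1 // => a h; case/existsP: no; exists a.
have PE b : (b \notin B) && (0 < m b)%N = (b == a) by rewrite (ordE b a) aB ma eqxx.
rewrite !(big_pred1 a) // => /eqP; rewrite mulf_eq0 (negPf (sS.1 _ _)) /= => /eqP ->.
by rewrite mulr0.
Qed.

Theorem lex_extremalP (k : fieldType) n : lex_extremal k n.
Proof.
elim: n => [|[|[|n]] IH]; try exact: lex_extremal_small.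
  exact: lex_extremal2.
exact: lex_extremal_step.
Qed.

(** * Cycles with coefficients in a monomial ideal *)

Section KoszulExactness.
Context {k : fieldType} {n : nat}.
Variable s : 'I_n -> {set 'I_n} -> k.
Hypothesis sS : sign_system s.
Implicit Types (V U W : 'X_{1..n} -> bool) (m : 'X_{1..n}) (A B : {set 'I_n}).

(* The Z^n-degree of x^m e_A. *)
Definition mdegree A m : 'X_{1..n} := [multinom (m a + (a \in A))%N | a < n].

Lemma mdegree_swap (a : 'I_n) A m : a \notin A -> (0 < m a)%N ->
  mdegree (a |: A)%SET (m - U_(a))%MM = mdegree A m.
Proof.
move=> aA ma; apply/mnmP => c; rewrite !mnmE !inE.
have [->|ac] /= := eqVneq c a; last by rewrite subn0.
by rewrite (negPf aA) subn1 addn1 addn0 prednK.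
Qed.

Let pk (mu : 'X_{1..n}) : option 'I_n := [pick a | (0 < mu a)%N].

(* In each multidegree, the homotopy contracting the Koszul complex along a
   variable occurring there. *)
Definition contraction (u : @chain k n) : @chain k n := fun x =>
  if pk (mdegree x.1 x.2) is Some a then
    if a \in x.1 then (s a (x.1 :\ a)%SET)^-1 * u ((x.1 :\ a)%SET, (x.2 + U_(a))%MM) else 0
  else 0.

Lemma contraction_linear : linear contraction.
Proof.
move=> c u v; apply/funext => x; rewrite chain_linE /contraction.
case: (pk _) => [a|]; last by rewrite mulr0 addr0.
by case: ifP => _; rewrite ?mulr0 ?addr0 // chain_linE mulrDr mulrCA.
Qed.

(** The homotopy works in every multidegree in which a variable occurs; in multidegree 0 there is
    only the coefficient of 1 at the empty set, assumed to vanish. *)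
Lemma bd_contraction u : bd s u = 0 -> u (finset.set0, 0%MM) = 0 -> bd s (contraction u) = u.
Proof.
case: (sS) => s0 sC bu u0; apply/funext => -[B m]; rewrite /bd /=.
have step c : (c \notin B) && (0 < m c)%N ->
    s c B * contraction u ((c |: B)%SET, (m - U_(c))%MM) =
    if pk (mdegree B m) is Some a then
      if a \in (c |: B)%SET then s c B * ((s a ((c |: B) :\ a)%SET)^-1 *
        u (((c |: B) :\ a)%SET, (m - U_(c) + U_(a))%MM)) else 0
    else 0.
  move=> /andP[cB mc]; rewrite /contraction /= mdegree_swap //.
  by case: (pk _) => [a|]; rewrite ?mulr0 //; case: ifP; rewrite ?mulr0.
rewrite (eq_bigr _ step) {step}; rewrite /pk; case: pickP => [a|no]; last first.
  rewrite big1 //; suff [-> ->] : B = finset.set0 /\ m = 0%MM by rewrite u0.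
  split; first by apply/setP => c; have := no c; rewrite mnmE inE; case: (c \in B); rewrite ?addn1.
  by apply/mnmP => c; have := no c; rewrite mnmE mnm0E; lia.
rewrite mnmE => ha; have [aB|aB] := boolP (a \in B); last first.
  have ma : (0 < m a)%N by move: ha; rewrite (negPf aB) addn0.
  rewrite (bigD1 a) /=; last by rewrite aB ma.
  rewrite !inE eqxx setU1K // submUK // mulrA divff // mul1r.
  rewrite big1 ?addr0 // => c /andP[/andP[cB mc] ca].
  by rewrite !inE eq_sym (negPf ca) (negPf aB).
pose B0 := (B :\ a)%SET.
have aB0 : a \notin B0 by rewrite !inE eqxx.
have BE : B = (a |: B0)%SET by rewrite finset.setD1K.
(* The cycle condition at (B0, x_a m) expresses u (B, m) through the other terms, which are those of
   the contraction. *)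
have := congr1 (fun v : chain => v (B0, (m + U_(a))%MM)) bu; rewrite chain0E /bd /=.
rewrite (bigD1 a) /=; last by rewrite aB0 mnmDE mnm1E eqxx addn1.
rewrite -BE addmK => /eqP; rewrite addr_eq0 => /eqP e.
have -> : u (B, m) = (s a B0)^-1 * (s a B0 * u (B, m)) by rewrite mulrA mulVf ?mul1r.
rewrite e mulrN -mulNr big_distrr /=.
have IE c : ((c \notin B0) && (0 < (m + U_(a))%MM c)%N && (c != a)) = (c \notin B) && (0 < m c)%N.
  rewrite BE !inE mnmDE mnm1E negb_or; have [->|ca] := eqVneq c a; first by rewrite !andbF.
  by rewrite /= andbT addn0.
rewrite [RHS](eq_bigl _ _ IE); apply: eq_bigr => c /andP[cB mc].
have ca : c != a by apply: contraNneq cB => ->.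
have cB0 : c \notin B0 by rewrite !inE (negPf cB) andbF.
rewrite !inE aB orbT.
have -> : ((c |: B) :\ a = c |: B0)%SET.
  by apply/setP => b; rewrite !inE; have [->|] := eqVneq b a; rewrite ?(eq_sym a) ?(negPf ca).
have -> : (m - U_(c) + U_(a) = m + U_(a) - U_(c))%MM.
  by apply/mnmP => b; rewrite !(mnmDE, mnmBE, mnm1E); have [<-|_] := eqVneq c b; lia.
have := sC a c B0 aB0 cB0; rewrite eq_sym => /(_ ca); rewrite -BE => h.
have -> : s c B = - (s a B0)^-1 * s c B0 * s a (c |: B0)%SET.
  by rewrite -mulrA mulNr -mulrN -h mulrA mulVf ?mul1r.
by rewrite -!mulrA mulVKf.
Qed.

Lemma contraction_supp i V W u : supp_chain i V u ->
  (forall m a, V (m + U_(a))%MM -> W m) -> supp_chain i.+1 W (contraction u).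
Proof.
move=> hu VW [A m] /= h; rewrite /contraction /=; case: (pk _) => [a|//].
case: ifP => // aA; rewrite hu ?mulr0 //=; apply: contra h => /andP[/eqP cA /VW ->].
by rewrite (cardsD1 a A) aA cA andbT.
Qed.

End KoszulExactness.

Definition koszul_sign (k : fieldType) n (a : 'I_n) (B : {set 'I_n}) : k :=
  (-1) ^+ #|[set b in B | (b < a)%N]%SET|.

Lemma koszul_sign_system (k : fieldType) n : sign_system (@koszul_sign k n).
Proof.
split=> [b B|b c B bB cB bc]; first by rewrite signr_eq0.
have add (x y : 'I_n) : x \notin B ->
    koszul_sign k y (x |: B)%SET = (if (x < y)%N then -1 else 1) * koszul_sign k y B.
  move=> xB; rewrite /koszul_sign; case: ifP => xy.
    have -> : [set z in x |: B | (z < y)%N]%SET = (x |: [set z in B | (z < y)%N])%SET.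
      by apply/setP => z; rewrite !inE; case: eqP => //= ->; rewrite xy.
    by rewrite cardsU1 inE (negPf xB) exprS.
  rewrite mul1r; congr (_ ^+ _); apply: eq_card => z; rewrite !inE.
  by case: eqP => //= ->; rewrite xy andbF.
rewrite !add //; case: (ltngtP b c) => [h|h|/val_inj h].
- by rewrite mulN1r mul1r mulrN mulrC.
- by rewrite mulN1r mul1r mulrN opprK mulrC.
- by rewrite h eqxx in bc.
Qed.

Section MonomialCycles.
Context {k : fieldType} {n : nat}.
Implicit Types (s : 'I_n -> {set 'I_n} -> k) (V U J L : 'X_{1..n} -> bool) (m : 'X_{1..n}).

Definition all_mon m : bool := true.

Definition deg_part d V m : bool := V m && (mdeg m == d).

Definition up_set V : Prop := forall m a, V m -> V (m + U_(a))%MM.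

Lemma bounded_deg_part d V N : (d < N)%N -> bounded N (deg_part d V).
Proof. by move=> dN m /andP[_ /eqP ->]. Qed.

Lemma K_all s i V U : (forall m a, V m -> U (m + U_(a))%MM) -> K s i V all_mon = K s i V U.
Proof.
move=> VU; apply/seteqP; split=> u [hu bu]; split=> // B m _; first exact: bu.
case: (boolP (U m)) => [/bu //|nU].
rewrite /bd big1 // => a /= /andP[_ ma]; rewrite hu ?mulr0 //=.
apply/negP => /andP[_ /(VU _ a)]; rewrite submUK //.
exact/negP.
Qed.

(* The dimension of the module of i-cycles of the Koszul complex with
   coefficients in the ideal spanned by V. *)
Definition zdim s i V : nat := fdim (K s i V all_mon).

Let mdegU d m a : mdeg m = d -> mdeg (m + U_(a))%MM = d.+1.
Proof. by move=> <-; rewrite mdegD mdeg1 addn1. Qed.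

(** By exactness a cycle with coefficients in [J] of degree d + 1 is the boundary of a chain of
    degree [d], unique up to cycles; these chains are those whose boundary vanishes outside [J].
    This turns cycles of an ideal into spaces [K]. *)
Lemma zdim_succ s i J d : sign_system s ->
  (zdim s i (deg_part d.+1 J) + zdim s i.+1 (deg_part d all_mon) =
   fdim (K s i.+1 (deg_part d all_mon) (fun m => deg_part d.+1 all_mon m && ~~ J m)))%N.
Proof.
move=> sS; pose N := d.+2; have bL := bd_linear s.
have b0 V : bounded N (deg_part d V) by apply: bounded_deg_part; rewrite /N.
have b1 V : bounded N (deg_part d.+1 V) by apply: bounded_deg_part.
have inD m : mdeg m = d -> deg_part d all_mon m by rewrite /deg_part => ->; rewrite eqxx.
apply/eqP; rewrite eqn_leq; apply/andP; split.
  have cL := @contraction_linear k n s.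
  have cb w : K s i (deg_part d.+1 J) all_mon w -> bd s (contraction s w) = w.
    move=> [hw bw]; apply: bd_contraction => //.
      by apply/funext => -[B m]; rewrite bw.
    by apply: hw; rewrite /= /deg_part mdeg0 andbF andbF.
  apply: (fdim_add_ge cL (g := id)) => //.
  - exact: subspace_K.
  - exact: spanned_K (b0 _).
  - exact: subspace_K.
  - exact: subspace_K.
  - move=> w hw; split=> [|B m /andP[_ nJ]].
      apply: (@contraction_supp _ _ s i (deg_part d.+1 J)); first by case: hw.
      move=> m a /andP[_]; rewrite mdegD mdeg1 addn1 eqSS => /eqP; exact: inD.
    rewrite (cb _ hw); case: hw => hw _; apply: hw => /=.
    by rewrite /deg_part (negPf nJ) !andbF.
  - by move=> w [hw bw]; split=> // B m _; apply: bw.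
  - move=> w1 w2 hw1 [hw2 bw2] e.
    have := congr1 (bd s) e; rewrite (linear_D bL) (cb _ hw1) (linear_0 bL).
    have -> : bd s w2 = 0 by apply/funext => -[B m]; rewrite bw2.
    by rewrite addr0 => w10; split=> //; move: e; rewrite w10 (linear_0 cL) add0r.
apply: (fdim_add_le bL (g := id)) => //.
- exact: subspace_K.
- exact: subspace_K.
- exact: spanned_K (b1 _).
- exact: subspace_K.
- exact: spanned_K (b0 _).
- move=> u [hu bu]; split=> [[B m] /= h|B m _]; last by rewrite bd_bd.
  move: h; rewrite negb_and => /orP[h|]; first exact: (bd_supp s hu m h).
  rewrite /deg_part; case: (eqVneq (mdeg m) d.+1) => [dm h|dm _].
    by apply: bu; rewrite /deg_part dm eqxx /=; rewrite andbT in h.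
  rewrite /bd big1 // => a /= /andP[_ ma]; rewrite hu ?mulr0 //=.
  by apply/negP => /andP[_ /andP[_ /eqP h2]]; move: dm; rewrite -(mdeg_sub ma) h2 eqxx.
- by move=> u [hu _] b0u; split=> // B m _; rewrite b0u.
Qed.

Variable e : 'I_n -> nat.
Hypothesis em : monotone_box e.

(** Multiples of a monomial outside the box stay outside, hence in [J]: such monomials meet no
    condition and split off. *)
Lemma K_box s i J d : sign_system s -> (forall m, ~~ inbox e m -> J m) ->
  fdim (K s i (deg_part d all_mon) (fun m => deg_part d.+1 all_mon m && ~~ J m)) =
  ('C(n, i) * crd d.+1 (fun m => deg_part d all_mon m && ~~ inbox e m) +
   fdim (K s i (Tbox e d 0) (fun m => Tbox e d.+1 0 m && ~~ (J m && Tbox e d.+1 0 m))))%N.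
Proof.
move=> sS nJ; set X := fun m => deg_part d all_mon m && ~~ inbox e m.
have b0 V : bounded d.+1 (deg_part d V) by apply: bounded_deg_part.
have bX : bounded d.+1 X by apply: boundedS (b0 all_mon) => m /andP[].
have bT : bounded d.+1 (Tbox e d 0) by apply: bounded_Tbox.
have -> : (fun m => deg_part d.+1 all_mon m && ~~ J m) =
    (fun m => Tbox e d.+1 0 m && ~~ (J m && Tbox e d.+1 0 m)).
  apply/funext => m; rewrite /deg_part /Tbox /= addn0 andbC.
  case: (mdeg m == d.+1) => /=; last by rewrite !andbF.
  rewrite !andbT; case: (boolP (inbox e m)) => [_|/nJ ->] //=; by rewrite andbT.
set U := fun m => _ && ~~ _.
rewrite -(fdim_supp_chain (k := k) i bX).
have bL := bd_linear s.
have XU m a : X m -> ~~ U (m + U_(a))%MM.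
  move=> /andP[_ nb]; apply/negP => /andP[/andP[/(inbox_sub a) + _] _].
  by rewrite addmK; apply/negP.
apply/eqP; rewrite eqn_leq; apply/andP; split.
  apply: (fdim_add_le (rest_linear (fun x => ~~ inbox e x.2)) (g := id)) => //.
  - exact: subspace_K.
  - exact: subspace_supp_chain.
  - exact: spanned_supp_chain bX.
  - exact: subspace_K.
  - exact: spanned_K bT.
  - move=> u [hu _] [B m] /= h; rewrite /rest /=; case: ifP => // nb.
    by apply: hu; apply: contra h => /= /andP[-> hm]; rewrite /X hm nb.
  - move=> u [hu bu] r0; split=> // -[B m] /= h.
    have := congr1 (fun v : chain => v (B, m)) r0; rewrite /rest /= chain0E.
    case: ifP => // /negbFE bm _; apply: hu; apply: contra h => /= /andP[-> /andP[_ dm]].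
    by rewrite /Tbox bm addn0.
apply: (fdim_add_ge (f := id) (g := id)) => //.
- exact: subspace_K.
- exact: spanned_K (b0 _).
- exact: subspace_supp_chain.
- exact: subspace_K.
- rewrite -(K_full s i XU) => w [hw bw]; split=> // x h; apply: hw.
  by apply: contra h => /andP[-> /andP[]].
- move=> w [hw bw]; split=> // x h; apply: hw; apply: contra h => /andP[-> /andP[_]].
  by rewrite addn0 /deg_part => ->.
- move=> w1 w2 hw1 [hw2 _] ew.
  suff w20 : w2 = 0 by split=> //; move: ew; rewrite w20 addr0.
  apply/funext => -[B m]; rewrite chain0E; case: (boolP (inbox e m)) => bm.
    have := congr1 (fun v : chain => v (B, m)) ew; rewrite chainDE chain0E.
    by rewrite hw1 ?add0r //= /X bm !andbF.
  by apply: hw2; rewrite /= /Tbox (negPf bm) !andbF.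
Qed.

(** A complete or empty degree is lex in a box containing it, so extremality applies in both
    directions. *)
Lemma zdim_sign s s' i V d : sign_system s -> sign_system s' ->
  (forall m, deg_part d all_mon m -> V m) \/ (forall m, deg_part d V m = false) ->
  zdim s i (deg_part d V) = zdim s' i (deg_part d V).
Proof.
move=> sS sS' hV.
(* Large enough to contain all monomials of degree at most d + 1. *)
pose e2 (a : 'I_n) := d.+2.
have m2 : monotone_box e2 by [].
have TE d' m : (d' <= d.+1)%N -> Tbox e2 d' 0 m = (mdeg m == d').
  move=> dd; rewrite /Tbox addn0 andb_idl // => /eqP dm; apply/inboxP => a.
  have : (m a <= mdeg m)%N by rewrite mdegE (bigD1 a) //= leq_addr.
  by rewrite /e2; lia.
have VT m : deg_part d V m -> Tbox e2 d 0 m by move=> /andP[_ dm]; rewrite TE.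
have lV : islex (Tbox e2 d 0) (deg_part d V).
  split=> // u v Vu; rewrite TE // => dv _; case: hV => [h|h]; last by rewrite h in Vu.
  by rewrite /deg_part dv andbT; apply: h; rewrite /deg_part dv.
have h (t t' : 'I_n -> {set 'I_n} -> k) : sign_system t -> sign_system t' ->
    (zdim t i (deg_part d V) <= zdim t' i (deg_part d V))%N.
  move=> tS tS'; rewrite /zdim !(@K_all _ i (deg_part d V) (fun m => Tbox e2 d.+1 0 m && ~~ false)).
  - by apply: (@lex_extremalP k n e2 t t' d.+2 d 0 i) => //; exact: islex0.
  - by move=> m a /andP[_ /eqP dm]; rewrite andbT TE // (mdegU _ dm).
  - by move=> m a /andP[_ /eqP dm]; rewrite andbT TE // (mdegU _ dm).
by apply/eqP; rewrite eqn_leq !h.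
Qed.

Section Lexification.
Variables (J L : 'X_{1..n} -> bool).
Hypotheses (nJ : forall m, ~~ inbox e m -> J m) (nL : forall m, ~~ inbox e m -> L m).
Hypothesis lL : forall d, islex (Tbox e d 0) (fun m => L m && Tbox e d 0 m).
Hypothesis cJL : forall d, crd d.+1 (fun m => J m && Tbox e d 0 m) = crd d.+1 (fun m => L m && Tbox e d 0 m).

Let cN d N : (d < N)%N -> crd N (fun m => J m && Tbox e d 0 m) = crd N (fun m => L m && Tbox e d 0 m).
Proof.
have b X : bounded d.+1 (fun m => X m && Tbox e d 0 m).
  by apply: boundedS (@bounded_Tbox _ e d 0 d.+1 (leqnn _)) => m /andP[].
by move=> dN; rewrite !(crd_bounded_le dN (b _)).
Qed.

(** In degree d + 1, [zdim_succ] and [K_box] reduce to extremality with [V] the whole box in degree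
    d and [W] the part of [J] in the box. In degree 0, out of reach of [zdim_succ], [J] and [L]
    agree and are complete or empty. *)
Lemma zdim_lex_le s s' i d : sign_system s -> sign_system s' ->
  (zdim s i (deg_part d J) <= zdim s' i (deg_part d L))%N.
Proof.
move=> sS sS'; case: d => [|d]; last first.
  suff : (zdim s i (deg_part d.+1 J) + zdim s i.+1 (deg_part d all_mon) <=
          zdim s' i (deg_part d.+1 L) + zdim s i.+1 (deg_part d all_mon))%N.
    by rewrite leq_add2r.
  rewrite [in X in (_ <= X)%N](zdim_sign _ sS sS'); last by left.
  rewrite !zdim_succ // !K_box // leq_add2l.
  apply: (@lex_extremalP k n e s s' d.+2 d 0 i.+1) => //; try exact: islexT.
  by move=> m /andP[].
have E X m : deg_part 0 X m = (m == 0%MM) && X 0%MM.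
  rewrite /deg_part mdeg_eq0 andbC; by case: eqP => [->|].
have JL : J 0%MM = L 0%MM.
  case: (boolP (inbox e 0%MM)) => b0; last by rewrite nJ // nL.
  have := cJL 0; rewrite /crd.
  have mE X : count (fun m => X m && Tbox e 0 0 m) (mons 1) = X 0%MM.
    rewrite (eq_in_count (a2 := fun m => X 0%MM && (m == 0%MM))).
      have h := count_uniq_mem 0%MM (uniq_mons (n := n) 1).
      rewrite mem_mons mdeg0 /= in h.
      by case: (X 0%MM); rewrite /= ?count_pred0.
    move=> m; rewrite mem_mons ltnS leqn0 mdeg_eq0 => /eqP ->.
    by rewrite /Tbox b0 mdeg0 !eqxx.
  by rewrite !mE; case: (J _); case: (L _).
have -> : deg_part 0 J = deg_part 0 L by apply/funext => m; rewrite !E JL.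
rewrite (zdim_sign _ sS sS') //.
case: (boolP (L 0%MM)) => h; [left|right] => m; last by rewrite E (negPf h) andbF.
by rewrite E andbT => /eqP ->.
Qed.

(** Extremality for i = 1: since [J] is closed under multiplication, its space [K] is as large as
    possible, and so is that of [L]; by [fdim_K1_le] the box shadow of [L] then lies in [L]. *)
Lemma lex_up_set : up_set J -> up_set L.
Proof.
move=> uJ m a Lm; case: (boolP (inbox e (m + U_(a))%MM)) => bm; last exact: nL.
have bm0 : inbox e m by rewrite -(addmK U_(a)%MM m); apply: inbox_sub.
pose s := koszul_sign k (n := n).
pose d := mdeg m.
have Tm : Tbox e d 0 m by rewrite /Tbox bm0 addn0 eqxx.
have TmU : Tbox e d.+1 0 (m + U_(a))%MM by rewrite /Tbox bm addn0 (mdegU a (erefl _)) eqxx.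
have sS : sign_system s := koszul_sign_system k n.
pose N := d.+2.
pose Jd d m := J m && Tbox e d 0 m; pose Ld d m := L m && Tbox e d 0 m.
have bd X d' : (d' < N)%N -> bounded N (fun m => X m && Tbox e d' 0 m).
  by move=> h; apply: boundedS (@bounded_Tbox _ e d' 0 N h) => ? /andP[].
have h1 : (fdim (K s 1 (Jd d) (fun m => Tbox e d.+1 0 m && ~~ Jd d.+1 m)) <=
           fdim (K s 1 (Ld d) (fun m => Tbox e d.+1 0 m && ~~ Ld d.+1 m)))%N.
  by apply: (@lex_extremalP k n e s s N d 0 1) => //; try exact: cN; move=> ? /andP[].
rewrite (fdim_K_full (N := N)) in h1; [|exact: bd|]; last first.
  move=> u b /andP[Ju _]; apply/negP => /andP[Tu]; rewrite /Jd Tu andbT; apply/negP.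
  by rewrite negbK; apply: uJ.
have bU : bounded N (fun m => Tbox e d.+1 0 m && ~~ Ld d.+1 m).
  by apply: boundedS (@bounded_Tbox _ e d.+1 0 N (leqnn _)) => ? /andP[].
have h2 := fdim_K1_le sS (bd L d (leqW (leqnn _))) bU.
apply: contraT => nLm.
have : (0 < crd N (fun m => (Tbox e d.+1 0 m && ~~ Ld d.+1 m) && shadow (Ld d) m))%N.
  apply: (@crd_gt0 _ N _ (m + U_(a))%MM); first by apply: boundedS bU => ? /andP[].
  by rewrite TmU /Ld (negPf nLm) /= mem_shadow // Lm.
have := cN (leqW (leqnn d.+1)); rewrite -/N => e1.
by move: h1 h2; rewrite bin1 e1 -/(Ld d); lia.
Qed.

End Lexification.

End MonomialCycles.

(** * Betti numbers *)

Section QuotientDimension.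
Context {k : fieldType}.

Lemma dim_mod_fdim (V : lmodType k) (Z B : set V) : subspace Z -> subspace B -> spanned Z ->
  B `<=` Z -> (dim_mod Z B + fdim B)%N = fdim Z.
Proof.
move=> sZ sB pZ BZ; have [N [y hy]] := pZ.
have [z [Zz iz spz]] := dim_modP sZ sB hy.
have [b [Bb ib spb]] := fdim_basis sB (spannedS BZ pZ).
pose w (l : 'I_(dim_mod Z B + fdim B)) :=
  match fintype.split l with inl l1 => z l1 | inr l2 => b l2 end.
have wL l : w (lshift _ l) = z l by rewrite /w (unsplitK (inl l)).
have wR l : w (rshift _ l) = b l by rewrite /w (unsplitK (inr l)).
apply/esym; apply: (@dim_mod_eq _ _ _ _ _ w); first exact: subspace0.
split=> [l|c|v Zv].
- by case: (split_ordP l) => l' ->; rewrite ?wL ?wR //; apply: BZ.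
- rewrite /= big_split_ord /=.
  under eq_bigr do rewrite wL; under [X in _ + X]eq_bigr do rewrite wR.
  set x := (X in X + _); set x' := (X in _ + X) => e.
  have Bx' : B x' by apply: subspace_scale_sum.
  have Bx : B x.
    have -> : x = (-1) *: x' + 0 by rewrite addr0 scaleN1r; apply/eqP; rewrite -addr_eq0 e.
    by apply: sB.2 => //; case: sB.
  have cz := iz _ Bx.
  have x0 : x = 0 by rewrite /x big1 // => l _; rewrite cz scale0r.
  have cb := ib (fun l => c (rshift _ l)).
  move=> l; case: (split_ordP l) => l' ->; first exact: cz.
  by apply: cb; rewrite /= -/x'; move: e; rewrite x0 add0r.
- have [c Bc] := spz v Zv; have [c' /eqP] := spb _ Bc; rewrite subr_eq0 => /eqP hc'.
  exists (fun l => match fintype.split l with inl l1 => c l1 | inr l2 => c' l2 end).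
  rewrite big_split_ord /=.
  rewrite (eq_bigr (fun l => c l *: z l)) => [|l _]; last by rewrite wL (unsplitK (inl l)).
  rewrite [X in v - (_ + X)](eq_bigr (fun l => c' l *: b l)) => [|l _]; last by rewrite wR (unsplitK (inr l)).
  by rewrite -hc' opprD addrA subrr.
Qed.

Lemma fdim_ffun (X : finType) (V : lmodType k) (P : set V) : subspace P -> spanned P ->
  fdim [set v : {ffun X -> V} | forall a, P (v a)] = (#|X| * fdim P)%N.
Proof.
move=> sP pP.
pose f (q : 'I_#|X|) (v : {ffun X -> V}) := v (enum_val q).
pose h (q : 'I_#|X|) (w : V) : {ffun X -> V} := [ffun a => if a == enum_val q then w else 0].
have fL q : linear (f q) by move=> c u v; rewrite /f !ffunE.
have hL q : linear (h q).
  move=> c u v; apply/ffunP => a; rewrite !ffunE.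
  by case: ifP => _; rewrite ?scaler0 ?addr0.
have sZ : subspace [set v : {ffun X -> V} | forall a, P (v a)].
  by split=> [a|c u v hu hv a]; rewrite !ffunE; [case: sP|apply: sP.2].
have pZ := spanned_ffun X pP.
rewrite -[X in (X * _)%N]card_ord -sum_nat_const.
apply/eqP; rewrite eqn_leq; apply/andP; split.
  apply: (fdim_peel_le fL) => // [q v hv _|v _ h0]; first exact: hv.
  by apply/ffunP => a; rewrite ffunE -(enum_rankK a); apply: (h0 (enum_rank a)).
apply: (fdim_peel_ge fL hL) => // [q w Pw a|q w Pw|q w j jq Pw].
- by rewrite ffunE; case: ifP => // _; case: sP.
- by rewrite /f ffunE eqxx.
- by rewrite /f ffunE (inj_eq enum_val_inj) -(inj_eq val_inj) ltn_eqF.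
Qed.

End QuotientDimension.

Section PolynomialCycles.
Context {k : fieldType} {n : nat}.
Local Notation S := {mpoly k[n]}.
Implicit Types (P : set S) (I L : set S) (s : 'I_n -> {set 'I_n} -> k) (B : {set 'I_n}).

(** Indexed by all subsets, so that the type does not depend on the homological degree; [pcyc]
    imposes the size. *)
Definition pchain : lmodType k := {ffun {set 'I_n} -> S}.

Definition pbd s (v : pchain) B : S := \sum_(a | a \notin B) s a B *: ('X_a * v (a |: B)%SET).

Definition pcyc s i P : set pchain :=
  [set v : pchain | [/\ forall B, P (v B), forall B, #|B| != i -> v B = 0 & forall B, pbd s v B = 0]].

Definition hpart I d : set S := [set p | I p /\ p \is d.-homog].

Lemma hilbert_hpart I d : hilbert I d = fdim (hpart I d). Proof. by []. Qed.

Lemma subspace_ideal I : is_ideal I -> subspace I.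
Proof. by case=> I0 ID IM; split=> // c p q Ip Iq; apply: ID => //; rewrite -mul_mpolyC; apply: IM. Qed.

Lemma subspace_hpart I d : is_ideal I -> subspace (hpart I d).
Proof.
move=> /subspace_ideal sI; apply: subspaceI => //; split; first exact: rpred0.
by move=> c p q hp hq; rewrite /= rpredD ?rpredZ.
Qed.

Lemma spanned_hpart I d : spanned (hpart I d).
Proof.
pose T := 'X_{1..n < d.+1}.
exists #|{: T}|, (fun l => 'X_[(enum_val l : T)]) => p [_ hp].
exists (fun l => p@_(enum_val l : T)).
rewrite -(big_enum_val (fun m : T => p@_m *: 'X_[m])) /=.
apply: mpolywE; rewrite msizeE; apply/bigmax_leqP_seq => m mp _.
by rewrite (dhomog_mf hp mp).
Qed.

Lemma pbd_linear s c (u v : pchain) B : pbd s (c *: u + v) B = c *: pbd s u B + pbd s v B.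
Proof.
rewrite /pbd scaler_sumr -big_split /=; apply: eq_bigr => a _.
by rewrite !ffunE mulrDr scalerDr -scalerAr !scalerA [c * _]mulrC.
Qed.

Lemma subspace_pcyc s i P : subspace P -> subspace (pcyc s i P).
Proof.
move=> sP; split=> [|c u v [u1 u2 u3] [v1 v2 v3]].
  split=> [B|B _|B]; rewrite ?ffunE //; first by case: sP.
  by rewrite /pbd big1 // => a _; rewrite ffunE mulr0 scaler0.
split=> [B|B Bi|B]; rewrite ?ffunE; first exact: sP.2.
  by rewrite u2 // v2 // scaler0 addr0.
by rewrite pbd_linear u3 v3 scaler0 addr0.
Qed.

Lemma spanned_pcyc s i P : spanned P -> spanned (pcyc s i P).
Proof. by move=> pP; apply: spannedS (spanned_ffun _ pP) => v []. Qed.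

Definition zero_ext i (v : {ffun gens (koszul k n) i -> S}) : pchain :=
  [ffun B => if insub B is Some b then v b else 0].

Lemma zero_extE i (v : {ffun gens (koszul k n) i -> S}) b : zero_ext v (val b) = v b.
Proof. by rewrite ffunE valK. Qed.

Lemma zero_ext0 i (v : {ffun gens (koszul k n) i -> S}) B : #|B| != i -> zero_ext v B = 0.
Proof. by move=> h; rewrite ffunE insubN. Qed.

Lemma zero_ext_linear i : linear (@zero_ext i).
Proof.
move=> c u v; apply/ffunP => B; rewrite !ffunE.
by case: insub => [b|]; rewrite ?ffunE // scaler0 addr0.
Qed.

Lemma ksignM a B (p : S) : ksign k a B * p = koszul_sign k a B *: p.
Proof. by rewrite /ksign /koszul_sign -[in LHS]signr_odd mulr_sign -[in RHS]signr_odd scaler_sign. Qed.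

Lemma bdry_pbd i (v : {ffun gens (koszul k n) i.+1 -> S}) (b : gens (koszul k n) i) :
  bdry v b = pbd (@koszul_sign k n) (zero_ext v) (val b).
Proof.
rewrite /bdry ffunE /pbd /=.
under eq_bigr do rewrite mulr_sumr.
rewrite (exchange_big_dep (fun a => a \notin val b)) /=; last by move=> ? ? _ /andP[].
apply: eq_bigr => a ab.
have cab : #|a |: val b| == i.+1 by rewrite cardsU1 ab (eqP (valP b)).
rewrite (big_pred1 (exist _ (a |: val b)%SET cab)); last first.
  by move=> c; rewrite /= ab /= -(inj_eq val_inj).
rewrite -[(a |: val b)%SET in RHS]
  /(val (exist (fun A : {set 'I_n} => #|A| == i.+1) (a |: val b)%SET cab)) zero_extE.
by rewrite mulrC -mulrA ksignM.
Qed.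

Lemma bdry_linear i : linear (@bdry k n (koszul k n) i).
Proof.
move=> c u v; apply/ffunP => b; rewrite !ffunE scaler_sumr -big_split; apply: eq_bigr => a _.
by rewrite !ffunE mulrDl scalerAl.
Qed.

Lemma twisted_hpart I i d p : I p /\ twisted_homog i (i + d) p <-> hpart I d p.
Proof. by rewrite /twisted_homog leq_addr addKn. Qed.

Lemma tensor_homogE I i d :
  @tensor_homog k n (koszul k n) I i (i + d) = [set v | forall a, hpart I d (v a)].
Proof. by apply/seteqP; split=> v hv a; apply/twisted_hpart; apply: hv. Qed.

Lemma fdim_tensor_homog I i d : is_ideal I ->
  fdim (@tensor_homog k n (koszul k n) I i (i + d)) = ('C(n, i) * hilbert I d)%N.
Proof.
move=> hI; rewrite tensor_homogE fdim_ffun; [|exact: subspace_hpart|exact: spanned_hpart].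
by rewrite card_sig -[n in 'C(n, _)]card_ord -card_draws; congr (_ * _)%N; apply: eq_card => B; rewrite !inE.
Qed.

Lemma spanned_tensor_homog I i d : spanned (@tensor_homog k n (koszul k n) I i (i + d)).
Proof. by rewrite tensor_homogE; apply/spanned_ffun/spanned_hpart. Qed.

Implicit Types (i d : nat).

Let T I i d := @tensor_homog k n (koszul k n) I i (i + d).
Let Zc I i d := @tor_cycles k n (koszul k n) I i (i + d).

Lemma subspace_tensor_homog I i d : is_ideal I -> subspace (@T I i d).
Proof.
move=> /(subspace_hpart d) sP; rewrite /T tensor_homogE.
by split=> [a|c u v hu hv a]; rewrite !ffunE; [case: sP|apply: sP.2].
Qed.

Lemma tor_cyclesE I i d v :
  @Zc I i d v <-> @T I i d v /\ forall B, pbd (@koszul_sign k n) (zero_ext v) B = 0.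
Proof.
case: i v => [|i] v; split=> [|[]] //=.
- move=> hv; split=> // B; rewrite /pbd big1 // => a aB.
  by rewrite zero_ext0 ?mulr0 ?scaler0 // cardsU1 aB.
- move=> [hv bv]; split=> // B; have [cB|cB] := boolP (#|B| == i).
    rewrite -[B]/(val (exist (fun A : {set 'I_n} => #|A| == i) B cB)) -bdry_pbd bv.
    by rewrite ffunE.
  by rewrite /pbd big1 // => a aB; rewrite zero_ext0 ?mulr0 ?scaler0 // cardsU1 aB.
- by move=> hv bv; split=> //; apply/ffunP => b; rewrite bdry_pbd bv ffunE.
Qed.

Lemma subspace_tor_cycles I i d : is_ideal I -> subspace (@Zc I i d).
Proof.
move=> hI; have [T0 TD] := subspace_tensor_homog i d hI.
split; [apply/tor_cyclesE; split=> // B|move=> c u v /tor_cyclesE[Tu bu] /tor_cyclesE[Tv bv]].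
  by rewrite (linear_0 (@zero_ext_linear i)) /pbd big1 // => a _; rewrite ffunE mulr0 scaler0.
apply/tor_cyclesE; split=> [|B]; first exact: TD.
by rewrite zero_ext_linear pbd_linear bu bv scaler0 addr0.
Qed.

Lemma fdim_tor_cycles I i d : is_ideal I ->
  fdim (@Zc I i d) = fdim (pcyc (@koszul_sign k n) i (hpart I d)).
Proof.
move=> hI; have sP := subspace_hpart d hI; have pP := spanned_hpart I d.
have P0 : hpart I d 0 by case: sP.
have TE v : @T I i d v <-> forall a, hpart I d (v a) by rewrite /T tensor_homogE.
apply/eqP; rewrite eqn_leq; apply/andP; split.
  apply: (fdim_inj_le (@zero_ext_linear i)).
  - exact: subspace_tor_cycles.
  - exact: subspace_pcyc.
  - exact: spanned_pcyc.
  - move=> v /tor_cyclesE[/TE hv bv]; split=> // B; last exact: zero_ext0.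
    by rewrite ffunE; case: insub.
  - by move=> v _ v0; apply/ffunP => b; rewrite -zero_extE v0 !ffunE.
pose r (v : pchain) : {ffun gens (koszul k n) i -> S} := [ffun b => v (val b)].
have rL : linear r by move=> c u v; apply/ffunP => b; rewrite !ffunE.
have rK (v : pchain) : (forall B, #|B| != i -> v B = 0) -> zero_ext (r v) = v.
  by move=> h; apply/ffunP => B; rewrite ffunE; case: insubP => [b _ <-|/h -> //]; rewrite ffunE.
apply: (fdim_inj_le rL).
- exact: subspace_pcyc.
- exact: subspace_tor_cycles.
- by apply: spannedS (spanned_tensor_homog I i d) => v /tor_cyclesE[].
- move=> v [v1 v2 v3]; apply/tor_cyclesE; rewrite rK //; split=> //.
  by apply/TE => b; rewrite ffunE.
- by move=> v [_ v2 _] r0; rewrite -(rK v v2) r0 (linear_0 (@zero_ext_linear i)).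
Qed.

Lemma tor_cycles_sub I i j : @tor_cycles k n (koszul k n) I i j `<=` @tensor_homog k n (koszul k n) I i j.
Proof. by case: i => [|i] v // []. Qed.

Lemma betti_eq0 I i j : is_ideal I -> (j < i)%N -> betti I i j = 0%N.
Proof.
move=> hI ji; apply/eqP; rewrite -leqn0.
have [z [Zz iz _]] := tor_dimP (koszul k n) i j hI.
have z0 l : z l = 0.
  have hz := tor_cycles_sub (Zz l).
  apply/ffunP => a; rewrite ffunE; have [_] := hz a.
  by rewrite /twisted_homog /= leqNgt ji => /eqP.
rewrite leqNgt; apply/negP => h.
have := iz (fun=> 1) _ (Ordinal h); rewrite big1 => [|l _]; last by rewrite z0 scaler0.
by move=> /(_ (tor_boundaries_subspace _ _ _ hI).1) /eqP; rewrite oner_eq0.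
Qed.

Lemma spanned_tor_cycles I i d : is_ideal I -> spanned (@Zc I i d).
Proof. by move=> hI; apply: spannedS (spanned_tensor_homog I i d) => v /tor_cyclesE[]. Qed.

Lemma boundaries_sub_cycles I i j : is_ideal I ->
  @tor_boundaries k n (koszul k n) I i j `<=` @tor_cycles k n (koszul k n) I i j.
Proof.
move=> [I0 ID IM] _ [w Tw <-].
have [_ _ _ _ ex] := @koszul_resolution k n.
have Tb : tensor_homog I j (bdry w).
  move=> b; split.
    rewrite ffunE; elim/big_rec: _ => // a p _ Ip; apply: ID => //.
    by rewrite mulrC; apply: IM; case: (Tw a).
  rewrite bdry_pbd /pbd /twisted_homog.
  have hw B : zero_ext w B \is (j - i.+1).-homog /\ ((j < i.+1)%N -> zero_ext w B = 0).
    rewrite ffunE; case: insub => [a|]; last by rewrite rpred0.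
    have [_] := Tw a; rewrite /twisted_homog /=.
    by case: (leqP i.+1 j) => _; [move=> ->|move=> /eqP ->; rewrite rpred0].
  case: leqP => [ij|ji]; last first.
    by rewrite big1 // => a _; rewrite (hw _).2 ?mulr0 ?scaler0 // ltnW.
  case: (ltnP i j) => [h|h]; last first.
    by rewrite big1 ?rpred0 // => a _; rewrite (hw _).2 ?mulr0 ?scaler0.
  rewrite rpred_sum // => a _; apply: rpredZ.
  have -> : (j - i)%N = (1 + (j - i.+1))%N by rewrite add1n subnSK.
  by apply: dhomogM; [rewrite dhomogX /= mdeg1|case: (hw (a |: val b)%SET)].
case: i w Tw Tb => [|i] w Tw Tb //; split=> //.
by apply/ex; exists w.
Qed.

(** Rank and nullity of the differential from homological degree i + 1 in internal degree i + d + 1: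
    its image consists of the boundaries, its kernel of the cycles. *)
Lemma betti_formula I i d : is_ideal I ->
  (betti I i (i + d.+1) + 'C(n, i.+1) * hilbert I d =
   fdim (pcyc (@koszul_sign k n) i (hpart I d.+1)) +
   fdim (pcyc (@koszul_sign k n) i.+1 (hpart I d)))%N.
Proof.
move=> hI; rewrite -!fdim_tor_cycles // -(fdim_tensor_homog i.+1 d hI).
have sB := tor_boundaries_subspace (koszul k n) i (i + d.+1) hI.
have BZ := @boundaries_sub_cycles I i (i + d.+1) hI.
have pZ := spanned_tor_cycles i d.+1 hI.
have e1 := dim_mod_fdim (subspace_tor_cycles i d.+1 hI) sB pZ BZ.
rewrite -/(@Zc _ _ _) -e1 /betti /tor_dim -/(@Zc I i d.+1) -!addnA; congr (_ + _)%N.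
have e0 : (i + d.+1 = i.+1 + d)%N by rewrite addnS.
have sT := subspace_tensor_homog i.+1 d hI; have pT := spanned_tensor_homog I i.+1 d.
have sZ := subspace_tor_cycles i.+1 d hI; have pZ' := spanned_tor_cycles i.+1 d hI.
have bL := @bdry_linear i.
apply/eqP; rewrite eqn_leq; apply/andP; split.
  apply: (fdim_add_le bL (g := id)) => //.
  - exact: spannedS BZ pZ.
  - by move=> v Tv; exists v => //; rewrite e0.
have [z [Bz iz]] := fdim_indep (@tor_boundaries k n (koszul k n) I i (i + d.+1)).
have [y [Zy iy]] := fdim_indep (@Zc I i.+1 d).
have ex l : exists w, @T I i.+1 d w /\ bdry w = z l.
  by have [w Tw e] := Bz l; exists w; rewrite /T -e0.
have [x hx] := choice ex.
pose w l := match fintype.split l with inl l1 => x l1 | inr l2 => y l2 end.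
have wL l : w (lshift _ l) = x l by rewrite /w (unsplitK (inl l)).
have wR l : w (rshift _ l) = y l by rewrite /w (unsplitK (inr l)).
apply: (@fdim_max _ _ _ _ w) => // [l|c].
  case: (split_ordP l) => l' ->; rewrite ?wL ?wR; first by case: (hx l').
  by case: (Zy l').
rewrite big_split_ord /=.
under eq_bigr do rewrite wL; under [X in _ + X]eq_bigr do rewrite wR.
move=> e.
have cz := iz (fun l => c (lshift _ l)).
have {}cz : forall l, c (lshift _ l) = 0.
  apply: cz; have := congr1 (@bdry k n (koszul k n) i) e.
  rewrite (linear_D bL) !(linear_sum bL) (linear_0 bL) [X in _ + X]big1 ?addr0 => [|l _].
    by under eq_bigr do rewrite (hx _).2.
  by case: (Zy l) => _ /= ->; rewrite scaler0.
move=> l; case: (split_ordP l) => l' ->; first exact: cz.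
apply: (iy (fun l => c (rshift _ l))); move: e.
by rewrite big1 ?add0r // => q _; rewrite cz scale0r.
Qed.

(** On the diagonal there are no boundaries: the generators of the next term have degree i + 1. *)
Lemma betti_formula0 I i : is_ideal I ->
  betti I i i = fdim (pcyc (@koszul_sign k n) i (hpart I 0)).
Proof.
move=> hI; rewrite -fdim_tor_cycles //.
have sB := tor_boundaries_subspace (koszul k n) i (i + 0) hI.
rewrite -(dim_mod_fdim (subspace_tor_cycles i 0 hI) sB
  (spanned_tor_cycles i 0 hI) (@boundaries_sub_cycles I i _ hI)).
have -> : fdim (@tor_boundaries k n (koszul k n) I i (i + 0)) = 0%N.
  apply: etrans (@fdim0 k {ffun gens (koszul k n) i -> S}); congr fdim.
  apply/seteqP; split=> v; last by move=> ->; exact: sB.1.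
  move=> [w Tw <-]; rewrite (_ : w = 0) ?(linear_0 (@bdry_linear i)) //.
  apply/ffunP => a; rewrite ffunE; have [_] := Tw a.
  by rewrite /twisted_homog /= addn0 ltnn => /eqP.
by rewrite addn0 /betti /tor_dim /Zc addn0.
Qed.

Lemma betti_le I L : is_ideal I -> is_ideal L -> (forall d, hilbert L d = hilbert I d) ->
  (forall i d, (fdim (pcyc (@koszul_sign k n) i (hpart I d)) <=
    fdim (pcyc (@koszul_sign k n) i (hpart L d)))%N) ->
  forall i j, (betti I i j <= betti L i j)%N.
Proof.
move=> hI hL hH hz i j; have [ji|ij] := ltnP j i; first by rewrite betti_eq0.
rewrite -(subnKC ij); case: (j - i)%N => [|d].
  by rewrite addn0 !betti_formula0.
rewrite -(leq_add2r ('C(n, i.+1) * hilbert I d)) betti_formula // -hH betti_formula //.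
by rewrite leq_add.
Qed.

End PolynomialCycles.

(** * Initial ideals *)

Section LeadingMonomials.
Context {k : fieldType} {n : nat}.
Local Notation S := {mpoly k[n]}.
Implicit Types (P I : set S) (V J : 'X_{1..n} -> bool) (m : 'X_{1..n}) (B : {set 'I_n}).
Implicit Types (s : 'I_n -> {set 'I_n} -> k).

Definition coef (v : @pchain k n) : @chain k n := fun x => (v x.1)@_x.2.

Lemma coef_linear : linear coef.
Proof. by move=> c u v; apply/funext => x; rewrite chain_linE /coef !ffunE mcoeffD mcoeffZ. Qed.

Lemma mcoeff_XM (a : 'I_n) (p : S) m :
  ('X_a * p)@_m = if (0 < m a)%N then p@_(m - U_(a))%MM else 0.
Proof.
case: ifP => ma.
  by rewrite mulrC -{1}(submUK ma) addmC mcoeffMX.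
apply/memN_msupp_eq0/negP; rewrite mulrC => /msuppM_le.
case/allpairsP=> -[u v] /= [_]; rewrite msuppX inE => /eqP -> mE.
by move: ma; rewrite mE mnmDE mnm1E eqxx addn1.
Qed.

Lemma coef_pbd s (v : @pchain k n) B m : (pbd s v B)@_m = bd s (coef v) (B, m).
Proof.
rewrite /pbd raddf_sum /= /bd /= big_mkcondr; apply: eq_bigr => a _.
by rewrite mcoeffZ mcoeff_XM; case: ifP => _; rewrite ?mulr0.
Qed.

(** The order in which the peeling lemmas read off components, largest first. *)
Lemma exists_descending N : exists l : seq 'X_{1..n},
  [/\ uniq l, forall m, (m \in l) = (mdeg m < N)%N
    & forall q m, (q < size l)%N -> m \in l -> (nth 0%MM l q < m)%O -> (index m l < q)%N].
Proof.
pose ge (u v : 'X_{1..n}) := (v <= u)%O.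
have geT : total ge by move=> u v; apply: le_total.
have tr : transitive ge by move=> x y w /= yx wy; apply: le_trans wy yx.
exists (sort ge (mons N)); split=> [|m|q m hq hm lt].
- by rewrite sort_uniq uniq_mons.
- by rewrite mem_sort mem_mons.
rewrite ltnNge; apply/negP => h.
have ss : sorted ge (sort ge (mons N)) by apply: sort_sorted.
have : (m <= nth 0%MM (sort ge (mons N)) q)%O.
  rewrite -[m in (m <= _)%O](nth_index 0%MM hm).
  apply: (sorted_leq_nth tr _ 0%MM ss) h; rewrite ?inE ?index_mem //.
  by move=> x; apply: lexx.
by rewrite leNgt lt.
Qed.

Definition lead_set P m : bool := `[< exists p, [/\ P p, p != 0 & mlead p = m] >].

Lemma lead_setP P m : reflect (exists p, [/\ P p, p != 0 & mlead p = m]) (lead_set P m).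
Proof. exact: asboolP. Qed.

Lemma mdeg_mlead_homog d (p : S) : p \is d.-homog -> p != 0 -> mdeg (mlead p) = d.
Proof. by move=> hp p0; rewrite (dhomog_mf hp) // mlead_supp. Qed.

Lemma lead_set_deg P d m : P `<=` [set p | p \is d.-homog] -> lead_set P m -> mdeg m = d.
Proof. by move=> hP /lead_setP[p [/hP hp p0 <-]]; apply: mdeg_mlead_homog. Qed.

Lemma fdim_setT : fdim [set: k^o] = 1%N.
Proof.
apply: (@dim_mod_eq _ _ _ _ 1 (fun=> (1 : k^o))); first exact: subspace0.
split=> // [c|v _].
  by rewrite /= big_ord1 /GRing.scale /= mulr1 => c0 l; rewrite ord1.
by exists (fun=> v); rewrite big_ord1 /GRing.scale /= mulr1 subrr.
Qed.

(** Reading coefficients from the largest monomial down, the first nonzero one is the leading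
    coefficient, so a coefficient outside [lead_set P] vanishes once all larger ones do. Conversely,
    monic elements with the given leading monomials are triangular. *)
Lemma fdim_lead_set P d N : subspace P -> spanned P -> P `<=` [set p | p \is d.-homog] ->
  (d < N)%N -> fdim P = crd N (lead_set P).
Proof.
move=> sP pP hP dN; have [l [ul ml dl]] := exists_descending N.
pose mq (q : 'I_(size l)) := nth 0%MM l q.
pose f (q : 'I_(size l)) (p : S) : k^o := p@_(mq q).
pose D (q : 'I_(size l)) : set k^o := if lead_set P (mq q) then setT else [set 0].
have sD q : subspace (D q) by rewrite /D; case: ifP => _; [split|exact: subspace0].
have pD q : spanned (D q).
  exists 1%N, (fun=> (1 : k^o)) => v _; exists (fun=> v).
  by rewrite big_ord1 /GRing.scale /= mulr1.
have fL q : linear (f q) by move=> c u v; rewrite /f mcoeffD mcoeffZ.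
have -> : crd N (lead_set P) = (\sum_q fdim (D q))%N.
  rewrite /crd -sum1_count big_mkcond /=.
  have pe : perm_eq (mons N) l by apply: uniq_perm; rewrite ?uniq_mons // => m; rewrite mem_mons ml.
  rewrite (perm_big _ pe) /= (big_nth 0%MM) big_mkord; apply: eq_bigr => q _.
  by rewrite /D /mq; case: ifP => _; rewrite ?fdim_setT ?fdim0.
have inl p m : P p -> m \in msupp p -> m \in l.
  by move=> /hP hp mp; rewrite ml (dhomog_mf hp mp).
apply/eqP; rewrite eqn_leq; apply/andP; split.
  apply: (fdim_peel_le fL) => // [q v Pv h0|v Pv h0].
    rewrite /D; case: ifP => // /lead_setP nl.
    apply: contrapT => /eqP fq; apply: nl; exists v.
    have mv : mq q \in msupp v by rewrite mcoeff_msupp.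
    have v0 : v != 0 by apply: contraNneq fq => ->; rewrite /f mcoeff0.
    split=> //; apply/eqP; rewrite eq_le; apply/andP; split; last exact: msupp_le_mlead.
    rewrite leNgt; apply/negP => lt.
    have lm := inl _ _ Pv (mlead_supp v0).
    have jq := dl _ _ (ltn_ord q) lm lt.
    have jl : (index (mlead v) l < size l)%N by rewrite index_mem.
    have := h0 (Ordinal jl) jq; rewrite /f /mq /= nth_index // => /eqP.
    by rewrite mleadc_eq0 (negPf v0).
  apply/mpolyP => m; rewrite mcoeff0; case: (boolP (m \in msupp v)) => [mv|/memN_msupp_eq0 //].
  have lm := inl _ _ Pv mv; rewrite -index_mem in lm.
  by have := h0 (Ordinal lm); rewrite /f /mq /= nth_index // -index_mem.
have ex q : exists p, lead_set P (mq q) -> [/\ P p, p@_(mq q) = 1 & mlead p = mq q].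
  case: (boolP (lead_set P (mq q))) => [/lead_setP[p [Pp p0 lp]]|nl]; last by exists 0.
  exists ((mleadc p)^-1 *: p) => _; split.
  - by rewrite -[_ *: p]addr0; apply: sP.2 => //; case: sP.
  - by rewrite mcoeffZ -lp mulVf // mleadc_eq0.
  - by rewrite mleadZ // invr_eq0 mleadc_eq0.
have [g hg] := choice ex.
apply: (fdim_peel_ge fL (h := fun q (c : k^o) => (c : k) *: (if lead_set P (mq q) then g q else 0))) => //.
- by move=> q c u v; rewrite scalerDl scalerA.
- move=> q c _; case: ifP => [/hg [Pg _ _]|_]; last by rewrite scaler0; case: sP.
  by rewrite -[_ *: _]addr0; apply: sP.2 => //; case: sP.
- move=> q c; rewrite /D /f; case: ifP => [/hg [_ g1 _] _|_ ->]; last by rewrite scale0r mcoeff0.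
  by rewrite mcoeffZ g1 mulr1.
- move=> q c j jq _; rewrite /f; case: ifP => [lq|_]; last by rewrite scaler0 mcoeff0.
  have [Pg g1 lg] := hg q lq; rewrite mcoeffZ [X in _ * X](_ : _ = 0) ?mulr0 //.
  apply/memN_msupp_eq0/negP => /msupp_le_mlead; rewrite lg leNgt; apply/negP; rewrite negbK.
  rewrite lt_neqAle; apply/andP; split.
    by rewrite /mq nth_uniq // gtn_eqF.
  rewrite leNgt; apply/negP => lt; have := dl j (mq q) (ltn_ord j) (mem_nth _ (ltn_ord q)) lt.
  by rewrite /mq index_uniq // ltnNge (ltnW jq).
Qed.

(** The differential preserves the Z^n-degree, so the component of a cycle in its largest
    multidegree is again a cycle. For fixed B multidegrees are ordered like monomials, so this
    component involves only leading monomials of the coordinates. *)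
Lemma fdim_pcyc_le P d s i : subspace P -> spanned P -> P `<=` [set p | p \is d.-homog] ->
  (fdim (pcyc s i P) <= zdim s i (lead_set P))%N.
Proof.
(* The multidegree of x^m e_B has total degree d + |B|, at most d + n. *)
move=> sP pP hP; pose N := (d + n).+1; have [l [ul ml dl]] := exists_descending N.
pose mq (q : 'I_(size l)) := nth 0%MM l q.
pose R (q : 'I_(size l)) := rest (k := k) (fun x : {set 'I_n} * 'X_{1..n} => mdegree x.1 x.2 == mq q).
pose f q (v : @pchain k n) := R q (coef v).
have RL q : linear (R q) by exact: rest_linear.
have fL q : linear (f q) by move=> c u v; rewrite /f coef_linear RL.
pose KP := K s i (lead_set P) all_mon.
pose D q : set (@chain k n) := KP `&` [set u | R q u = u].
have bP : bounded d.+1 (lead_set P) by move=> m /(lead_set_deg hP) ->.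
have sD q : subspace (D q).
  apply: subspaceI; first exact: subspace_K.
  split; first exact: linear_0 (RL q).
  by move=> c u v; rewrite /= RL => -> ->.
have pK : spanned KP := spanned_K s i all_mon bP.
have pD q : spanned (D q) by apply: spannedS pK => u [].
have RR q u : R q (R q u) = R q u.
  by apply/funext => x; rewrite /R /rest; case: (mdegree _ _ == _).
have bR q u : bd s (R q u) = R q (bd s u).
  apply/funext => -[B m]; rewrite /R /rest /=.
  have step (a : 'I_n) : a \notin B -> (0 < m a)%N ->
      mdegree (a |: B)%SET (m - U_(a))%MM = mdegree B m := @mdegree_swap _ a B m.
  rewrite /bd /=; case: ifP => h.
    by apply: eq_bigr => a /andP[aB ma]; rewrite step // h.
  by rewrite big1 // => a /andP[aB ma]; rewrite step // h mulr0.
have degE B m : mdeg (mdegree B m) = (mdeg m + #|B|)%N.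
  rewrite !mdegE -sum1_card [X in (_ + X)%N]big_mkcond -big_split /=.
  by apply: eq_bigr => a _; rewrite mnmE; case: (a \in B).
have Cn B : (#|B| <= n)%N by rewrite -[X in (_ <= X)%N]card_ord max_card.
have inl v B m : P (v B) -> m \in msupp (v B) -> mdegree B m \in l.
  by move=> /hP hv mv; rewrite ml degE (dhomog_mf hv mv) /N; have := Cn B; lia.
have ltm B m m' : (m < m')%O -> (mdegree B m < mdegree B m')%O.
  pose e := [multinom nat_of_bool (a \in B) | a < n].
  have E u : mdegree B u = (e + u)%MM by apply/mnmP => a; rewrite mnmDE !mnmE addnC.
  by rewrite !E ltmc_add2r.
apply: (@leq_trans (\sum_q fdim (D q))%N).
  apply: (fdim_peel_le fL) => //.
  - exact: subspace_pcyc.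
  - exact: spanned_pcyc.
  - move=> q v [v1 v2 v3] h0; split; last exact: RR.
    split=> [[B m] /= h|B m _]; last first.
      rewrite bR /R /rest /=; case: ifP => // _.
      by rewrite -coef_pbd v3 mcoeff0.
    rewrite /f /R /rest /=; case: ifP => // /eqP hm; rewrite /coef /=.
    move: h; rewrite negb_and => /orP[Bi|nl]; first by rewrite v2 // mcoeff0.
    apply: contrapT => /eqP vm; case/negP: nl; apply/lead_setP; exists (v B).
    have mv : m \in msupp (v B) by rewrite mcoeff_msupp.
    have v0 : v B != 0 by apply: contraNneq vm => ->; rewrite mcoeff0.
    split=> //; apply/eqP; rewrite eq_le; apply/andP; split; last exact: msupp_le_mlead.
    rewrite leNgt; apply/negP => lt.
    have lm := inl v B _ (v1 B) (mlead_supp v0).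
    have jq := dl _ _ (ltn_ord q) lm; rewrite -/(mq q) -hm in jq.
    have {}jq := jq (ltm _ _ _ lt).
    have jl : (index (mdegree B (mlead (v B))) l < size l)%N by rewrite index_mem.
    have := congr1 (fun u : chain => u (B, mlead (v B))) (h0 (Ordinal jl) jq).
    rewrite /f /R /rest /= /mq /= nth_index // eqxx /coef /= chain0E => /eqP.
    by rewrite mleadc_eq0 (negPf v0).
  - move=> v [v1 v2 v3] h0; apply/ffunP => B; rewrite ffunE; apply/mpolyP => m.
    rewrite mcoeff0; case: (boolP (m \in msupp (v B))) => [mv|/memN_msupp_eq0 //].
    have lm := inl v B _ (v1 B) mv; have jl := lm; rewrite -index_mem in jl.
    have := congr1 (fun u : chain => u (B, m)) (h0 (Ordinal jl)).
    by rewrite /f /R /rest /= /mq /= nth_index // eqxx.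
apply: (fdim_peel_ge RL (h := fun q u => u)) => //.
- exact: subspace_K.
- by move=> q w [].
- by move=> q w [].
- move=> q w j jq [_ hw]; rewrite -hw; apply/funext => x; rewrite chain0E /R /rest.
  case: ifP => // /eqP ->; case: ifP => // /eqP h.
  have := nth_uniq 0%MM (ltn_ord j) (ltn_ord q) ul; rewrite -/(mq j) -/(mq q) h eqxx.
  by rewrite ltn_eqF.
Qed.

Definition mspan V : set S := [set p | forall m, ~~ V m -> p@_m = 0].

Lemma up_set_add V m m' : up_set V -> V m -> V (m' + m)%MM.
Proof.
move=> uV Vm; elim: {m'}(mdeg m') {-2}m' (erefl (mdeg m')) => [|d IH] m' dm.
  by move/eqP: dm; rewrite mdeg_eq0 => /eqP ->; rewrite add0m.
have [|a ma] := @mdeg_gt0 _ m'; first by rewrite dm.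
have := mdeg_sub ma; rewrite dm => -[dm'].
by rewrite -(submUK ma) -addmA [(U_(a) + m)%MM]addmC addmA; apply: uV; apply: IH.
Qed.

Lemma is_ideal_mspan V : up_set V -> is_ideal (mspan V).
Proof.
move=> uV; split=> [m _|p q hp hq m Vm|a p hp m Vm].
- by rewrite mcoeff0.
- by rewrite mcoeffD hp // hq // addr0.
- apply/memN_msupp_eq0/negP => /msuppM_le /allpairsP[[u v] /= [_ vp mE]].
  case/negP: Vm; rewrite mE; apply: up_set_add => //.
  by apply: contraTT vp => /hp; rewrite -mcoeff_eq0 => ->.
Qed.

Lemma mpolyX_neq0 m : 'X_[m] != 0 :> S.
Proof. by rewrite -mleadc_eq0 mleadXm mcoeffX eqxx oner_eq0. Qed.

Lemma mspanX V m : mspan V 'X_[m] <-> V m.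
Proof.
split=> [h|Vm m' Vm']; last by rewrite mcoeffX; case: eqP => // e; rewrite -e Vm in Vm'.
by apply: contraT => /h; rewrite mcoeffX eqxx => /eqP; rewrite oner_eq0.
Qed.

Lemma lead_set_mspan V d m : lead_set (hpart (mspan V) d) m = deg_part d V m.
Proof.
apply/lead_setP/andP => [[p [[hp hd] p0 <-]]|[Vm /eqP dm]].
  split; last by rewrite (mdeg_mlead_homog hd).
  by apply: contraT => /hp /eqP; rewrite mleadc_eq0 (negPf p0).
exists 'X_[m]; split; last exact: mleadXm.
  by split; [exact/mspanX|rewrite /= dhomogX /= dm].
exact: mpolyX_neq0.
Qed.

Lemma hpart_homog I d : hpart I d `<=` [set p | p \is d.-homog].
Proof. by move=> p []. Qed.

Lemma hilbert_lead_set I d N : is_ideal I -> (d < N)%N ->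
  hilbert I d = crd N (lead_set (hpart I d)).
Proof.
move=> hI dN; rewrite hilbert_hpart; apply: (@fdim_lead_set _ d) => //.
- exact: subspace_hpart.
- exact: spanned_hpart.
- exact: hpart_homog.
Qed.

Lemma zdim_le_pcyc V d s i : up_set V ->
  (zdim s i (deg_part d V) <= fdim (pcyc s i (hpart (mspan V) d)))%N.
Proof.
move=> uV; have hI := is_ideal_mspan uV.
pose g (u : @chain k n) : @pchain k n := [ffun B => \sum_(m <- mons d.+1) u (B, m) *: 'X_[m]].
have gE u B m : (g u B)@_m = if (mdeg m < d.+1)%N then u (B, m) else 0.
  rewrite ffunE raddf_sum /= -mem_mons.
  under eq_bigr do rewrite mcoeffZ mcoeffX.
  case: (boolP (m \in mons d.+1)) => mN.
    rewrite (bigD1_seq m) ?uniq_mons //= eqxx mulr1 big1 ?addr0 // => m' /negPf ->.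
    by rewrite mulr0.
  rewrite big_seq big1 // => m' m'N; case: eqP => [e|_]; last by rewrite mulr0.
  by rewrite -e m'N in mN.
have gL : linear g.
  move=> c u v; apply/ffunP => B; rewrite !ffunE scaler_sumr -big_split /=.
  by apply: eq_bigr => m _; rewrite chain_linE scalerDl scalerA.
have gK u : supp_chain i (deg_part d V) u -> coef (g u) = u.
  move=> hu; apply/funext => -[B m]; rewrite /coef /= gE; case: ifP => // /negbT dm.
  rewrite hu //=; apply/negP => /andP[_ /andP[_ /eqP e]].
  by rewrite e ltnSn in dm.
apply: (fdim_inj_le gL).
- exact: subspace_K.
- by apply: subspace_pcyc; apply: subspace_hpart.
- exact: spanned_pcyc (spanned_hpart _ _).
- move=> u [hu bu]; split=> [B|B Bi|B].
  + split=> [m nV|].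
      rewrite gE; case: ifP => // _; apply: hu => /=.
      by rewrite /deg_part (negPf nV) andbF.
    rewrite /= ffunE rpred_sum // => m _.
    have [uE|] := eqVneq (u (B, m)) 0; first by rewrite uE scale0r rpred0.
    move=> um; apply: rpredZ; rewrite dhomogX /=.
    by apply: contraNT um => dm; apply/eqP; apply: hu; rewrite /= /deg_part (negPf dm) !andbF.
  + apply/mpolyP => m; rewrite mcoeff0 gE; case: ifP => // _.
    by apply: hu; rewrite /= (negPf Bi).
  + by apply/mpolyP => m; rewrite mcoeff0 coef_pbd gK // bu.
- by move=> u [hu _] g0; rewrite -(gK u hu) g0 (linear_0 coef_linear).
Qed.

Definition lead_ideal I m : bool := lead_set (hpart I (mdeg m)) m.

Lemma deg_lead_ideal I d m : deg_part d (lead_ideal I) m = lead_set (hpart I d) m.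
Proof.
rewrite /deg_part /lead_ideal; apply/andP/idP => [[h /eqP <-] //|h].
by have dm := lead_set_deg (@hpart_homog I d) h; rewrite dm eqxx.
Qed.

Lemma up_set_lead_ideal I : is_ideal I -> up_set (lead_ideal I).
Proof.
move=> [I0 ID IM] m a /lead_setP[p [[Ip hp] p0 lp]]; apply/lead_setP.
exists ('X_a * p); split.
- split; first exact: IM.
  rewrite /= mdegD mdeg1 addnC; apply: dhomogM => //.
  by rewrite dhomogX /= mdeg1.
- by rewrite mulf_neq0 // mpolyX_neq0.
- by rewrite mleadM ?mleadXm ?lp 1?addmC // mpolyX_neq0.
Qed.

Lemma initial_step I : is_ideal I ->
  [/\ up_set (lead_ideal I),
      forall d N, (d < N)%N -> crd N (deg_part d (lead_ideal I)) = hilbert I d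
    & forall s i d, (fdim (pcyc s i (hpart I d)) <= zdim s i (deg_part d (lead_ideal I)))%N].
Proof.
move=> hI; have E d : deg_part d (lead_ideal I) = lead_set (hpart I d).
  by apply/funext => m; rewrite deg_lead_ideal.
split=> [|d N dN|s i d]; first exact: up_set_lead_ideal.
  by rewrite E -hilbert_lead_set.
rewrite E; apply: fdim_pcyc_le; [exact: subspace_hpart|exact: spanned_hpart|].
exact: hpart_homog.
Qed.

End LeadingMonomials.

(** * Reduction to pure powers *)

Section Transvection.
Context {k : fieldType} {n : nat}.
Local Notation S := {mpoly k[n]}.
Variables (a b : 'I_n).
Hypothesis ab : (a < b)%N.
Implicit Types (p : S) (J : 'X_{1..n} -> bool) (m : 'X_{1..n}) (B : {set 'I_n}) (c : k).

Let a_neq_b : a != b. Proof. by apply: contraTneq ab => ->; rewrite ltnn. Qed.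

Definition transv_form c (i : 'I_n) : S := 'X_i + (if i == b then c *: 'X_a else 0).

Definition transv c (p : S) : S := p \mPo [tuple transv_form c i | i < n].

Lemma transvXU c i : transv c 'X_i = transv_form c i.
Proof. by rewrite /transv comp_mpolyXU -tnth_nth tnth_mktuple. Qed.

Lemma transvX c m : transv c 'X_[m] = \prod_(i < n) transv_form c i ^+ m i.
Proof. by rewrite /transv comp_mpolyX; apply: eq_bigr => i _; rewrite tnth_mktuple. Qed.

Lemma transvM c : {morph transv c : p q / p * q}. Proof. exact: rmorphM. Qed.

Lemma transv_linear c : linear (transv c).
Proof. by move=> d p q; rewrite /transv linearP. Qed.

Lemma transv_sum c (I : Type) (r : seq I) (P : pred I) (F : I -> S) :
  transv c (\sum_(i <- r | P i) F i) = \sum_(i <- r | P i) transv c (F i).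
Proof.
exact: (big_morph (transv c) (linear_D (transv_linear c)) (linear_0 (transv_linear c))).
Qed.

Lemma transvK c : cancel (transv c) (transv (- c)).
Proof.
move=> p; have L : linear (fun q => transv (- c) (transv c q)).
  by move=> d q q'; rewrite !transv_linear.
have Xm m : transv (- c) (transv c 'X_[m]) = 'X_[m]; last first.
  rewrite {1}(mpolyE p) [RHS](mpolyE p).
  elim: (msupp p : seq _) => [|m l IH]; first by rewrite !big_nil (linear_0 L).
  by rewrite !big_cons (L (p@_m)) IH Xm.
rewrite transvX [RHS]mpolyXE_id.
rewrite /transv rmorph_prod; apply: eq_bigr => i _; rewrite rmorphXn /=; congr (_ ^+ _).
rewrite /transv_form comp_mpolyD -!/(transv (- c) _) transvXU /transv_form.
case: eqP => [_|_]; last by rewrite /transv comp_mpoly0 !addr0.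
rewrite /transv comp_mpolyZ -/(transv (- c) _) transvXU /transv_form (negPf a_neq_b) addr0.
by rewrite -addrA -scalerDl addNr scale0r addr0.
Qed.

Lemma transv_form_homog c i : transv_form c i \is 1.-homog.
Proof.
have X1 (j : 'I_n) : ('X_j : S) \is 1.-homog by rewrite dhomogX /= mdeg1.
by rewrite rpredD //; case: ifP => _; rewrite ?rpred0 // rpredZ.
Qed.

Lemma transv_homog c d p : p \is d.-homog -> transv c p \is d.-homog.
Proof.
move=> hp; rewrite (mpolyE p) /transv raddf_sum /= big_seq rpred_sum // => m mp.
have dm : mdeg m = d := dhomog_mf hp mp.
rewrite comp_mpolyZ rpredZ // -/(transv c _) transvX -dm mdegE.
elim: (index_enum 'I_n) => [|i l IH]; first by rewrite !big_nil dhomog1.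
rewrite !big_cons; apply: dhomogM => //.
by have := dhomogMn (m i) (transv_form_homog c i); rewrite mul1n.
Qed.

Variable s : 'I_n -> {set 'I_n} -> k.
Hypothesis sS : sign_system s.

(** The substitution alone does not commute with the differential, which now meets x_b + x_a in
    place of x_b. The correction is the matching change e_b to e_b + e_a on the exterior algebra,
    with the quotient of signs for replacing b by a. *)
Definition transv_chain (v : @pchain k n) : @pchain k n := [ffun A =>
  transv 1 (v A) + if (a \in A) && (b \notin A) then
    (s b (A :\ a)%SET / s a (A :\ a)%SET) *: transv 1 (v (b |: (A :\ a))%SET) else 0].

Lemma transv_chain_linear : linear transv_chain.
Proof.
move=> c u v; apply/ffunP => A; rewrite !ffunE !transv_linear.
case: ifP => _; last by rewrite !addr0.
by rewrite !scalerDr !scalerA [_ / _ * c]mulrC addrACA.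
Qed.

(** The substituted cycle conditions are [H], and [E] measures what the correction must absorb. If b
    is in B all differences vanish; if neither is, the terms at a and b cancel; if only a is, the
    differences add up to a multiple of [H] at [b |: B0]. *)
Lemma pbd_transv_chain v : (forall B, pbd s v B = 0) -> forall B, pbd s (transv_chain v) B = 0.
Proof.
case: (sS) => s0 sC bv B.
pose w (A : {set 'I_n}) := transv 1 (v A).
pose l i := transv_form 1 i : S.
have H (C : {set 'I_n}) : \sum_(c | c \notin C) s c C *: (l c * w (c |: C)%SET) = 0.
  have := congr1 (transv 1) (bv C); rewrite (linear_0 (transv_linear 1)) => h; apply: etrans h.
  rewrite /pbd transv_sum; apply: eq_bigr => c _.
  by rewrite (linear_Z (transv_linear 1)) transvM transvXU.
have lE (c : 'I_n) : c != b -> l c = 'X_c by move=> cb; rewrite /l /transv_form (negPf cb) addr0.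
have lb : l b = 'X_b + 'X_a by rewrite /l /transv_form eqxx scale1r.
pose G (A : {set 'I_n}) : S := if (a \in A) && (b \notin A) then
    (s b (A :\ a)%SET / s a (A :\ a)%SET) *: w (b |: (A :\ a))%SET else 0.
have TE A : transv_chain v A = w A + G A by rewrite ffunE.
pose E (c : 'I_n) := s c B *: ('X_c * (w (c |: B)%SET + G (c |: B)%SET) - l c * w (c |: B)%SET).
suff E0 : \sum_(c | c \notin B) E c = 0.
  apply: etrans (_ : _ = \sum_(c | c \notin B) E c + 0) _; last by rewrite E0 addr0.
  rewrite -[X in _ = _ + X](H B) -big_split /pbd /=; apply: eq_bigr => c _.
  by rewrite TE /E scalerBr subrK.
have [bB|bB] := boolP (b \in B).
  rewrite big1 // => c cB; rewrite /E /G !inE bB orbT andbF addr0.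
  by rewrite lE ?subrr ?scaler0 //; apply: contraNneq cB => ->.
have ba : b != a by rewrite eq_sym.
have [aB|aB] := boolP (a \in B); last first.
  rewrite (bigD1 a) //= (bigD1 b) /=; last by rewrite bB ba.
  rewrite [X in _ + (_ + X)]big1 ?addr0 => [|c /andP[/andP[cB ca] cb]]; last first.
    rewrite /E /G !inE [a == c]eq_sym (negPf ca) (negPf aB) /= addr0.
    by rewrite lE // subrr scaler0.
  rewrite /E /G lE // lb !inE !eqxx /= andbF addr0 (negPf ba) (negPf bB) /= setU1K //.
  have e1 (x y : S) g : 'X_a * (x + g *: y) - 'X_a * x = g *: ('X_a * y).
    by rewrite mulrDr addrAC subrr add0r scalerAr.
  have e2 (y : S) : 'X_b * y - ('X_b + 'X_a) * y = - ('X_a * y).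
    by rewrite mulrDl opprD addrA subrr add0r.
  by rewrite e1 e2 scalerA mulrC divfK // scalerN subrr.
pose B0 := (B :\ a)%SET.
have BE : B = (a |: B0)%SET by rewrite finset.setD1K.
have aB0 : a \notin B0 by rewrite !inE eqxx.
have bB0 : b \notin B0 by rewrite !inE (negPf bB) andbF.
pose g := s b B0 / s a B0.
transitivity (g *: \sum_(c | c \notin (b |: B0)%SET)
    s c (b |: B0)%SET *: (l c * w (c |: (b |: B0))%SET)); last first.
  by rewrite H scaler0.
rewrite (bigD1 b) //= [in RHS](bigD1 a) /=; last by rewrite !inE negb_or a_neq_b eqxx.
rewrite scalerDr scaler_sumr; congr (_ + _).
  rewrite /E /G !inE eqxx /= andbF addr0 lb lE // -mulrBl opprD addrA subrr add0r.
  have -> : (b |: B = a |: (b |: B0))%SET by rewrite BE finset.setUCA.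
  rewrite mulNr scalerN -scaleNr scalerA; congr (_ *: _).
  apply: (mulfI (s0 a B0)); rewrite mulrN BE sC // opprK.
  by rewrite mulrA [s a B0 * g]mulrC /g divfK.
apply: eq_big => [c|c /andP[cB cb]].
  by rewrite BE !inE !negb_or; case: (c == a); case: (c == b); rewrite ?andbF ?andbT.
have ca : c != a by apply: contraNneq cB => ->.
have cB0 : c \notin B0 by rewrite !inE (negPf cB) andbF.
rewrite /E /G !inE aB orbT [b == c]eq_sym (negPf cb) (negPf bB) /= lE //.
have -> : ((c |: B) :\ a = c |: B0)%SET.
  by apply/setP => x; rewrite !inE; have [->|] := eqVneq x a; rewrite ?(eq_sym a) ?(negPf ca).
rewrite mulrDr addrAC subrr add0r finset.setUCA -scalerAr !scalerA; congr (_ *: _).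
have h1 := sC a c B0 aB0 cB0; rewrite eq_sym in h1; have {}h1 := h1 ca; rewrite -BE in h1.
have h2 := sC b c B0 bB0 cB0; rewrite eq_sym in h2; have {}h2 := h2 cb.
rewrite /g; apply: (mulfI (s0 a B0)).
transitivity (- (s c B0 * s b (c |: B0)%SET)).
  by rewrite [LHS]mulrA h1 mulNr -[X in - X]mulrA [X in _ * X]mulrC divfK.
by rewrite -h2 [RHS]mulrA [s a B0 * _]mulrC divfK.
Qed.

(** Triangularity: coordinates at sets that do not contain a without b receive no correction, and
    all corrections come from such coordinates. *)
Lemma transv_chain_inj v : transv_chain v = 0 -> v = 0.
Proof.
move=> v0; have h (A : {set 'I_n}) : ~~ ((a \in A) && (b \notin A)) -> v A = 0.
  move=> /negPf hA; have /ffunP/(_ A) := v0; rewrite !ffunE hA addr0 => e.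
  by rewrite -(transvK 1 (v A)) e (linear_0 (transv_linear _)).
apply/ffunP => A; rewrite ffunE.
have [hA|] := boolP ((a \in A) && (b \notin A)); last exact: h.
have /ffunP/(_ A) := v0; rewrite !ffunE hA (h (b |: A :\ a)%SET); last by rewrite !inE !eqxx /= ?andbF.
rewrite (linear_0 (transv_linear _)) scaler0 addr0 => e.
by rewrite -(transvK 1 (v A)) e (linear_0 (transv_linear _)).
Qed.

(** The image of the monomial ideal under the substitution, written as a preimage under the
    inverse. *)
Definition transv_ideal J : set S := [set p | mspan J (transv (- 1) p)].

Lemma is_ideal_transv J : up_set J -> is_ideal (transv_ideal J).
Proof.
move=> /(is_ideal_mspan (k := k)) [I0 ID IM]; have tL := transv_linear (- 1).
split=> [|p q hp hq|p q hq]; rewrite /transv_ideal /=.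
- by rewrite (linear_0 tL).
- by rewrite (linear_D tL); apply: ID.
- by rewrite transvM; apply: IM.
Qed.

Let transvNK p : transv 1 (transv (- 1) p) = p.
Proof. by rewrite -{1}[1](opprK (1 : k)) transvK. Qed.

Lemma hilbert_transv_ideal J d : up_set J ->
  hilbert (transv_ideal J) d = hilbert (mspan (k := k) J) d.
Proof.
move=> uJ; have h1 := is_ideal_mspan (k := k) uJ; have h2 := is_ideal_transv uJ.
rewrite !hilbert_hpart; apply/eqP; rewrite eqn_leq; apply/andP; split.
  apply: (fdim_inj_le (transv_linear (- 1))).
  - exact: subspace_hpart.
  - exact: subspace_hpart.
  - exact: spanned_hpart.
  - by move=> p [hp hd]; split=> //; apply: transv_homog.
  - by move=> p _ p0; rewrite -(transvNK p) p0 (linear_0 (transv_linear _)).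
apply: (fdim_inj_le (transv_linear 1)).
- exact: subspace_hpart.
- exact: subspace_hpart.
- exact: spanned_hpart.
- by move=> p [hp hd]; split; [rewrite /transv_ideal /= transvK|apply: transv_homog].
- by move=> p _ p0; rewrite -(transvK 1 p) p0 (linear_0 (transv_linear _)).
Qed.

Lemma fdim_pcyc_transv J i d : up_set J ->
  (fdim (pcyc s i (hpart (mspan J) d)) <= fdim (pcyc s i (hpart (transv_ideal J) d)))%N.
Proof.
move=> uJ; have h1 := is_ideal_mspan (k := k) uJ; have h2 := is_ideal_transv uJ.
have sP := subspace_hpart d h2.
apply: (fdim_inj_le transv_chain_linear).
- by apply: subspace_pcyc; apply: subspace_hpart.
- exact: subspace_pcyc.
- exact: spanned_pcyc (spanned_hpart _ _).
- move=> v [v1 v2 v3]; have tP (A : {set 'I_n}) : hpart (transv_ideal J) d (transv 1 (v A)).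
    by have [hv hd] := v1 A; split; [rewrite /transv_ideal /= transvK|apply: transv_homog].
  split=> [A|A Ai|]; last exact: pbd_transv_chain.
    rewrite ffunE addrC; case: ifP => _; last by rewrite add0r.
    exact: sP.2.
  have t0 := linear_0 (transv_linear 1).
  rewrite ffunE v2 // t0 add0r; case: ifP => // /andP[aA bA].
  rewrite v2 ?t0 ?scaler0 //.
  have -> : #|(b |: A :\ a)%SET| = #|A| by rewrite cardsU1 !inE (negPf bA) andbF (cardsD1 a A) aA.
  by [].
- by move=> v _; apply: transv_chain_inj.
Qed.

Definition move_exponent m : 'X_{1..n} :=
  [multinom (if i == a then m a + m b else if i == b then 0 else m i)%N | i < n].

(** Leading monomials are multiplicative, and x_b + x_a has leading monomial x_a because a < b. *)
Lemma mlead_transvX m : mlead (transv 1 'X_[m]) = move_exponent m.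
Proof.
have lX (i : 'I_n) : mlead (transv_form 1 i) = (if i == b then U_(a) else U_(i))%MM /\ transv_form 1 i != 0.
  rewrite /transv_form; case: eqP => [->|_]; last by rewrite addr0 mleadXm mpolyX_neq0.
  rewrite scale1r.
  have lt : ((U_(b)%MM : 'X_{1..n}) < U_(a)%MM)%O.
    apply/ltmcP; first by rewrite !mdeg1.
    exists a => [j ja|]; rewrite !mnm1E -!(inj_eq val_inj) /= ?eqxx ?(gtn_eqF ab) //.
    by rewrite (gtn_eqF ja) (gtn_eqF (ltn_trans ja ab)).
  have e : mlead ('X_b + 'X_a : S) = U_(a)%MM by rewrite mleadDr ?mleadXm.
  split=> //; rewrite -mleadc_eq0 e mcoeffD !mcoeffX eqxx.
  by rewrite (_ : (U_(b)%MM == U_(a)%MM :> 'X_{1..n}) = false) ?add0r ?oner_eq0 // (lt_eqF lt).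
rewrite transvX mlead_prod; last by move=> i _ _; rewrite expf_neq0 // (lX i).2.
apply/mnmP => c; rewrite mnm_sumE mnmE.
under eq_bigr => i _ do rewrite mleadX ?(lX i).2 // (lX i).1 mulmnE.
rewrite (bigD1 b) //= eqxx mnm1E.
have [ca|ca] := eqVneq c a.
  rewrite ca mul1n (bigD1 a) //= (negPf a_neq_b) mnm1E eqxx mul1n.
  rewrite big1 ?addn0 1?addnC // => i /andP[ib ia]; rewrite (negPf ib) mnm1E.
  by rewrite (negPf ia).
rewrite mul0n add0n.
have [cb|cb] := eqVneq c b.
  by rewrite big1 // => i ib; rewrite (negPf ib) mnm1E cb (negPf ib).
rewrite (bigD1 c) //= (negPf cb) mnm1E eqxx mul1n big1 ?addn0 // => i /andP[ib ic].
by rewrite (negPf ib) mnm1E (negPf ic).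
Qed.

End Transvection.

Section TransvectionStep.
Context {k : fieldType} {n : nat}.

Lemma transvection_step (a b : 'I_n) (s : 'I_n -> {set 'I_n} -> k) (J : 'X_{1..n} -> bool) :
  (a < b)%N -> sign_system s -> up_set J ->
  exists J', [/\ up_set J',
    forall d N, (d < N)%N -> crd N (deg_part d J') = crd N (deg_part d J),
    forall i d, (zdim s i (deg_part d J) <= zdim s i (deg_part d J'))%N
  & forall m, J m -> J' (move_exponent a b m)].
Proof.
move=> ab sS uJ; have hI : is_ideal (transv_ideal (k := k) a b J) by apply: is_ideal_transv.
have [uL cL zL] := initial_step hI.
exists (lead_ideal (transv_ideal (k := k) a b J)); split=> //.
- move=> d N dN; rewrite cL // hilbert_transv_ideal // (hilbert_lead_set (is_ideal_mspan uJ) dN).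
  by apply: eq_crd => m; rewrite lead_set_mspan.
- move=> i d; apply: leq_trans (zdim_le_pcyc d s i uJ) _.
  apply: leq_trans (fdim_pcyc_transv ab sS i d uJ) _.
  exact: zL.
- move=> m Jm; apply/lead_setP; exists (transv a b 1 'X_[m]).
  have t0 : transv a b 1 ('X_[m] : {mpoly k[n]}) != 0.
    apply/eqP => e0; have := transvK ab 1 ('X_[m] : {mpoly k[n]}).
    rewrite e0 (linear_0 (transv_linear _ _ _)) => /(congr1 (mcoeff m))/eqP.
    by rewrite mcoeff0 mcoeffX eqxx eq_sym oner_eq0.
  split=> //; last exact: mlead_transvX.
  split; first by rewrite /transv_ideal /= transvK //; apply/mspanX.
  rewrite -(mlead_transvX (k := k) ab m).
  have h : transv a b 1 ('X_[m] : {mpoly k[n]}) \is (mdeg m).-homog.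
    by apply: transv_homog; rewrite dhomogX /=.
  by rewrite /= (mdeg_mlead_homog h).
Qed.

End TransvectionStep.

Section MonomialIdeals.
Context {k : fieldType} {n : nat}.
Local Notation S := {mpoly k[n]}.
Implicit Types (V : 'X_{1..n} -> bool) (m : 'X_{1..n}).

Lemma ideal_gen_sub (G I : set S) : is_ideal I -> G `<=` I -> ideal_gen G `<=` I.
Proof. by move=> hI GI p; apply. Qed.

Lemma sub_ideal_gen (G : set S) : G `<=` ideal_gen G.
Proof. by move=> p Gp I [_]; apply. Qed.

Lemma is_ideal_gen (G : set S) : is_ideal (ideal_gen G).
Proof.
split=> [I [[I0 _ _] _]|p q hp hq I hI|a p hp I hI] //.
  by case: (hI) => -[_ ID _] _; apply: ID; [apply: hp|apply: hq].
by case: (hI) => -[_ _ IM] _; apply: IM; apply: hp.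
Qed.

Lemma mspan_sub V (I : set S) : is_ideal I -> (forall m, V m -> I 'X_[m]) -> mspan V `<=` I.
Proof.
move=> hI VI p hp; have [I0 ID] := subspace_ideal hI; rewrite (mpolyE p).
elim: (msupp p : seq _) => [|m l IH]; first by rewrite big_nil.
rewrite big_cons; case: (boolP (V m)) => [/VI Im|/hp ->]; first exact: ID.
by rewrite scale0r add0r.
Qed.

Lemma mspan_gen V : up_set V -> mspan V = ideal_gen [set 'X_[m] | m in [set m | V m]] :> set S.
Proof.
move=> uV; apply/seteqP; split.
  apply: mspan_sub; first exact: is_ideal_gen.
  by move=> m Vm; apply: sub_ideal_gen; exists m.
apply: ideal_gen_sub; first exact: is_ideal_mspan.
by move=> _ [m Vm <-]; apply/mspanX.
Qed.

(** For j < i, regularity puts f_j / gcd(f_i, f_j) in the ideal of the earlier monomials, so some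
    f_l divides it. If l = j, the gcd is 1; otherwise f_l divides f_j and, by induction, is disjoint
    from it, which contradicts its positive degree. *)
Lemma regular_monomials_disjoint r (f : 'I_r -> 'X_{1..n}) :
  (forall i, (0 < mdeg (f i))%N) -> regular_sequence (fun i => 'X_[f i] : S) ->
  forall i j : 'I_r, i != j -> forall a, (f i a == 0) || (f j a == 0)%N.
Proof.
move=> f0 [reg _].
suff H (N : nat) (i j : 'I_r) : (i < N)%N -> (j < i)%N -> forall a, (f i a == 0) || (f j a == 0)%N.
  move=> i j; rewrite -(inj_eq val_inj) /= neq_ltn => /orP[h|h] a; last exact: (H r).
  by rewrite orbC; apply: (H r).
elim: N i j => [//|N IH] i j iN ji a.
pose V m := [exists l : 'I_r, (l < i)%N && (f l <= m)%MM].
have uV : up_set V.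
  move=> m c /existsP[l /andP[li lm]]; apply/existsP; exists l; rewrite li /=.
  by apply: lepm_trans lm _; apply: lem_addr.
pose G := [set ('X_[f l] : S) | l in [set l : 'I_r | (l < i)%N]].
(* Truncated subtraction: f_j divided by its gcd with f_i, so that f_i g is a multiple of f_j. *)
pose g := (f j - f i)%MM.
have hg : ideal_gen G ('X_[f i] * 'X_[g]).
  rewrite -mpolyXD (_ : (f i + g = f i - f j + f j)%MM); last first.
    by apply/mnmP => c; rewrite !mnmDE !mnmBE; lia.
  rewrite mpolyXD; case: (is_ideal_gen G) => _ _; apply.
  by apply: sub_ideal_gen; exists j.
have GV : G `<=` mspan V.
  by move=> _ [l li <-]; apply/mspanX/existsP; exists l; rewrite lepm_refl andbT.
have /mspanX/existsP[l /andP[li lg]] := ideal_gen_sub (is_ideal_mspan uV) GV (reg i 'X_[g] hg).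
have lgE c : (f l c <= f j c - f i c)%N by have := mnm_lepP lg c; rewrite mnmBE.
have [lj|lj] := eqVneq l j; first by have := lgE a; rewrite lj; lia.
have dis c : (f l c == 0) || (f j c == 0)%N.
  move: lj; rewrite -(inj_eq val_inj) /= neq_ltn => /orP[h|h].
    by rewrite orbC; apply: IH => //; lia.
  by apply: IH => //; lia.
have := f0 l; rewrite mdegE big1 // => c _.
by have := dis c; have := lgE c; lia.
Qed.

End MonomialIdeals.

Section Collapse.
Context {k : fieldType} {n r : nat}.
Variable s : 'I_n -> {set 'I_n} -> k.
Hypothesis sS : sign_system s.
Variable f : 'I_r -> 'X_{1..n}.
Hypothesis f_gt0 : forall i, (0 < mdeg (f i))%N.
Hypothesis f_disj : forall i j : 'I_r, i != j -> forall a, (f i a == 0) || (f j a == 0)%N.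

Lemma mdeg_move_exponent (a b : 'I_n) m : a != b -> mdeg (move_exponent a b m) = mdeg m.
Proof.
move=> ab; have : (move_exponent a b m + U_(b) *+ m b = m + U_(a) *+ m b)%MM.
  apply/mnmP => c; rewrite !mnmDE !mulmnE !mnm1E mnmE [a == c]eq_sym [b == c]eq_sym.
  have [->|ca] := eqVneq c a; first by rewrite (negPf ab) mul1n mul0n addn0.
  have [->|cb] := eqVneq c b; first by rewrite mul1n mul0n addn0.
  by [].
by move/(congr1 mdeg); rewrite !mdegD !mdegMn !mdeg1; lia.
Qed.

(* Within the support of each f i, all exponents are moved to the smallest
   variable a i, which turns f i into a pure power. *)
Lemma collapse_pure (J : 'X_{1..n} -> bool) : up_set J -> (forall i, J (f i)) ->
  exists (a : 'I_r -> 'I_n) J', [/\ injective a, up_set J',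
    forall d N, (d < N)%N -> crd N (deg_part d J') = crd N (deg_part d J),
    forall i d, (zdim s i (deg_part d J) <= zdim s i (deg_part d J'))%N
  & forall i, J' (U_(a i) *+ mdeg (f i))%MM].
Proof.
move=> uJ Jf.
have exa i : exists c, (0 < f i c)%N /\ forall c', (0 < f i c')%N -> (c <= c')%N.
  have [c0 hc0] := mdeg_gt0 (f_gt0 i).
  by case: (@arg_minnP _ c0 (fun c => 0 < f i c)%N (fun c => val c) hc0) => c hc hmin; exists c.
have [a ha] := choice exa.
have same i i' c : (0 < f i c)%N -> (0 < f i' c)%N -> i = i'.
  move=> h h'; apply/eqP; apply: contraT => /f_disj/(_ c); lia.
have ainj : injective a.
  by move=> i i' e; apply: (same _ _ (a i)); [case: (ha i)|rewrite e; case: (ha i')].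
(* The target of the variable b: the smallest variable of the one f_i that contains b, or b
   itself. *)
pose g b := if [pick i | (0 < f i b)%N] is Some i then a i else b.
have gE i b : (0 < f i b)%N -> g b = a i.
  by move=> h; rewrite /g; case: pickP => [i' h'|/(_ i)]; [rewrite (same _ _ _ h' h)|rewrite h].
(* Variables are treated one at a time; the invariant keeps a monomial of the degree of f_i,
   supported within f_i and cleared at all treated variables but [a i]. *)
suff [J' [uJ' cJ' zJ' hJ']] : exists J', [/\ up_set J',
    forall d N, (d < N)%N -> crd N (deg_part d J') = crd N (deg_part d J),
    forall i d, (zdim s i (deg_part d J) <= zdim s i (deg_part d J'))%N
  & forall i, exists m, [/\ J' m, mdeg m = mdeg (f i), forall c, f i c = 0%N -> m c = 0%N
      & forall c, c \in enum 'I_n -> c != a i -> m c = 0%N]].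
  exists a, J'; split=> // i; have [m [Jm dm _ hm]] := hJ' i.
  suff -> : (U_(a i) *+ mdeg (f i))%MM = m by [].
  apply/mnmP => c; rewrite mulmnE mnm1E; have [<-|ca] := eqVneq (a i) c; last first.
    by rewrite mul0n hm // ?mem_enum // eq_sym.
  rewrite mul1n -dm mdegE (bigD1 (a i)) //= big1 ?addn0 // => c' c'a.
  by rewrite hm // mem_enum.
elim: (enum 'I_n) => [|b l [J' [uJ' cJ' zJ' hJ']]].
  by exists J; split=> // i; exists (f i).
have [gb|gb] := ltnP (g b) b; last first.
  exists J'; split=> // i; have [m [Jm dm m0 hm]] := hJ' i; exists m; split=> // c.
  rewrite inE => /orP[/eqP -> ba|]; last exact: hm.
  have [/m0 //|fb] := posnP (f i b); rewrite (gE _ _ fb) in gb.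
  have := (ha i).2 b fb => ab; case/negP: ba; apply/eqP/val_inj/eqP.
  by rewrite eqn_leq gb ab.
have [J2 [uJ2 cJ2 zJ2 hJ2]] := transvection_step gb sS uJ'.
have gbn : g b != b by apply: contraTneq gb => ->; rewrite ltnn.
exists J2; split=> // [d N dN|i d|i]; first by rewrite cJ2 // cJ'.
  exact: leq_trans (zJ' i d) (zJ2 i d).
have [m [Jm dm m0 hm]] := hJ' i; exists (move_exponent (g b) b m); split.
- exact: hJ2.
- by rewrite mdeg_move_exponent.
- move=> c fc; rewrite mnmE; have [cg|cg] := eqVneq c (g b); last by rewrite m0 // if_same.
  have [/m0 mb|fb] := posnP (f i b); first by rewrite -cg m0 // mb.
  by move: fc; rewrite cg (gE _ _ fb); have := (ha i).1; lia.
- move=> c; rewrite inE mnmE => /orP[/eqP ->|cl] ca.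
    by rewrite eq_sym (negPf gbn) eqxx.
  have [cg|cg] := eqVneq c (g b); last by rewrite hm // if_same.
  have [/m0 mb|fb] := posnP (f i b); first by rewrite -cg hm // mb.
  by rewrite cg (gE _ _ fb) eqxx in ca.
Qed.

End Collapse.

Section Permutation.
Context {k : fieldType} {n : nat}.
Variable sigma : 'S_n.
Implicit Types (m : 'X_{1..n}) (J : 'X_{1..n} -> bool) (B : {set 'I_n}).

Definition perm_mon m : 'X_{1..n} := [multinom m ((sigma^-1)%g c) | c < n].

Definition perm_sign (s : 'I_n -> {set 'I_n} -> k) (a : 'I_n) B : k := s (sigma a) (sigma @: B)%SET.

Lemma perm_mon_inj : injective perm_mon.
Proof.
move=> m m' e; apply/mnmP => c; have /mnmP/(_ (sigma c)) := e.
by rewrite !mnmE permK.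
Qed.

Lemma mdeg_perm_mon m : mdeg (perm_mon m) = mdeg m.
Proof.
rewrite !mdegE (reindex_inj (@perm_inj _ sigma)) /=.
by apply: eq_bigr => c _; rewrite mnmE permK.
Qed.

Lemma perm_monU a c : perm_mon (U_(a) *+ c)%MM = (U_(sigma a) *+ c)%MM.
Proof.
apply/mnmP => b; rewrite mnmE !mulmnE !mnm1E; congr (nat_of_bool _ * _)%N.
by rewrite -(inj_eq (@perm_inj _ sigma)) permKV.
Qed.

Lemma perm_mon_surj m : exists m', m = perm_mon m'.
Proof.
exists [multinom m (sigma c) | c < n]; apply/mnmP => c.
by rewrite !mnmE permKV.
Qed.

Lemma crd_perm N J : crd N (fun m => J (perm_mon m)) = crd N J.
Proof.
have h : perm_eq (map perm_mon (mons N)) (mons N).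
  apply: uniq_perm; rewrite ?uniq_mons ?(map_inj_uniq perm_mon_inj) ?uniq_mons // => m.
  have [m' ->] := perm_mon_surj m; rewrite (mem_map perm_mon_inj) !mem_mons.
  by rewrite mdeg_perm_mon.
by rewrite /crd; have /seq.permP/(_ J) := h; rewrite count_map.
Qed.

Lemma up_set_perm J : up_set J -> up_set (fun m => J (perm_mon m)).
Proof.
move=> uJ m a /(uJ _ (sigma a)).
rewrite (_ : (perm_mon m + U_(sigma a))%MM = perm_mon (m + U_(a))%MM) //.
apply/mnmP => c; rewrite mnmDE !mnmE; congr (_ + nat_of_bool _)%N.
by rewrite -[in RHS](inj_eq (@perm_inj _ sigma)) permKV.
Qed.

Variable s : 'I_n -> {set 'I_n} -> k.
Hypothesis sS : sign_system s.

Lemma perm_sign_system : sign_system (perm_sign s).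
Proof.
case: sS => s0 sC; split=> [a B|a b B aB bB ab]; first exact: s0.
by rewrite /perm_sign !imsetU1 sC ?mem_imset // ?(inj_eq perm_inj) //; apply: perm_inj.
Qed.

(** Renaming the generators e_A changes the signs, which is why the final comparison involves two
    sign systems. *)
Lemma zdim_perm i d J :
  (zdim s i (deg_part d J) <= zdim (perm_sign s) i (deg_part d (fun m => J (perm_mon m))))%N.
Proof.
pose h (u : @chain k n) : @chain k n := fun x => u ((sigma @: x.1)%SET, perm_mon x.2).
have hL : linear h by [].
have cS B : #|(sigma @: B)%SET| = #|B| by rewrite card_imset //; apply: perm_inj.
have bh u B m : bd (perm_sign s) (h u) (B, m) = bd s u ((sigma @: B)%SET, perm_mon m).
  rewrite /bd /= [RHS](reindex_inj (@perm_inj _ sigma)) /=.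
  apply: eq_big => [a|a _].
    by rewrite mem_imset ?mnmE ?permK //; apply: perm_inj.
  rewrite /perm_sign /h /= imsetU1; congr (_ * u (_, _)).
  apply/mnmP => c; rewrite mnmBE !mnmE; congr (_ - nat_of_bool _)%N.
  by rewrite -[in LHS](inj_eq (@perm_inj _ sigma)) permKV.
apply: (fdim_inj_le hL).
- exact: subspace_K.
- exact: subspace_K.
- by apply: (@spanned_K _ _ d.+1); apply: bounded_deg_part.
- move=> u [hu bu]; split=> [[B m] /= nh|B m _]; last by rewrite bh bu.
  by apply: hu; move: nh; rewrite /= /deg_part cS mdeg_perm_mon.
- move=> u _ u0; apply/funext => -[B m].
  have [m' ->] := perm_mon_surj m.
  have := congr1 (fun v : chain => v ((sigma^-1%g @: B)%SET, m')) u0.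
  rewrite /h /= chain0E; congr (u (_, _) = _).
  by rewrite -imset_comp (eq_imset (g := id)) ?imset_id // => c; rewrite /= permKV.
Qed.

End Permutation.

Lemma extend_perm r n (hr : (r <= n)%N) (a : 'I_r -> 'I_n) : injective a ->
  exists sigma : 'S_n, forall i, sigma (widen_ord hr i) = a i.
Proof.
move=> ai; pose l := map a (enum 'I_r) ++ [seq x <- enum 'I_n | x \notin codom a].
have ul : uniq l.
  rewrite cat_uniq map_inj_uniq ?enum_uniq // filter_uniq ?enum_uniq // andbT /=.
  apply/hasPn => x; rewrite mem_filter => /andP[xa _]; apply: contra xa => /mapP[i _ ->].
  exact: codom_f.
have sl : size l = n.
  rewrite -[RHS](size_enum_ord n); apply: perm_size; apply: uniq_perm; rewrite ?enum_uniq // => x.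
  rewrite mem_enum mem_cat mem_filter mem_enum andbT.
  by rewrite (_ : (x \in map a _) = (x \in codom a)) // orbN.
have inj : injective (fun c : 'I_n => nth c l c).
  move=> c c'; rewrite (set_nth_default c') ?sl // => /eqP.
  by rewrite nth_uniq ?sl // => /eqP /val_inj.
exists (perm inj) => i; rewrite permE /= nth_cat size_map size_enum_ord ltn_ord.
by rewrite (nth_map i) ?size_enum_ord // nth_ord_enum.
Qed.

(** * Lex-plus-powers ideals *)

Section LexPlusPowers.
Context {k : fieldType} {n r : nat}.
Local Notation S := {mpoly k[n]}.
Variable hr : (r <= n)%N.
Variable e : 'I_r -> nat.
Hypothesis e_mono : forall i j : 'I_r, (i <= j)%N -> (e i <= e j)%N.
Implicit Types (m : 'X_{1..n}) (J L : 'X_{1..n} -> bool).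

Definition powers m : bool := [exists i : 'I_r, (e i <= m (widen_ord hr i))%N].

Lemma up_set_powers : up_set powers.
Proof.
move=> m a /existsP[i h]; apply/existsP; exists i; rewrite mnmDE.
exact: leq_trans h (leq_addr _ _).
Qed.

Lemma mpolyX_pow (a : 'I_n) c : ('X_a : S) ^+ c = 'X_[U_(a) *+ c].
Proof. by rewrite mpolyXn. Qed.

Lemma pure_powers_mspan : pure_powers hr e = mspan (k := k) powers.
Proof.
apply/seteqP; split.
  apply: ideal_gen_sub; first by apply: is_ideal_mspan; apply: up_set_powers.
  move=> _ [i _ <-]; rewrite /= mpolyX_pow; apply/mspanX/existsP; exists i.
  by rewrite mulmnE mnm1E eqxx mul1n.
apply: mspan_sub; first exact: is_ideal_gen.
move=> m /existsP[i]; rewrite -lepm_mulU => hm.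
rewrite -(submK hm) mpolyXD.
case: (is_ideal_gen (range (fun i : 'I_r => ('X_(widen_ord hr i) : S) ^+ e i))) => _ _.
by apply; apply: sub_ideal_gen; exists i; rewrite //= mpolyX_pow.
Qed.

(* In degrees below D, the box bounded by D in the variables without a power
   has the same monomials as the unbounded one. *)
Definition box_below D (c : 'I_n) : nat :=
  if insub (c : nat) is Some i then e i else (\max_i e i + D)%N.

Lemma box_below_lt D (i : 'I_r) : box_below D (widen_ord hr i) = e i.
Proof. by rewrite /box_below /= valK. Qed.

Lemma box_below_mono D : monotone_box (box_below D).
Proof.
move=> a b ab; rewrite /box_below; case: insubP => [i _ ia|ar]; case: insubP => [j _ jb|bj] //.
- by apply: e_mono; rewrite ia jb.
- by apply: leq_trans (leq_addr _ _); apply: leq_bigmax.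
- by rewrite -jb in ab; case/negP: ar; apply: leq_ltn_trans ab (ltn_ord j).
Qed.

Lemma inbox_below D m : (mdeg m < D)%N -> inbox (box_below D) m = ~~ powers m.
Proof.
move=> mD; apply/inboxP/existsPn => [h i|h c].
  by have := h (widen_ord hr i); rewrite box_below_lt ltnNge.
rewrite /box_below; case: insubP => [i _ ic|_].
  have -> : c = widen_ord hr i by apply: val_inj; rewrite /= ic.
  by have := h i; rewrite -ltnNge.
apply: leq_ltn_trans (leq_trans mD (leq_addl _ _)).
by rewrite mdegE (bigD1 c) //= leq_addr.
Qed.

Variable J : 'X_{1..n} -> bool.
Hypotheses (uJ : up_set J) (JP : forall m, powers m -> J m).

Let T d m := ~~ powers m && (mdeg m == d).

Lemma exists_lexification : exists Q : nat -> 'X_{1..n} -> bool, forall d,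
  islex (T d) (Q d) /\ crd d.+1 (Q d) = crd d.+1 (fun m => J m && T d m).
Proof.
have ex d : exists Qd, islex (T d) Qd /\ crd d.+1 Qd = crd d.+1 (fun m => J m && T d m).
  apply: islex_exists; last by move=> m /andP[_ /eqP ->].
  by apply: crd_le => m /andP[].
by have [Q hQ] := choice ex; exists Q.
Qed.

Variable Q : nat -> 'X_{1..n} -> bool.
Hypothesis hQ : forall d, islex (T d) (Q d) /\ crd d.+1 (Q d) = crd d.+1 (fun m => J m && T d m).

Definition lexified m : bool := powers m || Q (mdeg m) m.

Let L := lexified.
(** With all monomials of degree at least [D] added, every monomial outside the finite box
    [box_below D] belongs to the set, even one that leaves it through a variable without a power. *)
Let below D V m : bool := V m || (D <= mdeg m)%N.

Let LT d m : (L m && T d m) = Q d m.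
Proof.
apply/andP/idP => [[/orP[Pm|Qm] /andP[nP /eqP dm]]|Qm]; first by rewrite Pm in nP.
  by rewrite -dm.
have Tm := (hQ d).1.1 m Qm; have /andP[_ /eqP dm] := Tm.
by split=> //; rewrite /L /lexified dm Qm orbT.
Qed.

Let TboxE D d m : (d < D)%N -> Tbox (box_below D) d 0 m = T d m.
Proof.
move=> dD; rewrite /Tbox /T addn0; case: eqP => [dm|]; last by rewrite !andbF.
by rewrite inbox_below ?dm.
Qed.

Let belowJ D m : ~~ inbox (box_below D) m -> below D J m.
Proof.
move=> h; rewrite /below; case: leqP => [|mD]; rewrite ?orbT // orbF.
by apply: JP; rewrite inbox_below // negbK in h.
Qed.

Let belowL D m : ~~ inbox (box_below D) m -> below D L m.
Proof.
move=> h; rewrite /below; case: leqP => [|mD]; rewrite ?orbT // orbF.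
by rewrite inbox_below // negbK in h; rewrite /L /lexified h.
Qed.

Let belowT (V : 'X_{1..n} -> bool) D d m : (d < D)%N ->
  (below D V m && Tbox (box_below D) d 0 m) = V m && T d m.
Proof.
move=> dD; rewrite TboxE // /below; case: (boolP (T d m)) => [/andP[_ /eqP ->]|]; last by rewrite !andbF.
by rewrite leqNgt dD orbF.
Qed.

Let below_lex D d : islex (Tbox (box_below D) d 0)
  (fun m => below D L m && Tbox (box_below D) d 0 m).
Proof.
have [dD|Dd] := ltnP d D.
  have -> : (fun m => below D L m && Tbox (box_below D) d 0 m) = Q d.
    by apply/funext => m; rewrite belowT // LT.
  have -> : Tbox (box_below D) d 0 = T d by apply/funext => m; rewrite TboxE.
  exact: (hQ d).1.
split=> [m /andP[] //|u v _ Tv _]; rewrite Tv andbT /below.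
by have /andP[_ /eqP] := Tv; rewrite addn0 => ->; rewrite Dd orbT.
Qed.

Let below_crd D d : crd d.+1 (fun m => below D J m && Tbox (box_below D) d 0 m) =
  crd d.+1 (fun m => below D L m && Tbox (box_below D) d 0 m).
Proof.
have [dD|Dd] := ltnP d D.
  rewrite (eq_crd _ (fun m => belowT J m dD)) (eq_crd _ (fun m => belowT L m dD)).
  by rewrite -(hQ d).2; apply: eq_crd => m; rewrite LT.
by apply: eq_crd => m; rewrite /below /Tbox addn0; case: eqP => [->|]; rewrite ?andbF // Dd !orbT.
Qed.

Lemma up_set_lexified : up_set L.
Proof.
(* m and its product with x_a both have degree below [D], where [below] adds nothing. *)
move=> m a Lm; pose D := (mdeg m).+2.
have h := lex_up_set (k := k) (@box_below_mono D) (@belowL D) (@below_lex D) (@below_crd D).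
have uJD : up_set (below D J).
  move=> u c /orP[Ju|Du]; first by rewrite /below uJ.
  by rewrite /below mdegD mdeg1 addn1 ltnW ?orbT.
have /orP[//|] := h uJD m a (introT orP (or_introl Lm)).
by rewrite mdegD mdeg1 addn1 /D ltnn.
Qed.

Lemma zdim_lexified_le (s s' : 'I_n -> {set 'I_n} -> k) i d : sign_system s -> sign_system s' ->
  (zdim (k := k) s i (deg_part d J) <= zdim s' i (deg_part d L))%N.
Proof.
move=> sS sS'; pose D := d.+1.
have dE (V : 'X_{1..n} -> bool) : deg_part d V = deg_part d (below D V).
  by apply/funext => m; rewrite /deg_part /below; case: eqP => [->|]; rewrite ?andbF // ltnn orbF.
rewrite dE (dE L).
exact: (zdim_lex_le (@box_below_mono D) (@belowJ D) (@belowL D) (@below_lex D) (@below_crd D)).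
Qed.

Lemma crd_lexified d : crd d.+1 (deg_part d J) = crd d.+1 (deg_part d L).
Proof.
have h (V : 'X_{1..n} -> bool) : (forall m, powers m -> V m) ->
    crd d.+1 (deg_part d V) = (crd d.+1 (deg_part d powers) + crd d.+1 (fun m => V m && T d m))%N.
  move=> PV; rewrite -(@crd_diff _ d.+1 (deg_part d powers) (deg_part d V)).
    congr (_ + _)%N; apply: eq_crd => m; rewrite /deg_part /T.
    by case: (mdeg m == d); rewrite ?andbF ?andbT.
  by move=> m /andP[/PV Vm dm]; apply/andP.
rewrite (h J) // (h L); last by move=> m Pm; rewrite /L /lexified Pm.
by congr (_ + _)%N; rewrite -(hQ d).2; apply: eq_crd => m; rewrite LT.
Qed.

(** The lex summand of the lex-plus-powers ideal: the monomials above may be in [L] through the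
    segments or through the powers. *)
Definition lex_core m : bool := `[< forall v, mdeg v = mdeg m -> (m <= v)%O -> L v >].

Lemma lex_core_sub m : lex_core m -> L m.
Proof. by move/asboolP; apply. Qed.

Lemma lexified_core m : L m -> powers m || lex_core m.
Proof.
move=> Lm; apply/orP; case: (boolP (powers m)) => [|nP]; [by left|right].
have Qm : Q (mdeg m) m by move: Lm; rewrite /L /lexified (negPf nP).
apply/asboolP => v dv mv; rewrite /L /lexified; case: (boolP (powers v)) => //= nPv.
move: mv; rewrite le_eqVlt => /orP[/eqP <- //|mv].
by rewrite dv; apply: (hQ (mdeg m)).1.2 Qm _ mv; rewrite /T nPv dv eqxx.
Qed.

(** If v / x_b were below m, equal degrees and the absence of variables of v after b would place
    their first difference before b, and it would persist between v and x_a m. *)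
Lemma sub_last_variable m v (a b : 'I_n) : mdeg v = (mdeg m).+1 -> ((m + U_(a))%MM <= v)%O ->
  (0 < v b)%N -> (forall c : 'I_n, (b < c)%N -> v c = 0%N) -> (m <= (v - U_(b))%MM)%O.
Proof.
move=> dv mv vb vmax; rewrite leNgt; apply/negP => lt; move: mv; rewrite leNgt; case/negP.
have dw : mdeg (v - U_(b))%MM = mdeg m by have := mdeg_sub vb; rewrite dv => -[].
have [i hi lti] : exists2 i : 'I_n,
    (forall j : 'I_n, (j < i)%N -> (v - U_(b))%MM j = m j) & ((v - U_(b))%MM i < m i)%N.
  exact/(ltmcP dw).
have ib : (i < b)%N.
  rewrite ltnNge; apply/negP => bi.
  have : (mdeg (v - U_(b))%MM < mdeg m)%N; last by rewrite dw ltnn.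
  rewrite !mdegE (bigD1 i) //= [X in (_ < X)%N](bigD1 i) //= -addSn leq_add //.
  apply: leq_sum => c ci; case: (ltnP c i) => h; first by rewrite hi.
  rewrite mnmBE vmax //; apply: leq_ltn_trans bi _.
  by rewrite ltn_neqAle h andbT eq_sym.
have vE (j : 'I_n) : (j < b)%N -> (v - U_(b))%MM j = v j.
  by move=> jb; rewrite mnmBE mnm1E -(inj_eq val_inj) /= (gtn_eqF jb) subn0.
have de : mdeg v = mdeg (m + U_(a))%MM by rewrite mdegD mdeg1 addn1.
apply/(ltmcP de); have [ai|ia] := ltnP a i.
  exists a => [j ja|]; rewrite mnmDE mnm1E.
    rewrite -(inj_eq val_inj) /= (gtn_eqF ja) addn0 -hi ?vE //; last exact: ltn_trans ja ai.
    exact: ltn_trans ja (ltn_trans ai ib).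
  by rewrite eqxx addn1 -hi // vE // (ltn_trans ai ib).
exists i => [j ji|]; last by rewrite mnmDE -vE // ltn_addr.
rewrite mnmDE mnm1E -(inj_eq val_inj) /= (gtn_eqF (leq_trans ji ia)) addn0 -hi // vE //.
exact: ltn_trans ji ib.
Qed.

(** By [sub_last_variable], every v above x_a m in its degree is a multiple of a monomial above m,
    which is in [L]. *)
Lemma up_set_lex_core : up_set lex_core.
Proof.
move=> m a /asboolP hm; apply/asboolP => v dv mv.
have {}dv : mdeg v = (mdeg m).+1 by rewrite dv mdegD mdeg1 addn1.
have [|c0 hc0] := @mdeg_gt0 _ v; first by rewrite dv.
have [b vb bmax] := @arg_maxnP _ c0 (fun c => 0 < v c)%N (fun c => val c) hc0.
rewrite -(submUK vb); apply: up_set_lexified; apply: hm.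
  by have := mdeg_sub vb; rewrite dv => -[].
apply: (sub_last_variable dv mv vb) => c bc; apply/eqP; rewrite -leqn0 leqNgt.
by apply/negP => /bmax /=; apply/negP; rewrite -ltnNge.
Qed.

Lemma lex_ideal_core : lex_ideal (mspan (k := k) lex_core).
Proof.
split.
  by exists [set m | lex_core m]; apply: mspan_gen; apply: up_set_lex_core.
move=> u v duv [i [lt eqi]] /mspanX/asboolP hu; apply/mspanX/asboolP => w dw vw.
apply: hu; first by rewrite dw.
apply: ltW; apply: lt_le_trans vw; apply/(ltmcP duv); exists i => // j ji.
by rewrite eqi.
Qed.

Lemma lex_plus_lexified : lex_plus (pure_powers hr e) (mspan (k := k) L).
Proof.
have hI := is_ideal_mspan (k := k) up_set_lexified.
have PL : pure_powers hr e `<=` mspan (k := k) L.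
  rewrite pure_powers_mspan; apply: mspan_sub => // m Pm.
  by apply/mspanX; rewrite /L /lexified Pm.
split=> //; exists (mspan lex_core); first exact: lex_ideal_core.
have [I0 ID _] := hI.
apply/seteqP; split; last first.
  move=> _ [p hp [q hq <-]]; apply: ID; last exact: PL.
  by move=> m nL; apply: hp; apply: contra nL; apply: lex_core_sub.
have [C0 CD] : subspace (mspan (k := k) lex_core).
  by apply: subspace_ideal; apply: is_ideal_mspan; apply: up_set_lex_core.
have [P0 PD] : subspace (pure_powers (k := k) hr e).
  by apply: subspace_ideal; apply: is_ideal_gen.
move=> p hp; rewrite (mpolyE p).
elim: (msupp p : seq _) => [|m l [x hx [y hy xy]]].
  by rewrite big_nil; exists 0 => //; exists 0 => //; rewrite addr0.
rewrite big_cons -xy; case: (boolP (L m)) => [|/hp ->]; last first.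
  by rewrite scale0r add0r; exists x => //; exists y.
case/lexified_core/orP => hm.
  exists x => //; exists (p@_m *: 'X_[m] + y); last by rewrite addrCA.
  by apply: PD => //; rewrite pure_powers_mspan; apply/mspanX.
by exists (p@_m *: 'X_[m] + x); [apply: CD => //; apply/mspanX|exists y => //; rewrite addrA].
Qed.

End LexPlusPowers.

Theorem theorem8p1 (k : fieldType) (n r : nat) (hr : (r <= n)%N)
  (e : 'I_r -> nat)
  (he2 : forall i, (2 <= e i)%N)
  (hemono : forall i j : 'I_r, (i <= j)%N -> (e i <= e j)%N)
  (I : set {mpoly k[n]})
  (hI : homogeneous_ideal I)
  (f : 'I_r -> 'X_{1..n})
  (hfdeg : forall i, mdeg (f i) = e i)
  (hfreg : regular_sequence (fun i => 'X_[f i] : {mpoly k[n]}))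
  (hfI : forall i, I 'X_[f i]) :
  exists L : set {mpoly k[n]},
    [/\ lex_plus (pure_powers hr e) L,
        forall d, hilbert L d = hilbert I d
      & forall i j, (betti I i j <= betti L i j)%N].

Proof.
have [iI _] := hI; have sS := koszul_sign_system k n.
have [uJ0 cJ0 zJ0] := initial_step iI.
have Jf i : lead_ideal I (f i).
  apply/lead_setP; exists 'X_[f i]; split; last exact: mleadXm.
    by split=> //=; rewrite dhomogX /=.
  exact: mpolyX_neq0.
have f_gt0 i : (0 < mdeg (f i))%N by rewrite hfdeg; apply: leq_trans (he2 i).
have f_disj := regular_monomials_disjoint f_gt0 hfreg.
have [a [J1 [ainj uJ1 cJ1 zJ1 J1f]]] := collapse_pure sS f_gt0 f_disj uJ0 Jf.
have [sigma sigmaE] := extend_perm hr ainj.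
(* [perm_mon sigma] carries the i-th variable to [a i], so the pure powers in [J1] become powers of
   the first r variables. *)
pose J2 m := J1 (perm_mon sigma m).
have uJ2 : up_set J2 by apply: up_set_perm.
have JP m : powers hr e m -> J2 m.
  move=> /existsP[i]; rewrite -lepm_mulU => hm; rewrite -(submK hm); apply: (up_set_add _ uJ2).
  by rewrite /J2 perm_monU sigmaE -hfdeg; apply: J1f.
have [Q hQ] := exists_lexification hr e J2.
pose L := lexified hr e Q.
have uL : up_set L := @up_set_lexified k n r hr e hemono J2 uJ2 Q hQ.
have iL := is_ideal_mspan (k := k) uL.
have hil d : hilbert (mspan (k := k) L) d = hilbert I d.
  rewrite (hilbert_lead_set iL (ltnSn d)) -(cJ0 d d.+1) // -(cJ1 d d.+1) //.
  rewrite (eq_crd _ (lead_set_mspan L d)) -(crd_lexified JP hQ).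
  rewrite -[RHS](crd_perm sigma); apply: eq_crd => m.
  by rewrite /deg_part mdeg_perm_mon.
exists (mspan L); split=> //; first exact: (lex_plus_lexified hemono uJ2 hQ).
apply: betti_le => // i d.
(* The last step of this chain also trades the permuted signs for the Koszul signs. *)
apply: leq_trans (zdim_le_pcyc d (koszul_sign k (n := n)) i uL).
apply: leq_trans (zJ0 _ _ _) _; apply: leq_trans (zJ1 _ _) _.
apply: leq_trans (zdim_perm sigma _ _ _ _) _.
exact: (zdim_lexified_le hemono JP hQ _ _ (perm_sign_system sigma sS) sS).
Qed.
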